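(* Let $m, d \in \mathbb{N}$, let $\mathbb{T}$ be either $\mathbb{R}$ or $\mathbb{Z}$, and let $\{\mathbf{Z}(\mathbf{x};t),\ \mathbf{x}\in\mathbb{S}^d,\ t\in\mathbb{T}\}$ be an $m$-variate random field that is isotropic and mean square continuous over $\mathbb{S}^d$ and stationary on $\mathbb{T}$, with covariance matrix function $\mathbf{C}(\vartheta;t)$. Then $\frac{\mathbf{C}(\vartheta;t)+\mathbf{C}(\vartheta;-t)}{2}$ is of the form $$\frac{\mathbf{C}(\vartheta;t)+\mathbf{C}(\vartheta;-t)}{2}=\begin{cases}\displaystyle\sum_{n=0}^\infty \mathbf{B}_n(t)\cos(n\vartheta), & d=1,\\[2mm] \displaystyle\sum_{n=0}^\infty \mathbf{B}_n(t)\,P_n^{\left(\frac{d-1}{2}\right)}(\cos\vartheta), & d\ge 2,\end{cases}\qquad \vartheta\in[0,\pi],\ t\in\mathbb{T},$$ where, for each fixed $t\in\mathbb{T}$, $\mathbf{B}_n(t)$ ($n\in\mathbb{N}_0$) are $m\times m$ symmetric matrices and $\sum_{n=0}^\infty \mathbf{B}_n(t)$ (if $d=1$) or $\sum_{n=0}^\infty \mathbf{B}_n(t)P_n^{\left(\frac{d-1}{2}\right)}(1)$ (if $d\ge2$) converges, and, for each fixed $n\in\mathbb{N}_0$, $\mathbf{B}_n(t)$ is a stationary covariance matrix function on $\mathbb{T}$. In particular, when $\mathbf{C}(\vartheta;t)$ is spatio-temporal symmetric in the sense that $\mathbf{C}(\vartheta;-t)=\mathbf{C}(\vartheta;t)$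 for all $\vartheta\in[0,\pi]$, $t\in\mathbb{T}$, it takes the form $$\mathbf{C}(\vartheta;t)=\begin{cases}\displaystyle\sum_{n=0}^\infty \mathbf{B}_n(t)\cos(n\vartheta), & d=1,\\[2mm] \displaystyle\sum_{n=0}^\infty \mathbf{B}_n(t)\,P_n^{\left(\frac{d-1}{2}\right)}(\cos\vartheta), & d\ge 2,\end{cases}\qquad \vartheta\in[0,\pi],\ t\in\mathbb{T},$$ where, for each fixed $t\in\mathbb{T}$, $\mathbf{B}_n(t)$ ($n\in\mathbb{N}_0$) are $m\times m$ symmetric matrices and $\sum_{n=0}^\infty \mathbf{B}_n(t)$ (if $d=1$) or $\sum_{n=0}^\infty \mathbf{B}_n(t)P_n^{\left(\frac{d-1}{2}\right)}(1)$ (if $d\ge2$) converges, and, for each fixed $n\in\mathbb{N}_0$, $\mathbf{B}_n(t)$ is a stationary covariance matrix function on $\mathbb{T}$.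
   Context: $\mathbb{N}$ is the set of positive integers and $\mathbb{N}_0$ the set of nonnegative integers. $\mathbb{S}^d=\{\mathbf{x}\in\mathbb{R}^{d+1}:\|\mathbf{x}\|=1\}$ is the unit sphere, with spherical distance $\vartheta(\mathbf{x}_1,\mathbf{x}_2)=\arccos(\mathbf{x}_1'\mathbf{x}_2)\in[0,\pi]$. A prime denotes transpose. For $\lambda>0$, the ultraspherical (Gegenbauer) polynomials $P_n^{(\lambda)}$, $n\in\mathbb{N}_0$, are defined by $(1-2ux+u^2)^{-\lambda}=\sum_{n=0}^\infty u^nP_n^{(\lambda)}(x)$ for $|x|\le 1$, $|u|<1$; $P_n^{(\lambda)}(1)=\binom{2\lambda+n-1}{n}$. An $m$-variate random field $\{\mathbf{Z}(\mathbf{x};t)\}$ is a family of $\mathbb{R}^m$-valued random vectors with finite second-order moments. Its mean function is $\mathrm{E}\,\mathbf{Z}(\mathbf{x};t)$ and its covariance matrix function is $\mathrm{cov}(\mathbf{Z}(\mathbf{x}_1;t_1),\mathbf{Z}(\mathbf{x}_2;t_2))=\mathrm{E}\{(\mathbf{Z}(\mathbf{x}_1;t_1)-\mathrm{E}\mathbf{Z}(\mathbf{x}_1;t_1))(\mathbf{Z}(\mathbf{x}_2;t_2)-\mathrm{E}\mathbf{Z}(\mathbf{x}_2;t_2))'\}$. It is (wide-sense) isotropic over $\mathbb{S}^d$ and (wide-sense) stationary on $\mathbb{T}$ if its mean function is a constant vector and its covariance matrix function depends only on $\vartheta(\mathbf{x}_1,\mathbf{x}_2)$ and $t_1-t_2$;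 it is then written $\mathbf{C}(\vartheta(\mathbf{x}_1,\mathbf{x}_2);t_1-t_2)$. It is mean square continuous over $\mathbb{S}^d$ if for each $t$ and each $\mathbf{x}_0\in\mathbb{S}^d$, $\mathrm{E}\|\mathbf{Z}(\mathbf{x};t)-\mathbf{Z}(\mathbf{x}_0;t)\|^2\to0$ as $\mathbf{x}\to\mathbf{x}_0$. An $m\times m$ matrix function $\mathbf{B}(t)$ on $\mathbb{T}$ is a stationary covariance matrix function on $\mathbb{T}$ if there is an $m$-variate second-order stochastic process $\{\mathbf{W}(t),t\in\mathbb{T}\}$ with $\mathrm{cov}(\mathbf{W}(t_1),\mathbf{W}(t_2))=\mathbf{B}(t_1-t_2)$ for all $t_1,t_2\in\mathbb{T}$; equivalently, $\mathbf{B}(-t)=\mathbf{B}(t)'$ and $\sum_{i,j=1}^n\mathbf{a}_i'\mathbf{B}(t_i-t_j)\mathbf{a}_j\ge0$ for all $n\in\mathbb{N}$, $t_i\in\mathbb{T}$, $\mathbf{a}_i\in\mathbb{R}^m$. Convergence of series of matrices is entrywise. *)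

(* Defs.v *)
From HB Require Import structures.
From mathcomp Require Import all_boot all_order all_algebra.
From mathcomp Require Import all_classical all_reals all_analysis.

Set Implicit Arguments.
Unset Strict Implicit.
Unset Printing Implicit Defensive.

Import Order.TTheory GRing.Theory Num.Theory.
Import numFieldNormedType.Exports.
Local Open Scope classical_set_scope.
Local Open Scope ring_scope.

(* The time domain is either the real line or the integers. *)
Variant time_domain := RealTime | IntegerTime.

Definition time (R : realType) (k : time_domain) : zmodType :=
  match k with RealTime => (R : zmodType) | IntegerTime => (int : zmodType) end.

Definition dot (R : realType) (n : nat) (x y : 'cV[R]_n) : R :=
  (x^T *m y) ord0 ord0.

(* Written with [dot] because the library norm on matrices is the sup norm. *)
Definition sphere (R : realType) (d : nat) : set 'cV[R]_d.+1 :=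
  [set x | Num.sqrt (dot x x) = 1].
Arguments sphere : clear implicits.

Definition sph_dist (R : realType) (d : nat) (x y : 'cV[R]_d.+1) : R :=
  acos (dot x y).

(* p is the sequence of ultraspherical polynomials of index lambda > 0, as
   given by the generating function (1 - 2ux + u^2)^(-lambda). *)
Definition is_gegenbauer (R : realType) (lambda : R) (p : nat -> {poly R}) :=
  forall x u : R, `|x| <= 1 -> `|u| < 1 ->
    series (fun n => u ^+ n * (p n).[x]) @ \oo -->
      (1 - 2 * u * x + u ^+ 2) `^ (- lambda).

(* For lambda > 0 exactly one sequence of polynomials satisfies
   [is_gegenbauer], so the default value 0 plays no role. *)
Definition gegenbauer (R : realType) (lambda : R) : nat -> {poly R} :=
  xget (fun=> 0) [set p | is_gegenbauer lambda p].

Section random_vectors.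
Context (R : realType) (dO : measure_display) (Omega : measurableType dO).
Context (P : probability Omega R) (m : nat).

(* An R^m-valued random vector is given by its m real components. *)
Definition random_vector := 'I_m -> {RV P >-> R}.

Definition second_order (X : random_vector) : Prop :=
  forall i, (X i : Omega -> R) \in Lfun P 2%:E.

Definition mean (X : random_vector) : 'cV[R]_m :=
  \col_i fine 'E_P[X i].

Definition cov_mx (X Y : random_vector) : 'M[R]_m :=
  \matrix_(i, j) fine (covariance P (X i) (Y j)).

(* E ||X - Y||^2, with the Euclidean norm *)
Definition msq_dist (X Y : random_vector) : \bar R :=
  ('E_P[fun w => (\sum_(i < m) (X i w - Y i w) ^+ 2)%R])%E.

End random_vectors.

Section random_fields.
Context (R : realType) (dO : measure_display) (Omega : measurableType dO).
Context (P : probability Omega R) (m d : nat) (T : zmodType).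

(* Only the values of the field at points of the sphere are constrained. *)
Variable Z : 'cV[R]_d.+1 -> T -> random_vector P m.

Definition second_order_field : Prop :=
  forall x t, sphere R d x -> second_order (Z x t).

Definition isotropic_stationary (C : R -> T -> 'M[R]_m) : Prop :=
  (exists mu : 'cV[R]_m, forall x t, sphere R d x -> mean (Z x t) = mu) /\
  (forall x1 x2 t1 t2, sphere R d x1 -> sphere R d x2 ->
     cov_mx (Z x1 t1) (Z x2 t2) = C (sph_dist x1 x2) (t1 - t2)).

Definition mean_square_continuous : Prop :=
  forall t x0, sphere R d x0 ->
    msq_dist (Z x t) (Z x0 t) @[x --> within (sphere R d) (nbhs x0)] --> 0%E.

End random_fields.

Definition stationary_cov (R : realType) (m : nat) (T : zmodType)
    (B : T -> 'M[R]_m) : Prop :=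
  exists (dO : measure_display) (Omega : measurableType dO)
         (P : probability Omega R) (W : T -> random_vector P m),
    (forall t, second_order (W t)) /\
    (forall t1 t2, cov_mx (W t1) (W t2) = B (t1 - t2)).

Definition mxseries_to (R : realType) (m : nat) (A : nat -> 'M[R]_m)
    (S : 'M[R]_m) : Prop :=
  forall i j, series (fun n => A n i j) @ \oo --> S i j.

Definition zonal (R : realType) (d n : nat) (theta : R) : R :=
  if d == 1%N then cos (n%:R * theta)
  else (gegenbauer ((d.-1)%:R / 2) n).[cos theta].

Definition zonal_at_one (R : realType) (d n : nat) : R :=
  if d == 1%N then 1 else (gegenbauer ((d.-1)%:R / 2) n).[1].
Arguments zonal_at_one : clear implicits.

Definition zonal_expansion (R : realType) (m d : nat) (T : zmodType)
    (F : R -> T -> 'M[R]_m) (B : nat -> T -> 'M[R]_m) : Prop :=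
  [/\ forall theta t, 0 <= theta <= pi ->
        mxseries_to (fun n => zonal d n theta *: B n t) (F theta t),
      forall t n, (B n t)^T = B n t,
      forall t, exists S, mxseries_to (fun n => zonal_at_one R d n *: B n t) S &
      forall n, stationary_cov (B n)].

(* Main.v *)
Require Import Defs.
From HB Require Import structures.
From mathcomp Require Import all_boot all_order all_algebra.
From mathcomp Require Import all_classical all_reals all_analysis.
From mathcomp Require Import measurable_realfun.
From mathcomp Require Import ring lra.

Set Implicit Arguments.
Unset Strict Implicit.
Unset Printing Implicit Defensive.

Import Order.TTheory GRing.Theory Num.Theory.
Import numFieldNormedType.Exports.
Local Open Scope classical_set_scope.
Local Open Scope ring_scope.

(* The covariance of the centred field defines, for each u in [-1, 1], a kernel
   K_{ab}(u) = cov(Z_a(x), Z_b(y)), u = x . y, indexed by pairs a = (t, i); it is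
   symmetric in a and b, continuous in u, and positive definite on the sphere.
   The rotation invariant mean over S^d is obtained without surface measure, as
   the limit of finitely supported probability measures whose energy
   sum w w' exp(x . y) tends to its infimum. Rotation invariance makes
   integration against (x . y)^a map zonal polynomials of degree b to zonal
   polynomials of degree at most b (a Funk-Hecke formula), which gives the
   orthogonality relations, and together with Weierstrass approximation the
   completeness of the ultraspherical polynomials Q_n. Positive definiteness yields
   |b_n(a, b)| <= (b_n(a, a) + b_n(b, b)) / 2 and Bessel's inequality, so the
   ultraspherical series of K_{ab} converges absolutely, with sum K_{ab}.
   The means of Q_n(pole . x) Z_a(x) along the same sequence of measures converge
   in L2 to random variables whose covariance is a positive multiple of b_n; running
   this process forwards or backwards in time according to an independent fair
   coin produces a process with covariance proportional to b_n(t) + b_n(-t). *)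

(** The coefficients b_n(t) of C itself are already stationary covariance functions, but b_n(-t) is
    the transpose of b_n(t): symmetric matrices come out after averaging t and -t, hence the coin.
    Since [stationary_cov] asks for an actual process, that process is built from the given field
    rather than deduced from positive definiteness. The exponential serves as energy kernel because
    all its Taylor coefficients are positive: the energy of a signed measure then dominates the
    square of each of its moments, up to a factorial, so near minimizers have nearly equal moments,
    and a reflected near minimizer is again one. Reflections suffice for invariance, as any two
    points of the sphere are exchanged by one. Indexing by pairs (t, i) turns the matrix problem
    into a scalar one in which off-diagonal coefficients are controlled by diagonal ones. The
    normalization Q_n(1) = 1 treats cosines and ultraspherical polynomials at once; the generating
    function is used only to compare Q_n with the polynomials of the statement. *)

(** * Ultraspherical polynomials: recurrence, derivatives, differential equation *)

Section normalized_gegenbauer.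
Context (R : realType) (d : nat).
Hypothesis hd : (0 < d)%N.

(* Ultraspherical polynomials of index (d - 1) / 2 normalized to take the value
   1 at 1; with this normalization d = 1 gives the Chebyshev polynomials. *)
Fixpoint ngeg2 (n : nat) : {poly R} * {poly R} :=
  if n is n'.+1 then
    let: (p, q) := ngeg2 n' in
    (q, (n'.+1 + d.-1)%:R^-1 *: ((2 * n'.+1 + d.-1)%:R *: ('X * q) - n'.+1%:R *: p))
  else (1, 'X).

Definition ngeg n := (ngeg2 n).1.

Lemma ngeg2E n : ngeg2 n = (ngeg n, ngeg n.+1).
Proof.
by rewrite /ngeg; elim: n => //= n ->.
Qed.

Lemma ngeg0 : ngeg 0 = 1. Proof. by []. Qed.
Lemma ngeg1 : ngeg 1 = 'X. Proof. by []. Qed.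

Lemma ngegSS n : (n.+1 + d.-1)%:R *: ngeg n.+2 =
  (2 * n.+1 + d.-1)%:R *: ('X * ngeg n.+1) - n.+1%:R *: ngeg n.
Proof.
by rewrite {1}/ngeg /= !ngeg2E /= scalerA divff ?scale1r//.
Qed.

Lemma ngeg_at1 n : (ngeg n).[1] = 1.
Proof.
suff : (ngeg n).[1] = 1 /\ (ngeg n.+1).[1] = 1 by case.
elim: n => [|n [IH0 IH1]]; first by rewrite ngeg0 ngeg1 hornerC hornerX.
split => //.
have /(congr1 (horner^~ 1)) := ngegSS n.
rewrite !(hornerD, hornerN, hornerZ, hornerM, hornerX) IH0 IH1 => h.
have h0 : (n.+1 + d.-1)%:R != 0 :> R by rewrite pnatr_eq0.
apply: (mulfI h0); rewrite h !natrD !natrM; ring.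
Qed.

Lemma size_ngeg n : size (ngeg n) = n.+1.
Proof.
suff : size (ngeg n) = n.+1 /\ size (ngeg n.+1) = n.+2 by case.
elim: n => [|n [IH0 IH1]].
  by rewrite ngeg0 ngeg1 size_poly1 size_polyX.
split => //.
have <- : size ((n.+1 + d.-1)%:R *: ngeg n.+2) = size (ngeg n.+2).
  by rewrite size_scale// pnatr_eq0.
have s1 : size ((2 * n.+1 + d.-1)%:R *: ('X * ngeg n.+1)) = n.+3.
  by rewrite size_scale ?pnatr_eq0// mulrC size_mulX ?IH1// -size_poly_gt0 IH1.
rewrite ngegSS size_polyDl ?s1//.
by rewrite size_polyN (leq_ltn_trans (size_scale_leq _ _))// IH0.
Qed.

Lemma ngeg_neq0 n : ngeg n != 0.
Proof. by rewrite -size_poly_gt0 size_ngeg. Qed.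

Let w : {poly R} := 1 - 'X ^+ 2.

(** The derivative is expressed once through the lower and once through the upper neighbour. The two
    relations are proved together: the upper one at n + 1 follows from the lower one at n and the
    recurrence, and the lower one at n + 1 from the differentiated recurrence, where both relations
    at n replace the derivatives. *)
Lemma ngeg_deriv n :
  w * (ngeg n.+1)^`() = n.+1%:R *: (ngeg n - 'X * ngeg n.+1) /\
  w * (ngeg n)^`() = (n + d.-1)%:R *: ('X * ngeg n - ngeg n.+1).
Proof.
elim: n => [|n [IH0 IH1]].
  rewrite ngeg0 ngeg1 derivX derivC !mulr1 mulr0 subrr scaler0 scale1r /w.
  by rewrite expr2.
have h0 : (n.+1 + d.-1)%:R != 0 :> R by rewrite pnatr_eq0.
have r := ngegSS n.
have B : w * (ngeg n.+1)^`() = (n.+1 + d.-1)%:R *: ('X * ngeg n.+1 - ngeg n.+2).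
  rewrite scalerBr r IH0.
  rewrite -!mul_polyC !polyC_natr !natrD !natrM.
  ring.
split => //.
apply: (scalerI h0).
have r' := congr1 (@deriv R) r.
rewrite derivZ derivB !derivZ derivM derivX mul1r in r'.
transitivity ((2 * n.+1 + d.-1)%:R *: (w * ngeg n.+1 + 'X * (w * (ngeg n.+1)^`()))
   - n.+1%:R *: (w * (ngeg n)^`())).
  by rewrite scalerAr r' -!mul_polyC; ring.
transitivity (n.+2%:R *:
   ((n.+1 + d.-1)%:R *: ngeg n.+1 - 'X * ((n.+1 + d.-1)%:R *: ngeg n.+2))); last first.
  by rewrite -!mul_polyC; ring.
rewrite IH0 IH1 r -!mul_polyC !polyC_natr !natrD !natrM /w; ring.
Qed.

(** This eigenvalue equation is the source of orthogonality. Both sides are multiplied by the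
    nonzero polynomial 1 - X^2, so that the first-order relations apply to every derivative that
    occurs. *)
Lemma ngeg_ode n : w * (ngeg n)^`()^`() - d%:R *: ('X * (ngeg n)^`()) =
  - (n * (n + d.-1))%:R *: ngeg n.
Proof.
case: n => [|n].
  by rewrite ngeg0 derivC deriv0 !mulr0 scaler0 subrr mul0n oppr0 scale0r.
have [A0 A1] := ngeg_deriv n.
have w0 : w != 0.
  apply/eqP => /(congr1 (horner^~ 0)); rewrite /w !hornerE expr0n/= subr0.
  by move/eqP; rewrite oner_eq0.
apply: (mulfI w0).
have dw : w^`() = - 'X *+ 2 by rewrite /w derivB derivC derivXn sub0r mulNrn.
have := congr1 (@deriv R) A0.
rewrite derivM dw derivZ derivB derivM derivX mul1r => h.
transitivity (w * (n.+1%:R *: ((ngeg n)^`() - (ngeg n.+1 + 'X * (ngeg n.+1)^`())))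
  + (2 - d%:R) *: ('X * (w * (ngeg n.+1)^`()))).
  by rewrite -h -!mul_polyC !rmorphB/= !polyC_natr; ring.
transitivity (n.+1%:R *: (w * (ngeg n)^`() - w * ngeg n.+1
  - 'X * (w * (ngeg n.+1)^`())) + (2 - d%:R) *: ('X * (w * (ngeg n.+1)^`()))).
  by rewrite -!mul_polyC; ring.
rewrite A1 A0 scaleNr -[in d%:R](prednK hd) -!mul_polyC !rmorphB/= !polyC_natr.
rewrite !natrM !natrD /w; ring.
Qed.

End normalized_gegenbauer.

(** * Limits in epsilon form *)

Section epsilon_limits.
Context {R : realType}.
Implicit Types (u v : nat -> R) (l : R).

Lemma cvgn_epsP u l : u @ \oo --> l <->
  forall e, 0 < e -> exists N, forall n, (N <= n)%N -> `|u n - l| <= e.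
Proof.
split=> [ul e e0|ul].
  have /cvgr_dist_le /(_ _ e0) [N _ hN] := ul.
  by exists N => n Nn; rewrite distrC; apply: hN.
apply/cvgrPdist_le => e e0; have [N hN] := ul _ e0.
by exists N => // n Nn; rewrite distrC; apply: hN.
Qed.

Lemma cauchyn_cvg u :
  (forall e, 0 < e -> exists N, forall n m, (N <= n)%N -> (N <= m)%N ->
    `|u n - u m| <= e) -> cvgn u.
Proof.
move=> uC; apply/cauchy_cvgP/cauchy_exP => e e0.
have e20 : 0 < e / 2 by rewrite divr_gt0.
have [N hN] := uC _ e20; exists (u N); exists N => // n /= Nn.
rewrite /ball/= (le_lt_trans (hN _ _ _ _))// ltr_pdivrMr// mulr2n mulrDr mulr1.
by rewrite ltrDl.
Qed.

(** It suffices to approximate f uniformly near the filter by functions whose limits are close to l.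
    This carries limits from polynomial kernels over to continuous ones. *)
Lemma cvg_uniform_approx {T : Type} (F : set_system T) {FF : Filter F}
    (f : T -> R) l :
  (forall e, 0 < e -> exists g m, [/\ g @ F --> m,
     \forall x \near F, `|f x - g x| <= e & `|l - m| <= e]) -> f @ F --> l.
Proof.
move=> h; apply/cvgrPdist_le => e e0.
have e30 : 0 < e / 3 by rewrite divr_gt0.
have [g [m [gm fg lm]]] := h _ e30.
have /cvgrPdist_le/(_ _ e30) gm' := gm.
near=> x.
have H1 : `|f x - g x| <= e / 3 by near: x.
have H2 : `|m - g x| <= e / 3 by near: x.
rewrite (_ : l - f x = (l - m) + (m - g x) - (f x - g x)); last by ring.
rewrite (le_trans (ler_normB _ _))// (le_trans (lerD (ler_normD _ _) (lexx _)))//.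
by move: H1 H2 lm; lra.
Unshelve. all: by end_near. Qed.

Lemma cvg_bigsum {T I : Type} (F : set_system T) {FF : Filter F} (r : seq I)
    (f : I -> T -> R) (a : I -> R) :
  (forall i, f i x @[x --> F] --> a i) ->
  (\sum_(i <- r) f i x) @[x --> F] --> \sum_(i <- r) a i.
Proof. by move=> h; apply: cvg_big => //; exact: add_continuous. Qed.

End epsilon_limits.

(** * Uniform mean on the sphere *)

Section finite_measures.
Context {R : realType}.

(** A list of weighted points encodes a finitely supported signed measure. Negative weights occur
    because the energy is applied to differences of probability measures. *)
Definition fint {T : Type} (nu : seq (R * T)) (f : T -> R) : R :=
  \sum_(p <- nu) p.1 * f p.2.

Definition fscale {T : Type} (c : R) (nu : seq (R * T)) : seq (R * T) :=
  [seq (c * p.1, p.2) | p <- nu].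

Definition fpush {T U : Type} (h : T -> U) (nu : seq (R * T)) : seq (R * U) :=
  [seq (p.1, h p.2) | p <- nu].

Definition fprob {T : Type} (A : set T) (nu : seq (R * T)) : Prop :=
  [/\ List.Forall (fun p => 0 <= p.1 /\ A p.2) nu & fint nu (fun=> 1) = 1].

Section basic.
Context {T : Type}.
Implicit Types (nu mu : seq (R * T)) (f g : T -> R) (A : set T).

Lemma eq_fint nu f g : f =1 g -> fint nu f = fint nu g.
Proof. by move=> fg; apply: eq_bigr => p _; rewrite fg. Qed.

Lemma fintD nu f g : fint nu (fun x => f x + g x) = fint nu f + fint nu g.
Proof. by rewrite /fint -big_split/=; apply: eq_bigr => p _; rewrite mulrDr. Qed.

Lemma fintZ nu c f : fint nu (fun x => c * f x) = c * fint nu f.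
Proof. by rewrite /fint big_distrr/=; apply: eq_bigr => p _; rewrite mulrCA. Qed.

Lemma fintB nu f g : fint nu (fun x => f x - g x) = fint nu f - fint nu g.
Proof.
rewrite -[in RHS]mulN1r -fintZ -fintD; apply: eq_fint => x.
by rewrite mulN1r.
Qed.

Lemma fint_sum (I : Type) (r : seq I) nu (f : I -> T -> R) :
  fint nu (fun x => \sum_(i <- r) f i x) = \sum_(i <- r) fint nu (f i).
Proof.
rewrite /fint exchange_big/=; apply: eq_bigr => p _.
by rewrite big_distrr.
Qed.

Lemma fint_cat nu mu f : fint (nu ++ mu) f = fint nu f + fint mu f.
Proof. by rewrite /fint big_cat. Qed.

Lemma fint_scale c nu f : fint (fscale c nu) f = c * fint nu f.
Proof.
rewrite /fint big_map big_distrr/=; apply: eq_bigr => p _.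
by rewrite mulrA.
Qed.

Lemma fintC (U : Type) nu (mu : seq (R * U)) (F : T -> U -> R) :
  fint nu (fun x => fint mu (F x)) = fint mu (fun y => fint nu (F^~ y)).
Proof.
rewrite /fint; under eq_bigr do rewrite big_distrr/=.
rewrite exchange_big/=; apply: eq_bigr => q _.
by rewrite big_distrr/=; apply: eq_bigr => p _; rewrite mulrCA.
Qed.

Lemma fprob_ler A nu f g : fprob A nu -> (forall x, A x -> f x <= g x) ->
  fint nu f <= fint nu g.
Proof.
move=> [+ _] fg; rewrite /fint; elim: nu => [|p nu IH] h; first by rewrite !big_nil.
rewrite !big_cons; inversion h as [|? ? [p0 Ap] h']; subst.
by rewrite lerD ?IH// ler_wpM2l// fg.
Qed.

Lemma fprob_eq A nu f g : fprob A nu -> (forall x, A x -> f x = g x) ->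
  fint nu f = fint nu g.
Proof.
by move=> nuA fg; apply/eqP; rewrite eq_le !(fprob_ler nuA)// => x /fg ->.
Qed.

Lemma fprob_cst A nu c : fprob A nu -> fint nu (fun=> c) = c.
Proof.
move=> [_ nu1]; rewrite -[RHS]mulr1 -nu1 -fintZ.
by apply: eq_fint => x; rewrite mulr1.
Qed.

Lemma fprob_dist A nu f g e : fprob A nu -> (forall x, A x -> `|f x - g x| <= e) ->
  `|fint nu f - fint nu g| <= e.
Proof.
move=> nuA fg; rewrite -fintB ler_norml -[X in X <= _](fprob_cst _ nuA).
rewrite -[X in _ && (_ <= X)](fprob_cst _ nuA).
by apply/andP; split; apply: (fprob_ler nuA) => x /fg; rewrite ler_norml => /andP[].
Qed.

Lemma fprob_mix A nu mu : fprob A nu -> fprob A mu ->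
  fprob A (fscale 2^-1 nu ++ fscale 2^-1 mu).
Proof.
have scaleF (s : seq (R * T)) : List.Forall (fun p => 0 <= p.1 /\ A p.2) s ->
    List.Forall (fun p => 0 <= p.1 /\ A p.2) (fscale 2^-1 s).
  elim: s => [|p s IH] h; first by constructor.
  inversion h as [|? ? [p0 Ap] h']; subst.
  by constructor; [split => //; rewrite mulr_ge0// invr_ge0|exact: IH].
move=> [nuA nu1] [muA mu1]; split.
  by apply/List.Forall_app; split; exact: scaleF.
by rewrite fint_cat !fint_scale nu1 mu1; field.
Qed.

Lemma fint_push (U : Type) (h : T -> U) nu (f : U -> R) :
  fint (fpush h nu) f = fint nu (f \o h).
Proof. by rewrite /fint big_map. Qed.

Lemma fprob_push A nu (h : T -> T) : (forall x, A x -> A (h x)) ->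
  fprob A nu -> fprob A (fpush h nu).
Proof.
move=> Ah [nuA nu1]; split; last by rewrite fint_push.
elim: nu nuA {nu1} => [|p nu IH] H; first by constructor.
inversion H as [|? ? [p0 Ap] h']; subst.
by constructor; [split => //; exact: Ah|exact: IH].
Qed.

End basic.
End finite_measures.

Section dot_product.
Context {R : realType} {n : nat}.
Implicit Types x y z : 'cV[R]_n.

Lemma dotE x y : dot x y = \sum_i x i ord0 * y i ord0.
Proof. by rewrite /dot mxE; apply: eq_bigr => i _; rewrite mxE. Qed.

Lemma dotC x y : dot x y = dot y x.
Proof. by rewrite !dotE; apply: eq_bigr => i _; rewrite mulrC. Qed.

Lemma dotDl x y z : dot (x + y) z = dot x z + dot y z.
Proof. by rewrite /dot linearD/= mulmxDl mxE. Qed.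

Lemma dotZl c x z : dot (c *: x) z = c * dot x z.
Proof. by rewrite /dot linearZ/= -scalemxAl mxE. Qed.

Lemma dotNl x z : dot (- x) z = - dot x z.
Proof. by rewrite -scaleN1r dotZl mulN1r. Qed.

Lemma dotDr x y z : dot x (y + z) = dot x y + dot x z.
Proof. by rewrite dotC dotDl !(dotC x). Qed.

Lemma dotZr c x z : dot x (c *: z) = c * dot x z.
Proof. by rewrite dotC dotZl dotC. Qed.

Lemma dotNr x z : dot x (- z) = - dot x z.
Proof. by rewrite dotC dotNl dotC. Qed.

Lemma dot_ge0 x : 0 <= dot x x.
Proof. by rewrite dotE; apply: sumr_ge0 => i _; rewrite -expr2 sqr_ge0. Qed.

Lemma dot_eq0 x : (dot x x == 0) = (x == 0).
Proof.
apply/idP/eqP => [|->]; last first.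
  by rewrite dotE big1// => i _; rewrite mxE mul0r.
rewrite dotE psumr_eq0; last by move=> i _; rewrite -expr2 sqr_ge0.
move=> /allP h; apply/matrixP => i j; rewrite ord1 mxE.
by have := h i (mem_index_enum _); rewrite -expr2 sqrf_eq0 => /eqP.
Qed.

(** Reflection in the hyperplane orthogonal to z. For z = 0 it is the identity, a case that
    [exists_uniform_seq] exploits. *)
Definition refl z x : 'cV[R]_n := x - (2 * dot z x / dot z z) *: z.

Lemma dot_refl z x y : dot (refl z x) (refl z y) = dot x y.
Proof.
have [z0|z0] := eqVneq (dot z z) 0.
  by rewrite /refl z0 invr0 !mulr0 !scale0r !subr0.
rewrite /refl !(dotDl, dotDr, dotNl, dotNr, dotZl, dotZr) (dotC x z); field.
by [].
Qed.

Lemma refl_swap x y : dot x x = dot y y -> refl (x - y) x = y.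
Proof.
move=> xy; rewrite /refl.
have [->|nxy] := eqVneq x y.
  by rewrite subrr scaler0 subr0.
have D0 : dot (x - y) (x - y) != 0 by rewrite dot_eq0 subr_eq0.
suff -> : 2 * dot (x - y) x / dot (x - y) (x - y) = 1.
  by rewrite scale1r subKr.
apply: (mulIf D0); rewrite mulfVK// mul1r.
by rewrite !(dotDl, dotDr, dotNl, dotNr) xy (dotC y x); ring.
Qed.

Lemma refl_adj z x y : dot (refl z x) y = dot x (refl z y).
Proof. by rewrite /refl !(dotDl, dotDr, dotNl, dotNr, dotZl, dotZr) (dotC x z); ring. Qed.

Lemma dot_sqr_le x y : dot x x = 1 -> dot y y = 1 -> -1 <= dot x y <= 1.
Proof.
move=> x1 y1.
have := dot_ge0 (x + y); have := dot_ge0 (x - y).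
rewrite !(dotDl, dotDr, dotNl, dotNr) x1 y1 (dotC y x); lra.
Qed.

End dot_product.

Lemma sphereE (R : realType) d (x : 'cV[R]_d.+1) : sphere R d x <-> dot x x = 1.
Proof.
rewrite /sphere/=; split => [h|->]; last by rewrite sqrtr1.
by rewrite -[LHS]sqr_sqrtr ?dot_ge0// h expr1n.
Qed.

(** * Moments and exponential energy *)

Section monomials.
Context {R : realType} {n : nat}.
Notation V := 'cV[R]_n.
Implicit Types (nu : seq (R * V)) (phi : V -> R).

Definition mono (w : seq 'I_n) (x : V) : R := \prod_(i <- w) x i ord0.

Definition skern nu k phi : R :=
  fint nu (fun x => phi x * fint nu (fun y => phi y * dot x y ^+ k)).

Lemma skernS nu k phi :
  skern nu k.+1 phi = \sum_i skern nu k (fun x => phi x * x i ord0).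
Proof.
rewrite /skern -fint_sum; apply: eq_fint => x.
under [RHS]eq_bigr do rewrite -mulrA.
rewrite -mulr_sumr; congr (_ * _).
under [RHS]eq_bigr do rewrite -fintZ.
rewrite -fint_sum; apply: eq_fint => y.
rewrite exprS dotE mulrA mulr_sumr mulr_suml.
by apply: eq_bigr => i _; ring.
Qed.

(** Expanding (x . y)^k over words w of length k writes [skern nu k phi] as the sum of the squares
    of the moments of phi times [mono w]; a single square is at most the sum. The induction moves
    one coordinate into phi. *)
Lemma skern_mono nu k phi :
  0 <= skern nu k phi /\ forall w, size w = k ->
    fint nu (fun x => phi x * mono w x) ^+ 2 <= skern nu k phi.
Proof.
elim: k phi => [|k IH] phi.
  have -> : skern nu 0 phi = fint nu phi ^+ 2.
    rewrite /skern expr2 -fintZ; apply: eq_fint => x.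
    by rewrite mulrC; congr (_ * _); apply: eq_fint => y; rewrite mulr1.
  split=> [|w /size0nil ->]; first exact: sqr_ge0.
  by rewrite le_eqVlt; apply/orP; left; apply/eqP; congr (_ ^+ 2);
    apply: eq_fint => x; rewrite /mono big_nil mulr1.
rewrite skernS; split => [|[//|i w] [sw]].
  by apply: sumr_ge0 => i _; have [] := IH (fun x => phi x * x i ord0).
rewrite (bigD1 i)//= ler_wpDr//.
  by apply: sumr_ge0 => j _; have [] := IH (fun x => phi x * x j ord0).
have [_ /(_ w sw)] := IH (fun x => phi x * x i ord0).
rewrite (_ : fint _ _ = fint nu (fun x => phi x * mono (i :: w) x))//.
by apply: eq_fint => x; rewrite /mono big_cons mulrA.
Qed.

Definition expE nu mu : R := fint nu (fun x => fint mu (fun y => expR (dot x y))).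

Lemma expEC nu mu : expE nu mu = expE mu nu.
Proof. by rewrite /expE fintC; do 2!apply: eq_fint => ?; rewrite dotC. Qed.

(** In the exponential series of the energy each term is a nonnegative [skern] divided by k!; the
    term k = [size w] alone bounds the moment. The bound is meant for signed measures. *)
Lemma mono_expE nu w :
  fint nu (mono w) ^+ 2 / (size w)`!%:R <= expE nu nu.
Proof.
pose S N := \sum_(0 <= k < N) skern nu k (fun=> 1) / k`!%:R.
have SE : S @ \oo --> expE nu nu.
  rewrite (_ : S = fun N => fint nu (fun x => fint nu (fun y =>
      series (exp_coeff (dot x y)) N))).
    apply: cvg_bigsum => p; apply: cvgMr; apply: cvg_bigsum => q; apply: cvgMr.
    by rewrite /expR; exact: is_cvg_series_exp_coeff.
  apply/funext => N; rewrite /S /series/=.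
  under [RHS]eq_fint => x do rewrite fint_sum.
  rewrite fint_sum; apply: eq_bigr => k _.
  rewrite /skern mulrC -fintZ; apply: eq_fint => x.
  rewrite mul1r -fintZ; apply: eq_fint => y.
  by rewrite exp_coeffE mul1r.
have : limn S = expE nu nu by apply/cvg_lim.
move=> <-; apply: limr_ge; first by apply/cvg_ex; eexists; exact: SE.
exists (size w).+1 => // N /= wN; rewrite /S big_mkord.
rewrite (bigD1 (Ordinal wN))//= ler_wpDr//.
  apply: sumr_ge0 => i _; rewrite divr_ge0//.
  by have [] := skern_mono nu i (fun=> 1).
rewrite ler_wpM2r ?invr_ge0//.
have [_ /(_ w erefl)] := skern_mono nu (size w) (fun=> 1).
by rewrite (@eq_fint _ _ _ _ (mono w))// => x; rewrite mul1r.
Qed.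

Lemma expE_ge0 nu : 0 <= expE nu nu.
Proof. by apply: le_trans (mono_expE nu [::]); rewrite divr_ge0// sqr_ge0. Qed.

Lemma expEDl nu nu' mu : expE (nu ++ nu') mu = expE nu mu + expE nu' mu.
Proof. by rewrite /expE fint_cat. Qed.

Lemma expEZl c nu mu : expE (fscale c nu) mu = c * expE nu mu.
Proof. by rewrite /expE fint_scale. Qed.

Lemma expEDr nu mu mu' : expE nu (mu ++ mu') = expE nu mu + expE nu mu'.
Proof. by rewrite expEC expEDl !(expEC nu). Qed.

Lemma expEZr c nu mu : expE nu (fscale c mu) = c * expE nu mu.
Proof. by rewrite expEC expEZl (expEC nu). Qed.

Lemma expE_refl z nu : expE (fpush (refl z) nu) (fpush (refl z) nu) = expE nu nu.
Proof.
rewrite /expE fint_push; apply: eq_fint => x /=; rewrite fint_push.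
by apply: eq_fint => y /=; rewrite dot_refl.
Qed.

End monomials.

Section uniform_sequence.
Context (R : realType) (d : nat).
Notation V := 'cV[R]_d.+1.
Notation S := (sphere R d).

Let energies : set R := [set expE nu nu | nu in fprob S].

Let energies_lb : has_lbound energies.
Proof. by exists 0 => _ [nu _ <-]; exact: expE_ge0. Qed.

Let energies_neq0 : energies !=set0.
Proof.
pose e : V := delta_mx ord0 ord0.
exists (expE [:: (1, e)] [:: (1, e)]); exists [:: (1, e)] => //; split.
  constructor => //; split => //; apply/sphereE.
  rewrite dotE (bigD1 ord0)//= big1 ?addr0 ?mxE ?eqxx ?mulr1// => i /negPf i0.
  by rewrite mxE i0 mul0r.
by rewrite /fint big_seq1 mulr1.
Qed.

(* Parallelogram identity applied to the midpoint of nu and mu. *)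
Let near_minimizers (e : R) (nu mu : seq (R * V)) w : fprob S nu -> fprob S mu ->
  expE nu nu <= inf energies + e -> expE mu mu <= inf energies + e ->
  (fint nu (mono w) - fint mu (mono w)) ^+ 2 <= (size w)`!%:R * (4 * e).
Proof.
move=> nuS muS nue mue.
have mid : inf energies <= expE (fscale 2^-1 nu ++ fscale 2^-1 mu)
                                (fscale 2^-1 nu ++ fscale 2^-1 mu).
  apply: ge_inf => //; eexists; last reflexivity.
  exact: fprob_mix.
have := mono_expE (nu ++ fscale (-1) mu) w.
move: mid; rewrite fint_cat fint_scale !(expEDl, expEDr, expEZl, expEZr) (expEC mu nu) mulN1r.
move=> mid; rewrite ler_pdivrMr ?ltr0n ?fact_gt0// [X in _ <= X]mulrC.
move=> /le_trans; apply; rewrite ler_wpM2l//.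
by move: mid nue mue; lra.
Qed.

Lemma exists_uniform_seq : exists nu : nat -> seq (R * V),
  [/\ forall N, fprob S (nu N),
      forall w, cvgn (fun N => fint (nu N) (mono w)) &
      forall w z, (fun N => fint (nu N) (mono w)
                          - fint (nu N) (mono w \o refl z)) @ \oo --> (0 : R)].
Proof.
have /choice[nu nuP] (N : nat) : exists nu, fprob S nu /\ expE nu nu <= inf energies + N.+1%:R^-1.
  have N0 : 0 < N.+1%:R^-1 :> R by rewrite invr_gt0.
  have [_ [nu nuS <-] nuN] := inf_adherent N0 (conj energies_neq0 energies_lb).
  by exists nu; split => //; exact: ltW.
(* One estimate serves both claims: z = z' = 0 makes the reflections trivial and gives the Cauchy
   property, while n = m with one reflection gives asymptotic invariance. *)
have close w N n m z z' : (N <= n)%N -> (N <= m)%N ->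
    (fint (fpush (refl z) (nu n)) (mono w)
     - fint (fpush (refl z') (nu m)) (mono w)) ^+ 2 <=
    (size w)`!%:R * (4 * N.+1%:R^-1).
  move=> Nn Nm.
  have reflS y : (forall x, S x -> S (refl y x)).
    by move=> x /sphereE x1; apply/sphereE; rewrite dot_refl.
  have inv k : (N <= k)%N -> k.+1%:R^-1 <= N.+1%:R^-1 :> R.
    by move=> Nk; rewrite lef_pV2 ?posrE ?ltr0n// ler_nat.
  have [nun En] := nuP n; have [num Em] := nuP m.
  apply: near_minimizers; rewrite ?expE_refl.
  - by apply: fprob_push => //; exact: reflS.
  - by apply: fprob_push => //; exact: reflS.
  - by rewrite (le_trans En)// lerD2l inv.
  - by rewrite (le_trans Em)// lerD2l inv.
have small (w : seq 'I_d.+1) (e : R) : 0 < e ->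
    exists N : nat, (size w)`!%:R * (4 * N.+1%:R^-1) <= e ^+ 2.
  move=> e0; pose c : R := (size w)`!%:R * 4.
  have [N hN] : exists N : nat, c / e ^+ 2 <= N%:R.
    by exists (Num.bound (c / e ^+ 2)); rewrite ltW// archi_boundP// divr_ge0 ?mulr_ge0 ?exprn_ge0// ltW.
  exists N; rewrite mulrA -/c ler_pdivrMr ?ltr0n// mulrC -ler_pdivrMr ?exprn_gt0//.
  by rewrite (le_trans hN)// ler_nat.
have refl0 x : refl (0 : V) x = x by rewrite /refl scaler0 subr0.
have push0 k w : fint (fpush (refl 0) (nu k)) (mono w) = fint (nu k) (mono w).
  by rewrite fint_push; apply: eq_fint => x /=; rewrite refl0.
have le_sqr (a e : R) : 0 < e -> a ^+ 2 <= e ^+ 2 -> `|a| <= e.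
  by move=> e0 ae; rewrite -(ger0_norm (ltW e0)) -ler_sqr ?nnegrE// !real_normK ?num_real.
exists nu; split.
- by move=> N; have [] := nuP N.
- move=> w; apply: cauchyn_cvg => e e0; have [N hN] := small w e e0.
  exists N => n m Nn Nm; apply: le_sqr => //; apply: le_trans hN.
  by have := close w N n m 0 0 Nn Nm; rewrite !push0.
- move=> w z; apply/cvgn_epsP => e e0; have [N hN] := small w e e0.
  exists N => n Nn; rewrite subr0; apply: le_sqr => //; apply: le_trans hN.
  by have := close w N n n 0 z Nn Nn; rewrite push0 fint_push.
Qed.

End uniform_sequence.

(** * Weierstrass approximation *)

Section bernstein.
Context {R : realType}.
Implicit Types (phi psi : nat -> R) (x s : R).

(* [bern n phi] at x is the mean of [phi] under the binomial law of parameters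
   n and x; the recursion conditions on one of the n trials. *)
Fixpoint bern (n : nat) (phi : nat -> R) : {poly R} :=
  if n is n'.+1 then
    (1 - 'X) * bern n' phi + 'X * bern n' (fun k => phi k.+1)
  else (phi 0%N)%:P.

Lemma bernS n phi x : (bern n.+1 phi).[x] =
  (1 - x) * (bern n phi).[x] + x * (bern n (fun k => phi k.+1)).[x].
Proof. by rewrite /= !(hornerD, hornerM, hornerN, hornerX, hornerC). Qed.

Lemma bernD n phi psi x :
  (bern n (fun k => phi k + psi k)).[x] = (bern n phi).[x] + (bern n psi).[x].
Proof.
elim: n phi psi => [|n IH] phi psi; first by rewrite !hornerC.
by rewrite !bernS !IH; ring.
Qed.

Lemma bernZ n c phi x : (bern n (fun k => c * phi k)).[x] = c * (bern n phi).[x].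
Proof.
elim: n phi => [|n IH] phi; first by rewrite !hornerC.
by rewrite !bernS !IH; ring.
Qed.

Lemma bern_cst n c x : (bern n (fun=> c)).[x] = c.
Proof. by elim: n => [|n IH]; rewrite ?bernS ?IH ?hornerC//; ring. Qed.

(** Squared bias plus variance of the binomial law; for a = n x the variance n x (1 - x) remains. *)
Lemma bern_sqr n a x :
  (bern n (fun k => (k%:R - a) ^+ 2)).[x] = (n%:R * x - a) ^+ 2 + n%:R * x * (1 - x).
Proof.
elim: n a => [|n IH] a; first by rewrite hornerC; ring.
rewrite bernS IH (_ : (fun k : nat => _) = fun k : nat => (k%:R - (a - 1)) ^+ 2).
  by rewrite IH -natr1; ring.
by apply/funext => k; rewrite -natr1; ring.
Qed.

Lemma bern_ler n phi psi x : 0 <= x <= 1 ->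
  (forall k, (k <= n)%N -> phi k <= psi k) -> (bern n phi).[x] <= (bern n psi).[x].
Proof.
move=> /andP[x0 x1]; elim: n phi psi => [|n IH] phi psi h.
  by rewrite !hornerC h.
rewrite !bernS lerD// ler_wpM2l ?subr_ge0//; apply: IH => k kn; apply: h => //.
exact: leqW.
Qed.

(** The hypothesis encloses the sampled values of h between two quadratic functions of k centred at
    (n + 1) x. Their Bernstein means are explicit, and these means are monotone. *)
Lemma bern_approx (h : R -> R) (e K : R) n x : 0 <= x <= 1 ->
  (forall s, 0 <= s <= 1 -> `|h s - h x| <= e + K * (s - x) ^+ 2) ->
  `|h x - (bern n.+1 (fun k => h (k%:R / n.+1%:R))).[x]| <= e + K * (x * (1 - x)) / n.+1%:R.
Proof.
move=> x01 hx.
set g := (fun k : nat => h _).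
pose q (c1 c2 : R) := fun k : nat => c1 + c2 * (k%:R - n.+1%:R * x) ^+ 2.
have qE c1 c2 : (bern n.+1 (q c1 c2)).[x] = c1 + c2 * (n.+1%:R * x * (1 - x)).
  by rewrite /q bernD bern_cst bernZ bern_sqr subrr expr0n/= add0r.
have n0 : n.+1%:R != 0 :> R by rewrite pnatr_eq0.
have bnd k : (k <= n.+1)%N ->
    `|g k - h x| <= e + K / n.+1%:R ^+ 2 * (k%:R - n.+1%:R * x) ^+ 2.
  move=> kn; have := hx (k%:R / n.+1%:R).
  rewrite divr_ge0//= ler_pdivrMr ?ltr0n// mul1r ler_nat kn => /(_ isT).
  by rewrite (_ : K / _ * _ = K * (k%:R / n.+1%:R - x) ^+ 2)//; field.
have E : K * (x * (1 - x)) / n.+1%:R =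
    K / n.+1%:R ^+ 2 * (n.+1%:R * x * (1 - x)) by field.
rewrite distrC ler_norml E; apply/andP; split.
  rewrite lerBrDr -[leLHS](_ : (bern n.+1 (q (h x - e) (- (K / n.+1%:R ^+ 2)))).[x] = _);
    last by rewrite qE; ring.
  apply: bern_ler => // k /bnd; rewrite ler_norml /q => /andP[+ _].
  by move: (K / _) ((_ - _) ^+ 2) => c y; rewrite mulNr; lra.
rewrite lerBlDr -[leRHS](_ : (bern n.+1 (q (h x + e) (K / n.+1%:R ^+ 2))).[x] = _);
  last by rewrite qE; ring.
apply: bern_ler => // k /bnd; rewrite ler_norml /q => /andP[_ +].
by move: (K / _) ((_ - _) ^+ 2) => c y; lra.
Qed.

End bernstein.

Section weierstrass.
Context {R : realType}.
Implicit Types (h g : R -> R) (e u x y s : R).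

(** Continuity on [-1, 1] in the form in which it is used: means are computed on polynomials, and
    the sum of a uniformly convergent zonal series has this property at once. *)
Definition poly_approx h := forall e : R, 0 < e ->
  exists p : {poly R}, forall u, -1 <= u <= 1 -> `|h u - p.[u]| <= e.

(** Compactness of [a, b] in near-covering form, the parameter being the modulus, which tends to 0
    from the right. The point y may lie outside [a, b]. *)
Lemma uniform_continuity h (a b e : R) : continuous h -> 0 < e ->
  exists2 dl : R, 0 < dl & forall x y, a <= x <= b -> `|x - y| < dl -> `|h x - h y| <= e.
Proof.
move=> hc e0.
have /compact_near_coveringP nc := @segment_compact R a b.
have [] := nc R (0^'+) (fun dl x => forall y, `|x - y| < dl -> `|h x - h y| <= e) _.
- move=> x _.
  have e20 : 0 < e / 2 by rewrite divr_gt0.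
  have /cvgrPdist_le/(_ _ e20)/nbhs_ballP[r /= r0 hr] := hc x.
  have r20 : 0 < r / 2 by rewrite divr_gt0.
  near=> x' dl => /= y x'y.
  have xx' : `|x - x'| < r / 2 by near: x'; exact: nbhsx_ballx.
  have dr : dl < r / 2 by near: dl; exact: nbhs_right_lt.
  have H1 : `|h x - h x'| <= e / 2.
    by apply: hr; rewrite /ball/= (lt_le_trans xx')// ler_pdivrMr// ler_peMr// ?ltW// ltr1n.
  have H2 : `|h x - h y| <= e / 2.
    apply: hr; rewrite /ball/= (_ : x - y = (x - x') + (x' - y)); last by ring.
    by rewrite (le_lt_trans (ler_normD _ _))//; lra.
  rewrite (_ : h x' - h y = (h x - h y) - (h x - h x')); last by ring.
  by rewrite (le_trans (ler_normB _ _))//; lra.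
- move=> r /= r0 hr; exists (r / 2); first by rewrite divr_gt0.
  move=> x y xab; apply: hr => //=.
  + by rewrite /ball/= sub0r normrN gtr0_norm ?divr_gt0// ltr_pdivrMr// ltr_pMr// ltr1n.
  + by rewrite divr_gt0.
Unshelve. all: by end_near. Qed.

Lemma weierstrass h : continuous h -> poly_approx h.
Proof.
move=> hc e e0.
have e20 : 0 < e / 2 by rewrite divr_gt0.
have [dl dl0 hdl] := uniform_continuity (-1) 1 hc e20.
have [B hB] : exists B : R, forall x, -1 <= x <= 1 -> `|h x| <= B.
  have /compact_bounded[M [_ hM]] : compact (h @` `[-1, 1]).
    apply: continuous_compact; last exact: segment_compact.
    exact: continuous_subspaceT.
  exists (M + 1) => x x1; apply: hM; first by rewrite ltrDl.
  by exists x => //=; rewrite in_itv.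
have B0 : 0 <= B by rewrite (le_trans _ (hB 0 _))//; lra.
pose h1 s := h (2 * s - 1).
(* Where s and x are too far apart for uniform continuity, 2 |s - x| is at least dl, and the
   oscillation, at most 2 B, is below K (s - x)^2. *)
pose K := 2 * B * (2 / dl) ^+ 2.
have K0 : 0 <= K by rewrite /K mulr_ge0 ?sqr_ge0// mulr_ge0.
have h1K x s : 0 <= x <= 1 -> 0 <= s <= 1 ->
    `|h1 s - h1 x| <= e / 2 + K * (s - x) ^+ 2.
  move=> x01 s01; have [sx|sx] := ltP `|(2 * s - 1) - (2 * x - 1)| dl.
    have /le_trans : `|h1 s - h1 x| <= e / 2 by apply: hdl => //; lra.
    by apply; rewrite lerDl mulr_ge0// sqr_ge0.
  rewrite (le_trans (ler_normB _ _))//.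
  rewrite (@le_trans _ _ (2 * B))//.
    rewrite mulr2n mulrDl mul1r lerD// hB//; lra.
  apply: ler_wpDl; first exact: ltW.
  rewrite (_ : K * _ = 2 * B * (2 / dl * (s - x)) ^+ 2); last by rewrite /K; ring.
  rewrite -[leLHS]mulr1; apply: ler_wpM2l; first by rewrite mulr_ge0.
  rewrite -real_normK ?num_real// exprn_ege1//.
  rewrite normrM normf_div (gtr0_norm dl0) mulrAC ler_pdivlMr// mul1r.
  by rewrite -normrM (le_trans sx)// (_ : _ - _ = 2 * (s - x))//; ring.
have [n hn] : exists n : nat, K / (e / 2) <= n%:R.
  by exists (Num.bound (K / (e / 2))); rewrite ltW// archi_boundP// divr_ge0// ltW.
pose b := bern n.+1 (fun k => h1 (k%:R / n.+1%:R)).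
exists (b \Po (2^-1 *: ('X + 1))) => u u1.
pose x := 2^-1 * (u + 1).
rewrite horner_comp (_ : horner (_ *: _) u = x); last first.
  by rewrite !(hornerZ, hornerD, hornerX, hornerC).
have x01 : 0 <= x <= 1 by rewrite /x; lra.
have -> : h u = h1 x by rewrite /h1 /x; congr h; field.
rewrite (le_trans (bern_approx n x01 (fun s => h1K x s x01)))//.
rewrite [leRHS](splitr e) lerD2l ler_pdivrMr//.
rewrite ler_pdivrMr// in hn.
apply: (@le_trans _ _ K); first by rewrite ler_piMr//; nra.
by rewrite (le_trans hn)// mulrC ler_wpM2l ?(ltW e20)// ler_nat.
Qed.

Lemma poly_approx_poly (p : {poly R}) : poly_approx (horner p).
Proof. by move=> e e0; exists p => u _; rewrite subrr normr0 ltW. Qed.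

Lemma poly_approx_bounded h : poly_approx h ->
  exists2 B : R, 0 < B & forall u, -1 <= u <= 1 -> `|h u| <= B.
Proof.
move=> /(_ _ ltr01)[p hp].
exists (1 + \sum_(i < size p) `|p`_i|).
  by rewrite ltr_pwDl// sumr_ge0.
move=> u u1; rewrite -[h u](subrK p.[u]) (le_trans (ler_normD _ _))// lerD ?hp//.
rewrite horner_coef (le_trans (ler_norm_sum _ _ _))//; apply: ler_sum => i _.
by rewrite normrM normrX ler_piMr// exprn_ile1// ler_norml.
Qed.

Lemma poly_approxD h g : poly_approx h -> poly_approx g ->
  poly_approx (fun u => h u + g u).
Proof.
move=> ha ga e e0; have e20 : 0 < e / 2 by rewrite divr_gt0.
have [p hp] := ha _ e20; have [q hq] := ga _ e20; exists (p + q) => u u1.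
rewrite hornerD opprD addrACA (le_trans (ler_normD _ _))// (splitr e).
by rewrite lerD ?hp ?hq.
Qed.

Lemma poly_approxM h g : poly_approx h -> poly_approx g ->
  poly_approx (fun u => h u * g u).
Proof.
move=> ha ga e e0.
have [B B0 hB] := poly_approx_bounded ha.
have [C C0 hC] := poly_approx_bounded ga.
(* The error of the product is at most dl C + B dl + dl^2, hence at most dl (B + C + 1) as dl is at
   most 1. *)
pose dl := Num.min 1 (e / (B + C + 1)).
have s0 : 0 < B + C + 1 by rewrite !addr_gt0.
have dl0 : 0 < dl by rewrite /dl lt_min ltr01 divr_gt0.
have [p hp] := ha _ dl0; have [q hq] := ga _ dl0; exists (p * q) => u u1.
have dl1 : dl <= 1 by rewrite /dl ge_min lexx.
have dle : dl * (B + C + 1) <= e by rewrite -ler_pdivlMr// /dl ge_min lexx orbT.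
rewrite hornerM.
have -> : h u * g u - p.[u] * q.[u] = (h u - p.[u]) * g u
   + h u * (g u - q.[u]) - (h u - p.[u]) * (g u - q.[u]) by ring.
rewrite (le_trans (ler_normB _ _))// (le_trans (lerD (ler_normD _ _) (lexx _)))//.
rewrite !normrM (le_trans _ dle)//.
have := hp u u1; have := hq u u1; have := hB u u1; have := hC u u1.
have := normr_ge0 (h u - p.[u]); have := normr_ge0 (g u - q.[u]).
have := normr_ge0 (h u); have := normr_ge0 (g u).
move: `|h u - p.[u]| `|g u - q.[u]| `|h u| `|g u| => a b c f f0 c0 b0 a0 fC cB bd ad.
have H1 : a * f <= dl * C by exact: ler_pM.
have H2 : c * b <= B * dl by exact: ler_pM.
have H3 : a * b <= dl * 1 by rewrite ler_pM// (le_trans bd).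
lra.
Qed.

Lemma poly_approxN h : poly_approx h -> poly_approx (fun u => - h u).
Proof.
move=> ha e e0; have [p hp] := ha _ e0; exists (- p) => u u1.
by rewrite hornerN -opprD normrN hp.
Qed.

End weierstrass.

Lemma cvg_dist_le (R : realType) (T : Type) (F : set_system T) {FF : ProperFilter F}
    (f g : T -> R) (a b e : R) : f @ F --> a -> g @ F --> b ->
  (\forall x \near F, `|f x - g x| <= e) -> `|a - b| <= e.
Proof. by move=> fa gb; apply: cvgr_to_le; apply: cvg_norm; exact: cvgB. Qed.

(** * The invariant mean as a limit of finite means *)

Section uniform_mean.
Context {R : realType} {d : nat}.
Notation V := 'cV[R]_d.+1.
Notation S := (sphere R d).
Implicit Types (f g p q : V -> R) (x y z : V).

Definition unif : nat -> seq (R * V) := sval (cid (exists_uniform_seq R d)).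

Lemma unif_prob N : fprob S (unif N).
Proof. by rewrite /unif; case: cid => nu []. Qed.

Definition polyfun f := exists s : seq (R * seq 'I_d.+1),
  forall x, f x = fint s (fun w => mono w x).

Lemma polyfun_cst c : polyfun (fun=> c).
Proof.
exists [:: (c, [::])] => x.
by rewrite /fint big_seq1 /mono big_nil mulr1.
Qed.

Lemma polyfun_coord i : polyfun (fun x => x i ord0).
Proof.
exists [:: (1, [:: i])] => x.
by rewrite /fint big_seq1 /mono big_seq1 mul1r.
Qed.

Lemma polyfunD f g : polyfun f -> polyfun g -> polyfun (fun x => f x + g x).
Proof. by move=> [s sf] [t tg]; exists (s ++ t) => x; rewrite fint_cat sf tg. Qed.

Lemma polyfunM f g : polyfun f -> polyfun g -> polyfun (fun x => f x * g x).
Proof.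
move=> [s sf] [t tg].
exists [seq (m.1 * m'.1, m.2 ++ m'.2) | m <- s, m' <- t] => x.
rewrite sf tg /fint big_allpairs_dep/= mulr_suml; apply: eq_bigr => m _.
rewrite mulr_sumr; apply: eq_bigr => m' _.
by rewrite /mono big_cat/=; ring.
Qed.

Lemma polyfunZ c f : polyfun f -> polyfun (fun x => c * f x).
Proof. exact: polyfunM (polyfun_cst c). Qed.

Lemma polyfun_sum (I : Type) (r : seq I) (F : I -> V -> R) :
  (forall i, polyfun (F i)) -> polyfun (fun x => \sum_(i <- r) F i x).
Proof.
move=> pF; elim: r => [|i r IH].
  have [s hs] := polyfun_cst 0; exists s => x.
  by rewrite big_nil -hs.
have [s hs] := polyfunD (pF i) IH; exists s => x.
by rewrite big_cons -hs.
Qed.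

Lemma polyfunX f k : polyfun f -> polyfun (fun x => f x ^+ k).
Proof.
move=> pf; elim: k => [|k IH]; first exact: (polyfun_cst 1).
have [s hs] := polyfunM pf IH; exists s => x.
by rewrite exprS -hs.
Qed.

Lemma polyfun_dot z : polyfun (dot z).
Proof.
have [s hs] : polyfun (fun x => \sum_i z i ord0 * x i ord0).
  by apply: polyfun_sum => i; apply: polyfunZ; exact: polyfun_coord.
by exists s => x; rewrite dotE -hs.
Qed.

Lemma polyfun_zonal (p : {poly R}) z : polyfun (fun x => p.[dot z x]).
Proof.
have [s hs] : polyfun (fun x => \sum_(i < size p) p`_i * dot z x ^+ i).
  by apply: polyfun_sum => i; apply: polyfunZ; apply: polyfunX; exact: polyfun_dot.
by exists s => x; rewrite horner_coef -hs.
Qed.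

Definition sapprox f := forall e : R, 0 < e -> exists2 p, polyfun p &
  forall x, S x -> `|f x - p x| <= e.

Lemma polyfun_sapprox f : polyfun f -> sapprox f.
Proof. by move=> pf e e0; exists f => // x _; rewrite subrr normr0 ltW. Qed.

Lemma dot_sphere x y : S x -> S y -> -1 <= dot x y <= 1.
Proof. by move=> /sphereE ? /sphereE ?; exact: dot_sqr_le. Qed.

Lemma zonal_sapprox (h : R -> R) z : poly_approx h -> S z ->
  sapprox (fun x => h (dot z x)).
Proof.
move=> ha Sz e e0; have [p hp] := ha _ e0.
exists (fun x => p.[dot z x]); first exact: polyfun_zonal.
by move=> x Sx; apply: hp; exact: dot_sphere.
Qed.

Lemma polyfun_bounded f : polyfun f ->
  exists2 B : R, 0 < B & forall x, S x -> `|f x| <= B.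
Proof.
move=> [s hs]; exists (1 + \sum_(m <- s) `|m.1|).
  by rewrite ltr_pwDl// sumr_ge0.
move=> x Sx; rewrite hs /fint ler_wpDl// (le_trans (ler_norm_sum _ _ _))//.
apply: ler_sum => m _; rewrite normrM ler_piMr// /mono normr_prod.
apply: prodr_ile1 => i _; rewrite normr_ge0/=.
have := Sx => /sphereE; rewrite dotE (bigD1 i)//= => x1.
rewrite -(@ler_pXn2r _ 2)// ?nnegrE// real_normK ?num_real// expr1n -x1 -expr2 lerDl.
by apply: sumr_ge0 => j _; rewrite -expr2 sqr_ge0.
Qed.

Lemma sapproxMp f q : sapprox f -> polyfun q -> sapprox (fun x => f x * q x).
Proof.
move=> fa pq e e0; have [B B0 hB] := polyfun_bounded pq.
have [p pp hp] := fa _ (divr_gt0 e0 B0).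
exists (fun x => p x * q x); first exact: polyfunM.
move=> x Sx; rewrite -mulrBl normrM (le_trans (ler_pM _ _ (hp x Sx) (hB x Sx)))//.
by rewrite divfK// gt_eqF.
Qed.

Lemma sapproxD f g : sapprox f -> sapprox g -> sapprox (fun x => f x + g x).
Proof.
move=> fa ga e e0; have e20 : 0 < e / 2 by rewrite divr_gt0.
have [p pp hp] := fa _ e20; have [q pq hq] := ga _ e20.
exists (fun x => p x + q x); first exact: polyfunD.
move=> x Sx; rewrite opprD addrACA (le_trans (ler_normD _ _))// (splitr e).
by rewrite lerD ?hp ?hq.
Qed.

Lemma sapproxZ c f : sapprox f -> sapprox (fun x => c * f x).
Proof.
move=> fa; rewrite (_ : (fun x => _) = fun x => f x * c).
  by apply: sapproxMp => //; exact: polyfun_cst.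
by apply/funext => x; rewrite mulrC.
Qed.

(** Meaningful on [sapprox], where the finite means are Cauchy. *)
Definition smean f : R := limn (fun N => fint (unif N) f).

Lemma smean_polyfun f : polyfun f -> fint (unif N) f @[N --> \oo] --> smean f.
Proof.
move=> [s hs].
have /cvg_ex[l fl] : cvgn (fun N => fint (unif N) f).
  apply/cvg_ex; exists (fint s (fun w => limn (fun N => fint (unif N) (mono w)))).
  rewrite (_ : (fun N => _) =
      fun N => fint s (fun w => fint (unif N) (mono w))); last first.
    by apply/funext => N; rewrite fintC; apply: eq_fint => x.
  apply: cvg_bigsum => m; apply: cvgMr.
  by rewrite /unif; case: cid => nu [].
by rewrite /smean (cvg_lim _ fl).
Qed.

Lemma smean_cvg f : sapprox f -> fint (unif N) f @[N --> \oo] --> smean f.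
Proof.
move=> fa; suff : cvgn (fun N => fint (unif N) f) by [].
apply: cauchyn_cvg => e e0; have e40 : 0 < e / 4 by rewrite divr_gt0.
have [p pp hp] := fa _ e40.
have /cvgn_epsP/(_ _ e40)[N hN] := smean_polyfun pp.
exists N => n m Nn Nm.
have fp k := fprob_dist (unif_prob k) hp.
move: (fp n) (fp m) (hN _ Nn) (hN _ Nm).
rewrite !ler_norml; lra.
Qed.

Lemma smeanD f g : sapprox f -> sapprox g ->
  smean (fun x => f x + g x) = smean f + smean g.
Proof.
move=> fa ga; apply/cvg_lim => //.
under eq_fun do rewrite fintD.
by apply: cvgD; exact: smean_cvg.
Qed.

Lemma smeanZ c f : sapprox f -> smean (fun x => c * f x) = c * smean f.
Proof.
move=> fa; apply/cvg_lim => //.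
under eq_fun do rewrite fintZ.
by apply: cvgMr; exact: smean_cvg.
Qed.

Lemma smean_sum (I : Type) (r : seq I) (F : I -> V -> R) :
  (forall i, sapprox (F i)) ->
  smean (fun x => \sum_(i <- r) F i x) = \sum_(i <- r) smean (F i).
Proof.
move=> pF; apply/cvg_lim => //.
under eq_fun do rewrite fint_sum.
by apply: cvg_bigsum => i; exact: smean_cvg.
Qed.

Lemma smean_cst c : smean (fun=> c) = c.
Proof.
apply/cvg_lim => //; under eq_fun do rewrite (fprob_cst _ (unif_prob _)).
exact: cvg_cst.
Qed.

Lemma eq_smean f g : (forall x, S x -> f x = g x) -> smean f = smean g.
Proof.
move=> fg; rewrite /smean (_ : (fun N => fint _ f) = fun N => fint (unif N) g)//.
by apply/funext => N; exact: fprob_eq (unif_prob N) fg.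
Qed.

Lemma smean_ler f g : sapprox f -> sapprox g -> (forall x, S x -> f x <= g x) ->
  smean f <= smean g.
Proof.
move=> fa ga fg; apply: ler_cvg_to (smean_cvg fa) (smean_cvg ga) _.
by apply: nearW => N; exact: fprob_ler (unif_prob N) fg.
Qed.

Lemma smean_dist f g (e : R) : sapprox f -> sapprox g ->
  (forall x, S x -> `|f x - g x| <= e) -> `|smean f - smean g| <= e.
Proof.
move=> fa ga fg.
apply: cvg_dist_le (smean_cvg fa) (smean_cvg ga) _.
by apply: nearW => N; exact: fprob_dist (unif_prob N) fg.
Qed.

Lemma smean_refl z f : polyfun f -> smean (f \o refl z) = smean f.
Proof.
move=> pf; apply/cvg_lim => //.
have [s hs] := pf.
suff h : (fun N => fint (unif N) f - fint (unif N) (f \o refl z)) @ \oo --> (0 : R).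
  rewrite -[smean f]subr0.
  rewrite (_ : (fun N => _) = fun N => fint (unif N) f -
      (fint (unif N) f - fint (unif N) (f \o refl z))).
    by apply: cvgB => //; exact: smean_polyfun.
  by apply/funext => N; rewrite subKr.
rewrite (_ : (fun N => _) = fun N => fint s (fun w =>
    fint (unif N) (mono w) - fint (unif N) (mono w \o refl z))).
  rewrite (_ : 0 = fint s (fun=> 0)); last first.
    by rewrite /fint big1// => m _; rewrite mulr0.
  apply: cvg_bigsum => m; apply: cvgMr.
  by rewrite /unif; case: cid => nu [].
apply/funext => N; rewrite fintB; congr (_ - _).
  by rewrite fintC; apply: eq_fint => x.
by rewrite fintC; apply: eq_fint => x /=; rewrite hs.
Qed.

(** The reflection along z - z' carries z to z' and is self-adjoint. The common norm is arbitrary,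
    which lets [smean_dotX_even] extract the norm of z. *)
Lemma smean_zonal_poly (p : {poly R}) z z' : dot z z = dot z' z' ->
  smean (fun x => p.[dot z x]) = smean (fun x => p.[dot z' x]).
Proof.
move=> zz; rewrite -(smean_refl (z - z') (polyfun_zonal p z)).
apply: eq_smean => x _ /=.
by rewrite -[in RHS](refl_swap zz) refl_adj.
Qed.

Lemma smean_zonal h z z' : poly_approx h -> S z -> S z' ->
  smean (fun x => h (dot z x)) = smean (fun x => h (dot z' x)).
Proof.
move=> ha Sz Sz'; apply/eqP; rewrite -subr_eq0 -normr_le0.
apply/ler_addgt0Pr => e e0; rewrite add0r.
have e20 : 0 < e / 2 by rewrite divr_gt0.
have [p hp] := ha _ e20.
have H w : S w -> `|smean (fun x => h (dot w x)) - smean (fun x => p.[dot w x])| <= e / 2.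
  move=> Sw; apply: smean_dist; first exact: zonal_sapprox.
    by apply: polyfun_sapprox; exact: polyfun_zonal.
  by move=> x Sx; apply: hp; exact: dot_sphere.
have E : smean (fun x => p.[dot z x]) = smean (fun x => p.[dot z' x]).
  by apply: smean_zonal_poly; rewrite (sphereE z).1 // (sphereE z').1.
by have := H _ Sz; have := H _ Sz'; rewrite E !ler_norml; lra.
Qed.

(** The two indices are kept apart: convergence along the product filter allows sending M to
    infinity first, exchanging the variables, or restricting to the diagonal. This replaces Fubini's
    theorem for [smean]. *)
Definition bmean (F : V -> V -> R) (NM : nat * nat) : R :=
  fint (unif NM.1) (fun x => fint (unif NM.2) (F x)).

Lemma cvgn2_epsP (F : nat * nat -> R) (l : R) : F @ (\oo, \oo) --> l <->
  forall e, 0 < e -> exists K, forall N M, (K <= N)%N -> (K <= M)%N ->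
    `|F (N, M) - l| <= e.
Proof.
split=> [Fl e e0|Fl].
  have /cvgrPdist_le/(_ _ e0) [[A B] /= [[n _ nA] [m _ mB]] AB] := Fl.
  exists (maxn n m) => N M; rewrite !geq_max => /andP[nN _] /andP[_ mM].
  by rewrite distrC; apply: (AB (N, M)); split; [exact: nA|exact: mB].
apply/cvgrPdist_le => e e0; have [K hK] := Fl _ e0.
exists ([set N | (K <= N)%N], [set N | (K <= N)%N]) => /=.
  by split; exists K.
by move=> [N M] [/= KN KM]; rewrite distrC; exact: hK.
Qed.

(** For a = 0 the double mean factors into two single means; otherwise one factor x . y splits into
    products of coordinates, absorbed by f and g. *)
Lemma bmean_polyfun f g a : polyfun f -> polyfun g ->
  cvg (bmean (fun x y => dot x y ^+ a * (f x * g y)) @ (\oo, \oo)).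
Proof.
elim: a f g => [|a IH] f g pf pg.
  apply/cvg_ex; exists (smean f * smean g).
  rewrite (_ : bmean _ = fun NM => fint (unif NM.1) f * fint (unif NM.2) g).
    apply: cvgM.
      exact: (cvg_comp _ _ cvg_fst (smean_polyfun pf)).
    exact: (cvg_comp _ _ cvg_snd (smean_polyfun pg)).
  apply/funext => -[N M]; rewrite /bmean/= mulrC -fintZ; apply: eq_fint => x.
  rewrite mulrC -fintZ; apply: eq_fint => y.
  by rewrite expr0 mul1r.
have H i : cvg (bmean (fun x y => dot x y ^+ a *
    ((f x * x i ord0) * (g y * y i ord0))) @ (\oo, \oo)).
  by apply: IH; apply: polyfunM => //; exact: polyfun_coord.
apply/cvg_ex; eexists.
rewrite (_ : bmean _ = fun NM => \sum_i bmean (fun x y => dot x y ^+ a *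
    ((f x * x i ord0) * (g y * y i ord0))) NM).
  by apply: cvg_bigsum => i; exact: (H i).
apply/funext => NM; rewrite /bmean -fint_sum; apply: eq_fint => x.
rewrite -fint_sum; apply: eq_fint => y.
rewrite exprS dotE !mulr_suml; apply: eq_bigr => i _.
by rewrite -dotE; ring.
Qed.

Lemma bmean_iter F (l : R) : bmean F @ (\oo, \oo) --> l ->
  (forall x, sapprox (F x)) ->
  fint (unif N) (fun x => smean (F x)) @[N --> \oo] --> l.
Proof.
move=> /cvgn2_epsP Fl Fa; apply/cvgn_epsP => e e0.
have [K hK] := Fl _ e0; exists K => N KN.
have H : fint (unif N) (fun x => fint (unif M) (F x)) @[M --> \oo] -->
    fint (unif N) (fun x => smean (F x)).
  by apply: cvg_bigsum => p; apply: cvgMr; exact: smean_cvg.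
apply: cvg_dist_le H (cvg_cst l) _.
by exists K => // M KM; exact: hK.
Qed.

Lemma bmean_swap F (l : R) : bmean F @ (\oo, \oo) --> l ->
  bmean (fun x y => F y x) @ (\oo, \oo) --> l.
Proof.
move=> /cvgn2_epsP Fl; apply/cvgn2_epsP => e e0.
have [K hK] := Fl _ e0; exists K => N M KN KM.
by rewrite /bmean fintC; exact: hK.
Qed.

End uniform_mean.

Lemma horner_inj (R : realType) (p q : {poly R}) :
  (forall x, p.[x] = q.[x]) -> p = q.
Proof.
move=> pq; apply/eqP; rewrite -subr_eq0; apply/negPn/negP => r0.
have := max_poly_roots r0 (rs := [seq i%:R | i <- iota 0 (size (p - q))]).
rewrite size_map size_iota ltnn => h; suff : false by [].
apply: h; last first.
  by rewrite map_inj_uniq ?iota_uniq// => i j /eqP; rewrite eqr_nat => /eqP.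
by apply/allP => _ /mapP[i _ ->]; rewrite /root !hornerE pq subrr.
Qed.

(** * Zonal functions *)

Section trinomial_coefficients.
Context {R : realType}.

(* [qcoef j b] evaluated at r is the coefficient of s^b in (1 + 2 r s + s^2)^j. *)
Fixpoint qcoef (j b : nat) : {poly R} :=
  if j is j'.+1 then
    qcoef j' b + (if b is b'.+1 then (2%:P * 'X) * qcoef j' b' else 0)
               + (if b is b'.+2 then qcoef j' b' else 0)
  else (b == 0%N)%:R%:P.

Lemma qcoefE j b r :
  (('X^2 + (2 * r) *: 'X + 1) ^+ j)`_b = (qcoef j b).[r] :> R.
Proof.
elim: j b => [|j IH] b.
  by rewrite expr0 coef1 hornerC.
set P := (_ ^+ j) in IH *; rewrite exprS -/P !(mulrDl _ _ P) mul1r !coefD -scalerAl coefZ coefXM coefXnM !IH.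
case: b => [|[|b]] /=; rewrite ?subn2 /= !(hornerD, hornerM, hornerX, hornerC); ring.
Qed.

Lemma size_qcoef j b : (size (qcoef j b) <= b.+1)%N.
Proof.
elim: j b => [|j IH] b /=.
  by rewrite (leq_trans (size_polyC_leq1 _)).
rewrite (leq_trans (size_polyD _ _))// geq_max; apply/andP; split; last first.
  by case: b => [|[|b]]; rewrite ?size_poly0// (leq_trans (IH _))// leqW// leqW.
rewrite (leq_trans (size_polyD _ _))// geq_max IH/=.
case: b => [|b]; first by rewrite size_poly0.
rewrite -mulrA mul_polyC (leq_trans (size_scale_leq _ _))//.
by rewrite mulrC (leq_trans (size_polyMleq _ _))// size_polyX addn2/= ltnS.
Qed.

Lemma qcoef_at0 j : [/\ (qcoef j 0).[0] = 1, (qcoef j 1).[0] = 0 &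
  (qcoef j 2).[0] = j%:R :> R].
Proof.
elim: j => [|j [H0 H1 H2]]; first by rewrite /= !hornerC.
by rewrite /= !(hornerD, hornerM, hornerX, hornerC) H0 H1 H2 -natr1; split; ring.
Qed.

End trinomial_coefficients.

Section zonal_theory.
Context {R : realType} {d : nat}.
Hypothesis hd : (0 < d)%N.
Notation V := 'cV[R]_d.+1.
Notation S := (sphere R d).
Implicit Types (x y z : V) (p q : {poly R}) (u c s : R).

Definition pole : V := delta_mx ord0 ord0.

Lemma dot_delta i x : dot (delta_mx i ord0) x = x i ord0.
Proof.
rewrite dotE (bigD1 i)//= big1 ?addr0 ?mxE ?eqxx ?mul1r// => j /negPf ji.
by rewrite mxE ji mul0r.
Qed.

Lemma sphere_delta i : S (delta_mx i ord0).
Proof. by apply/sphereE; rewrite dot_delta mxE !eqxx. Qed.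

Lemma sphere_pole : S pole. Proof. exact: sphere_delta. Qed.

Lemma dot_pole : dot pole pole = 1 :> R.
Proof. by apply/sphereE; exact: sphere_pole. Qed.

(** A point with prescribed inner product u with the pole, for u in [-1, 1]; the second basis
    direction exists because d > 0. *)
Definition meridian (u : R) : V :=
  u *: delta_mx ord0 ord0 + Num.sqrt (1 - u ^+ 2) *: delta_mx (inord 1) ord0.

Lemma ord01 : (ord0 : 'I_d.+1) != inord 1.
Proof. by rewrite -val_eqE/= inordK. Qed.

Lemma dot_meridian u : dot pole (meridian u) = u.
Proof.
rewrite /meridian dotDr !dotZr !dot_delta !mxE !eqxx/= (negPf ord01).
by rewrite mulr1 mulr0 addr0.
Qed.

Lemma sphere_meridian u : -1 <= u <= 1 -> S (meridian u).
Proof.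
move=> u1; apply/sphereE.
rewrite /meridian !(dotDl, dotDr, dotZl, dotZr) !dot_delta !mxE !eqxx/=.
rewrite [inord 1 == _]eq_sym (negPf ord01) !mulr0 !addr0 !add0r !mulr1.
by rewrite -[_ * _ in X in _ + X]expr2 sqr_sqrtr; [ring|nra].
Qed.

Definition mom k := smean (fun x => dot pole x ^+ k).

Lemma polyfun_dotX z k : polyfun (fun x => dot z x ^+ k).
Proof. by apply: polyfunX; exact: polyfun_dot. Qed.

Lemma smean_dotX z z' k : dot z z = dot z' z' ->
  smean (fun x => dot z x ^+ k) = smean (fun x => dot z' x ^+ k).
Proof.
move=> zz; have := smean_zonal_poly 'X^k zz.
by under eq_fun do rewrite hornerXn; under [in RHS]eq_fun do rewrite hornerXn.
Qed.

Lemma smean_dotX_odd z k : odd k -> smean (fun x => dot z x ^+ k) = 0.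
Proof.
move=> ok; have : smean (fun x => dot z x ^+ k) = - smean (fun x => dot z x ^+ k).
  rewrite -mulN1r -smeanZ; last by apply: polyfun_sapprox; exact: polyfun_dotX.
  rewrite (@smean_dotX z (- z)); last by rewrite dotNl dotNr opprK.
  apply: eq_smean => x _.
  by rewrite dotNl exprNn -signr_odd ok.
by lra.
Qed.

Lemma smean_dotX_even z j :
  smean (fun x => dot z x ^+ j.*2) = dot z z ^+ j * mom j.*2.
Proof.
rewrite (@smean_dotX _ (Num.sqrt (dot z z) *: pole)); last first.
  by rewrite dotZl dotZr dot_pole mulr1 -expr2 sqr_sqrtr// dot_ge0.
rewrite -smeanZ; last by apply: polyfun_sapprox; exact: polyfun_dotX.
apply: eq_smean => x _.
by rewrite dotZl exprMn -[in X in X * _](mul2n j) exprM sqr_sqrtr// dot_ge0.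
Qed.

Definition bimom a b x z := smean (fun y => dot x y ^+ a * dot z y ^+ b).

Lemma polyfun_bimom a b x z : polyfun (fun y : V => dot x y ^+ a * dot z y ^+ b).
Proof. by apply: polyfunM; exact: polyfun_dotX. Qed.

Lemma smean_binomial x z k s :
  smean (fun y => dot (x + s *: z) y ^+ k) =
  \sum_(b < k.+1) ('C(k, b)%:R * bimom (k - b) b x z) * s ^+ b.
Proof.
rewrite -(big_mkord xpredT (fun b => ('C(k, b)%:R * bimom (k - b) b x z) * s ^+ b)).
pose F b y := s ^+ b * 'C(k, b)%:R * (dot x y ^+ (k - b) * dot z y ^+ b).
rewrite (eq_bigr (fun b => smean (F b))) => [|b _]; last first.
  by rewrite smeanZ; [rewrite mulrC mulrA|apply: polyfun_sapprox; exact: polyfun_bimom].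
rewrite -smean_sum; last first.
  by move=> b; apply: polyfun_sapprox; apply: polyfunZ; exact: polyfun_bimom.
apply: eq_smean => y _; rewrite dotDl dotZl exprDn big_mkord.
by apply: eq_bigr => b _; rewrite /F exprMn -mulr_natr; ring.
Qed.

(** By invariance the mean of ((x + s z) . y)^k, for even k, is [mom k] times the k-th power of the
    norm of x + s z. On the sphere the square of that norm is 1 + 2 (x . z) s + s^2, and [qcoef] is
    the coefficient of s^b in its power k / 2. That the degree is at most b keeps the induced
    operators from raising degrees. *)
Definition bipoly a b : {poly R} :=
  if odd (a + b) then 0 else (mom (a + b) / 'C(a + b, b)%:R) *: qcoef (a + b)./2 b.

Lemma size_bipoly a b : (size (bipoly a b) <= b.+1)%N.
Proof.
rewrite /bipoly; case: ifP => _; first by rewrite size_poly0.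
by rewrite (leq_trans (size_scale_leq _ _))// size_qcoef.
Qed.

(* Compare the coefficients of s^b in the mean of ((x + s z) . y)^(a + b). *)
Lemma bimomE a b x z : S x -> S z -> bimom a b x z = (bipoly a b).[dot x z].
Proof.
move=> /sphereE x1 /sphereE z1.
pose k := (a + b)%N; pose L := \poly_(c < k.+1) ('C(k, c)%:R * bimom (k - c) c x z).
have LE s : L.[s] = smean (fun y => dot (x + s *: z) y ^+ k).
  by rewrite horner_poly smean_binomial.
have Lb : L`_b = 'C(k, b)%:R * bimom a b x z.
  by rewrite coef_poly ltnS leq_addl /k addnK.
have C0 : 'C(k, b)%:R != 0 :> R by rewrite pnatr_eq0 -lt0n bin_gt0 leq_addl.
apply: (mulfI C0); rewrite -Lb /bipoly -/k; case: ifP => ok.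
  rewrite horner0 mulr0 (_ : L = 0) ?coef0//; apply: horner_inj => s.
  by rewrite LE smean_dotX_odd// horner0.
have kE : k = k./2.*2 by rewrite -[LHS]odd_double_half ok.
have -> : L = mom k *: ('X^2 + (2 * dot x z) *: 'X + 1) ^+ k./2.
  apply: horner_inj => s; rewrite LE [in LHS]kE smean_dotX_even -kE.
  rewrite hornerZ horner_exp mulrC; congr (_ * _ ^+ _).
  rewrite !(dotDl, dotDr, dotZl, dotZr) x1 z1 (dotC z x).
  by rewrite !(hornerD, hornerZ, hornerX, hornerXn, hornerC); ring.
by rewrite coefZ qcoefE hornerZ; field.
Qed.

Definition zint p := smean (fun x => p.[dot pole x]).

Lemma zintE p z : S z -> smean (fun x => p.[dot z x]) = zint p.
Proof.
move=> /sphereE z1; apply: smean_zonal_poly.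
by rewrite z1 dot_pole.
Qed.

Lemma zonal_poly_sapprox p z : sapprox (fun x : V => p.[dot z x]).
Proof. by apply: polyfun_sapprox; exact: polyfun_zonal. Qed.

Lemma zintD p q : zint (p + q) = zint p + zint q.
Proof.
rewrite /zint -smeanD; try exact: zonal_poly_sapprox.
by apply: eq_smean => x _; rewrite hornerD.
Qed.

Lemma zintZ c p : zint (c *: p) = c * zint p.
Proof.
rewrite /zint -smeanZ; last exact: zonal_poly_sapprox.
by apply: eq_smean => x _; rewrite hornerZ.
Qed.

Lemma zintN p : zint (- p) = - zint p.
Proof. by rewrite -scaleN1r zintZ mulN1r. Qed.

Lemma zintB p q : zint (p - q) = zint p - zint q.
Proof. by rewrite zintD zintN. Qed.

Lemma zint0 : zint 0 = 0.
Proof. by rewrite -(scale0r 1) zintZ mul0r. Qed.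

Lemma zint_sum (I : Type) (r : seq I) (F : I -> {poly R}) :
  zint (\sum_(i <- r) F i) = \sum_(i <- r) zint (F i).
Proof. by apply: (big_morph zint zintD zint0). Qed.

Lemma zintX k : zint 'X^k = mom k.
Proof. by apply: eq_smean => x _; rewrite hornerXn. Qed.

Lemma zint_ge0 p : (forall u, -1 <= u <= 1 -> 0 <= p.[u]) -> 0 <= zint p.
Proof.
move=> p0; rewrite -[leLHS](@smean_cst R d).
apply: smean_ler; [exact: polyfun_sapprox (polyfun_cst 0)|exact: zonal_poly_sapprox|].
by move=> x Sx; apply: p0; apply: dot_sphere => //; exact: sphere_pole.
Qed.

(** For odd k both moments vanish. For even k the squared coordinates sum to 1: the pole direction
    contributes [mom k.+2], and each of the d orthogonal directions the bimoment at inner product 0,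
    which is [mom k.+2] divided by k + 1. *)
Lemma mom_rec k : (k.+1 + d)%:R * mom k.+2 = k.+1%:R * mom k.
Proof.
have [ok|ek] := boolP (odd k).
  by rewrite /mom !smean_dotX_odd ?mulr0//= negbK.
have kE : k = k./2.*2 by rewrite -[LHS]odd_double_half (negPf ek).
have H (i : 'I_d.+1) : i != ord0 ->
    k.+1%:R * bimom k 2 pole (delta_mx i ord0) = mom k.+2.
  move=> i0; rewrite bimomE; [|exact: sphere_pole|exact: sphere_delta].
  rewrite dot_delta mxE eqxx andbT eq_sym (negPf i0) /bipoly addn2 /= negbK (negPf ek).
  have [_ _ q2] := @qcoef_at0 R k./2.+1.
  rewrite hornerZ -[X in _ * (_ * X) = _]/((qcoef k./2.+1 2).[0]) q2.
  have -> : 'C(k.+2, 2)%:R = k./2.+1%:R * k.+1%:R :> R.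
    rewrite -natrM; congr _%:R; rewrite bin2 succnK.
    rewrite (_ : k.+2 * k.+1 = (k./2.+1 * k.+1).*2)%N ?doubleK//.
    by rewrite doubleMl doubleS -kE.
  have a0 : k./2.+1%:R != 0 :> R by rewrite pnatr_eq0.
  have b0 : k.+1%:R != 0 :> R by rewrite pnatr_eq0.
  move: a0 b0; move: (k./2.+1%:R : R) (k.+1%:R : R) => a b a0 b0.
  by field; rewrite a0 b0.
have : k.+1%:R * \sum_(i < d.+1 | i != ord0) bimom k 2 pole (delta_mx i ord0) =
    d%:R * mom k.+2.
  rewrite mulr_sumr (eq_bigr (fun=> mom k.+2)) => [|i /H//].
  rewrite sumr_const [RHS]mulr_natl; congr (_ *+ _).
  by rewrite cardC1 card_ord.
have -> : \sum_(i < d.+1 | i != ord0) bimom k 2 pole (delta_mx i ord0) = mom k - mom k.+2.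
  have -> : mom k = \sum_(i < d.+1) bimom k 2 pole (delta_mx i ord0).
    rewrite -smean_sum; last first.
      by move=> i; apply: polyfun_sapprox; exact: polyfun_bimom.
    apply: eq_smean => x /sphereE x1; rewrite -mulr_sumr.
    rewrite -[LHS]mulr1 -x1; congr (_ * _); rewrite dotE.
    by apply: eq_bigr => i _; rewrite dot_delta expr2.
  rewrite [in RHS](bigD1 ord0)//= addrAC [X in X - _](_ : _ = mom k.+2) ?subrr ?add0r//.
  by apply: eq_smean => x _; rewrite -exprD addn2.
by rewrite natrD mulrDl mulrBr => <-; rewrite addrC subrK.
Qed.

(** Integration by parts against the weight (1 - u^2)^(d/2 - 1), the density of the height u up to a
    constant; on monomials it is the moment recurrence. *)
Lemma zint_deriv p : zint ((1 - 'X^2) * p^`()) = d%:R * zint ('X * p).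
Proof.
rewrite -[p]coefK poly_def linear_sum/= !mulr_sumr !zint_sum mulr_sumr.
apply: eq_bigr => -[k kp] _ /=.
rewrite derivZ -!scalerAr !zintZ mulrCA; congr (_ * _).
rewrite derivXn mulrBl mul1r -exprS.
case: k {kp} => [|k].
  by rewrite /= mulr0n mulr0 subrr zint0 zintX /mom smean_dotX_odd// mulr0.
rewrite /= -mulr_natl mulrCA -exprD zintB !zintX.
have mN j i : zint (j%:R * 'X^i) = j%:R * mom i.
  by rewrite -polyC_natr mul_polyC zintZ zintX.
rewrite !mN addnC addn2; have := mom_rec k; rewrite natrD; lra.
Qed.

End zonal_theory.

Section strict_positivity.
Context {R : realType} {d : nat}.
Hypothesis hd : (0 < d)%N.
Notation V := 'cV[R]_d.+1.
Notation S := (sphere R d).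
Implicit Types (x y z : V) (p q : {poly R}) (u : R).

(** The open bands of points at inner product close to u0 with a centre z cover the sphere when z
    runs over it. The argument is carried out on row vectors, where the sphere is closed in a
    compact cube. *)
Lemma sphere_net (u0 dl : R) : -1 <= u0 <= 1 -> 0 < dl -> exists s : seq V,
  (forall z, z \in s -> S z) /\
  forall x, S x -> exists2 z, z \in s & `|dot z x - u0| < dl.
Proof.
move=> u01 dl0.
pose phi z (v : 'rV[R]_d.+1) := \sum_i z i ord0 * v ord0 i.
have phiE z x : phi z x^T = dot z x.
  by rewrite dotE; apply: eq_bigr => i _; rewrite mxE.
have phic z : continuous (phi z).
  move=> v; apply: (@cvg_bigsum _ _ _ (nbhs v)) => i; apply: cvgMr; exact: coord_continuous.
pose sqn (v : 'rV[R]_d.+1) := \sum_i v ord0 i * v ord0 i.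
have sqnc : continuous sqn.
  by move=> v; apply: (@cvg_bigsum _ _ _ (nbhs v)) => i; apply: cvgM; exact: coord_continuous.
pose K := [set v : 'rV[R]_d.+1 | sqn v = 1].
have Kcpt : compact K.
  have Kcube : compact [set v : 'rV[R]_d.+1 | forall i, `[-1, 1]%classic (v ord0 i)].
    apply: (@rV_compact R _ (fun=> `[-1, 1]%classic)) => _; exact: segment_compact.
  apply: subclosed_compact Kcube _.
    apply: (@preimage_closed _ _ sqn [set 1]); last exact: closed_eq.
    by move=> v _; exact: sqnc.
  move=> v Kv i /=; rewrite in_itv/= -ler_norml.
  rewrite -(@ler_pXn2r _ 2)// ?nnegrE// real_normK ?num_real// expr1n -Kv /sqn.
  rewrite (bigD1 i)//= -expr2 lerDl.
  by apply: sumr_ge0 => j _; rewrite -expr2 sqr_ge0.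
have sqnE x : sqn x^T = dot x x.
  by rewrite dotE; apply: eq_bigr => i _; rewrite !mxE.
move: Kcpt; rewrite compact_cover => /(_ V S (fun z => [set v | `|phi z v - u0| < dl])).
case.
- move=> z _; rewrite (_ : mkset _ = phi z @^-1` (ball u0 dl)).
    apply: open_comp; last exact: ball_open.
    by move=> v _; exact: phic.
  by apply/funext => v; rewrite /preimage/ball/= distrC.
- move=> v Kv; pose x := v^T.
  have x1 : dot x x = 1 by rewrite -sqnE trmxK.
  (* The reflection exchanging x and the pole sends [meridian u0] to a point whose inner product
     with x is exactly u0. *)
  exists (refl (pole - x) (meridian u0)).
    by apply/sphereE; rewrite dot_refl; apply/sphereE; exact: sphere_meridian.
  rewrite /= -[v]trmxK phiE refl_adj -/x dotC.
  have -> : refl (pole - x) x = pole.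
    rewrite -{2}(@refl_swap R d.+1 x pole) ?x1 ?dot_pole// /refl.
    by rewrite -(opprB x pole) !(dotNl, dotNr, scalerN) !mulrN mulNr opprK scaleNr opprK.
  by rewrite dot_meridian// subrr normr0.
- move=> D DS cov; exists (finmap.enum_fset D); split => [z zD|x Sx].
    by have := DS z zD; rewrite inE.
  have [|z zD hz] := cov x^T; first by rewrite /K/= sqnE; exact/sphereE.
  by exists z => //; rewrite -phiE.
Qed.

(** A band where h is at least eta / 4 has finitely many rotated copies covering the sphere, so the
    sum of the rotated h has mean at least eta / 4. All copies have the same mean, which therefore
    is not 0. The three losses of eta / 4 come from approximating h at u and at u0 and from the
    continuity of the polynomial. *)
Lemma smean_zonal_gt0 (h : R -> R) u0 : poly_approx h ->
  (forall u, -1 <= u <= 1 -> 0 <= h u) -> -1 <= u0 <= 1 -> 0 < h u0 ->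
  0 < smean (fun x : V => h (dot pole x)).
Proof.
move=> ha h0 u01 hu0; set eta := h u0 in hu0.
have e0 : 0 < eta / 4 by rewrite divr_gt0.
have [p hp] := ha _ e0.
have /cvgrPdist_le/(_ _ e0)/nbhs_ballP[dl /= dl0 hdl] :
  horner p u @[u --> u0] --> p.[u0] by exact: continuous_horner.
have hlow u : -1 <= u <= 1 -> `|u - u0| < dl -> eta / 4 <= h u.
  move=> u1 uu0; have := hdl u; rewrite /ball/= distrC => /(_ uu0).
  have := hp u u1; have := hp u0 u01; rewrite -/eta !ler_norml.
  by lra.
have [s [sS snet]] := sphere_net u01 dl0.
have spole := @sphere_pole R d.
pose g z : V -> R := if z \in s then (fun x => h (dot z x)) else fun=> 0.
have ga z : sapprox (g z).
  rewrite /g; case: ifP => zs; last exact: polyfun_sapprox (polyfun_cst 0).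
  by apply: zonal_sapprox => //; exact: sS.
have H : eta / 4 <= smean (fun x => \sum_(z <- s) g z x).
  rewrite -[leLHS](@smean_cst R d); apply: smean_ler.
  - exact: polyfun_sapprox (polyfun_cst _).
  - elim: (s) => [|z t IH].
      apply: polyfun_sapprox; exists [::] => x.
      by rewrite /fint !big_nil.
    by under eq_fun do rewrite big_cons; exact: sapproxD.
  - move=> x Sx; have [z zs hz] := snet x Sx.
    have g0 y : 0 <= g y x.
      by rewrite /g; case: ifP => // ys; apply: h0; apply: dot_sphere => //; exact: sS.
    apply: (@le_trans _ _ (g z x)).
      rewrite /g zs; apply: hlow => //; apply: dot_sphere => //; exact: sS.
    by rewrite (big_rem z)//= lerDl sumr_ge0.
rewrite lt_neqAle; apply/andP; split; last first.
  rewrite -[leLHS](@smean_cst R d); apply: smean_ler.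
  - exact: polyfun_sapprox (polyfun_cst _).
  - exact: zonal_sapprox.
  - by move=> x Sx; apply: h0; exact: dot_sphere.
apply/eqP => hz; move: H; rewrite smean_sum// big1_seq ?leNgt ?e0// => z /andP[_ zs].
rewrite /g zs hz; apply: smean_zonal => //; exact: sS.
Qed.

Lemma poly0_itv p : (forall u, -1 <= u <= 1 -> p.[u] = 0) -> p = 0.
Proof.
move=> p0; apply/eqP/negPn/negP => pn0.
have := max_poly_roots pn0 (rs := [seq i.+1%:R^-1 | i <- iota 0 (size p)]).
rewrite size_map size_iota ltnn => h; suff : false by [].
apply: h; last first.
  rewrite map_inj_uniq ?iota_uniq// => i j /invr_inj/eqP.
  by rewrite eqr_nat => /eqP[].
apply/allP => _ /mapP[i _ ->]; rewrite /root p0// (@le_trans _ _ 0)//=.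
by rewrite invf_le1 ?ltr0n// ler1n.
Qed.

Lemma zint_sqr_eq0 p : @zint R d (p * p) = 0 -> p = 0.
Proof.
move=> pp0; apply: poly0_itv => u u1; apply/eqP/negPn/negP => pu.
have := @smean_zonal_gt0 (horner (p * p)) u (poly_approx_poly _) _ u1.
rewrite -/(@zint R d (p * p)) pp0 ltxx => h; suff : false by [].
apply: h => [v _|]; rewrite hornerM -expr2 ?sqr_ge0//.
by rewrite lt_neqAle sqr_ge0 eq_sym sqrf_eq0 pu.
Qed.

End strict_positivity.

(** * Orthogonality, Funk-Hecke formula and completeness *)

Section spherical_harmonics.
Context {R : realType} {d : nat}.
Hypothesis hd : (0 < d)%N.
Notation V := 'cV[R]_d.+1.
Notation S := (sphere R d).
Notation zint := (@zint R d).
Notation Q := (ngeg R d).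
Implicit Types (x y z : V) (p q : {poly R}) (u : R).

(** The integral operator with kernel (x . y)^a, as a map on zonal polynomials. *)
Definition transfer a q : {poly R} := \sum_(b < size q) q`_b *: @bipoly R d a b.

Lemma size_transfer a q : (size (transfer a q) <= size q)%N.
Proof.
apply: (leq_trans (size_sum _ _ _)); apply/bigmax_leqP => -[b bq] _ /=.
by rewrite (leq_trans (size_scale_leq _ _))// (leq_trans (size_bipoly _ _)).
Qed.

Lemma polyfun_transfer a q x z : polyfun (fun y : V => dot x y ^+ a * q.[dot z y]).
Proof. by apply: polyfunM; [exact: polyfun_dotX|exact: polyfun_zonal]. Qed.

Lemma transferE a q x z : S x -> S z ->
  smean (fun y => dot x y ^+ a * q.[dot z y]) = (transfer a q).[dot x z].
Proof.
move=> Sx Sz; rewrite /transfer horner_sum.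
pose F (b : 'I_(size q)) (y : V) := q`_b * (dot x y ^+ a * dot z y ^+ b).
rewrite (eq_bigr (fun b => smean (F b))) => [|b _]; last first.
  rewrite hornerZ -bimomE// -smeanZ//.
  by apply: polyfun_sapprox; exact: polyfun_bimom.
rewrite -smean_sum => [|b]; last first.
  by apply: polyfun_sapprox; apply: polyfunZ; exact: polyfun_bimom.
apply: eq_smean => y _; rewrite horner_coef mulr_sumr.
by apply: eq_bigr => b _; rewrite /F mulrCA.
Qed.

Lemma bmean_transfer a p q :
  bmean (fun x y : V => dot x y ^+ a * (p.[dot pole x] * q.[dot pole y])) @ (\oo, \oo)
    --> zint (p * transfer a q).
Proof.
have /cvg_ex[l Fl] := @bmean_polyfun R d _ _ a (polyfun_zonal p pole) (polyfun_zonal q pole).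
suff <- : l = zint (p * transfer a q) by [].
have H := bmean_iter Fl.
apply: (@cvg_unique _ (@norm_hausdorff _ R^o) _ _ _ _ (H _)).
  move=> x; apply: polyfun_sapprox.
  have [s hs] := polyfunZ p.[dot pole x] (polyfun_transfer a q x pole).
  by exists s => y; rewrite -hs; ring.
rewrite (_ : (fun N => _) = fun N => fint (unif N) (fun x => (p * transfer a q).[dot pole x])).
  by apply: smean_cvg; exact: zonal_poly_sapprox.
apply/funext => N; apply: fprob_eq (unif_prob N) _ => x Sx.
rewrite hornerM [X in _ * _.[X]]dotC -transferE//; last exact: sphere_pole.
rewrite -smeanZ; last by apply: polyfun_sapprox; exact: polyfun_transfer.
by apply: eq_smean => y _; ring.
Qed.

(** Both sides are limits of one double mean, read with x and y exchanged: the kernel is symmetric,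
    so the operator is self-adjoint. *)
Lemma transfer_sym a p q : zint (p * transfer a q) = zint (q * transfer a p).
Proof.
have H := bmean_swap (@bmean_transfer a p q).
apply: (@cvg_unique _ (@norm_hausdorff _ R^o) _ _ _ _ H).
rewrite (_ : (fun x y => _) =
  (fun x y : V => dot x y ^+ a * (q.[dot pole x] * p.[dot pole y]))).
  exact: bmean_transfer.
by apply/funext => x; apply/funext => y; rewrite dotC; ring.
Qed.

(* Sturm-Liouville operator of the ultraspherical polynomials. *)
Let slop p : {poly R} := (1 - 'X^2) * p^`()^`() - d%:R *: ('X * p^`()).

(** Green's identity: integration by parts leaves an expression symmetric in p and q. *)
Let slopE p q : zint (q * slop p) = - zint ((1 - 'X^2) * (p^`() * q^`())).
Proof.
have := @zint_deriv R d (p^`() * q).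
rewrite derivM mulrDr zintD -zintZ => h.
have -> : q * slop p = (1 - 'X^2) * (p^`()^`() * q) - d%:R *: ('X * (p^`() * q)).
  by rewrite /slop -!mul_polyC; ring.
by rewrite zintB -h; ring.
Qed.

Let slop_sym p q : zint (q * slop p) = zint (p * slop q).
Proof. by rewrite !slopE (mulrC p^`()). Qed.

(** The self-adjoint operator [slop] has Q_n as eigenfunction and is triangular on monomials with
    diagonal entries -k (k + d - 1). Induction removes the term in X^(k - 2), and the eigenvalues
    for n and k differ. *)
Lemma zint_ngegX n k : (k < n)%N -> zint (Q n * 'X^k) = 0.
Proof.
elim/ltn_ind: k => k IH kn.
have slopX : slop 'X^k = (k * k.-1)%:R *: 'X^(k.-2) - (k * (k + d.-1))%:R *: 'X^k.
  rewrite /slop; case: k {IH kn} => [|[|k]].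
  - by rewrite derivC deriv0 !mulr0 scaler0 !mul0n !scale0r.
  - rewrite derivX derivC mulr0 mulr1 muln0 scale0r mul1n add1n prednK//.
  - rewrite derivXn derivMn derivXn /= -!mul_polyC !polyC_natr.
    rewrite -[in d%:R](prednK hd) !natrM !natrD !exprS.
    by ring.
have := slop_sym (Q n) 'X^k.
rewrite slopX /slop ngeg_ode// mulrBr -!scalerAr !(zintB, zintZ).
have -> : (k * k.-1)%:R * zint (Q n * 'X^(k.-2)) = 0.
  case: k IH kn {slopX} => [|[|k]] IH kn; rewrite ?muln0 ?mul0r//=.
  by rewrite IH ?mulr0// ?(ltn_trans _ kn)// ltnS leqW.
rewrite add0r [in LHS]mulrC => h.
have {}h : ((n * (n + d.-1))%:R - (k * (k + d.-1))%:R) * zint (Q n * 'X^k) = 0.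
  by move: h; rewrite (mulrC 'X^k); lra.
move/eqP: h; rewrite mulf_eq0 subr_eq0 eqr_nat => /orP[|/eqP//].
rewrite gtn_eqF// (@leq_ltn_trans (k * (n + d.-1)))//.
  by rewrite leq_mul2l leq_add2r ltnW ?orbT.
by rewrite ltn_mul2r kn andbT addn_gt0 (leq_ltn_trans _ kn).
Qed.

Lemma zint_ngeg_low n q : (size q <= n)%N -> zint (Q n * q) = 0.
Proof.
move=> qn; rewrite -[q]coefK poly_def mulr_sumr zint_sum big1// => -[k kq] _ /=.
by rewrite -scalerAr zintZ zint_ngegX ?mulr0// (leq_trans kq).
Qed.

Lemma zint_ngeg_orth n k : n != k -> zint (Q n * Q k) = 0.
Proof.
rewrite neq_ltn => /orP[nk|kn].
  by rewrite mulrC zint_ngeg_low// size_ngeg.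
by rewrite zint_ngeg_low// size_ngeg.
Qed.

Lemma ngeg_cancel n q : (size q <= n.+1)%N ->
  exists c : R, (size (q - c *: Q n)%R <= n)%N.
Proof.
move=> qn; exists (q`_n / (Q n)`_n); apply/leq_sizeP => j nj.
have lQ : (Q n)`_n != 0.
  have := ngeg_neq0 R d n; rewrite -lead_coef_eq0 lead_coefE size_ngeg.
  by [].
rewrite coefB coefZ; case: (ltngtP n j) nj => // [nj _|<- _].
  rewrite (nth_default _ (leq_trans qn nj)) (@nth_default _ _ (Q n) j) ?size_ngeg//.
  by rewrite mulr0 subrr.
by rewrite divfK// subrr.
Qed.

(** Let r be the image of Q_n minus the multiple of Q_n that lowers the degree below n. Then r is
    orthogonal to Q_n, and by self-adjointness also to the image of Q_n, since the image of r has
    degree below n; so r is orthogonal to itself. The eigenvalue is read off at x = z = [pole]. *)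
Lemma transfer_ngeg a n : transfer a (Q n) = zint ('X^a * Q n) *: Q n.
Proof.
have [|c hc] := @ngeg_cancel n (transfer a (Q n)).
  by rewrite (leq_trans (size_transfer _ _))// size_ngeg.
set r := transfer a (Q n) - c *: Q n in hc.
have r0 : r = 0.
  apply: (@zint_sqr_eq0 R d hd).
  rewrite {2}/r mulrBr zintB transfer_sym -scalerAr zintZ (mulrC r).
  rewrite zint_ngeg_low; last by rewrite (leq_trans (size_transfer _ _)).
  by rewrite zint_ngeg_low// mulr0 subrr.
have E : transfer a (Q n) = c *: Q n by apply/eqP; rewrite -subr_eq0 -/r r0.
rewrite E; congr (_ *: _).
have := transferE a (Q n) (@sphere_pole R d) (@sphere_pole R d).
rewrite E dot_pole hornerZ ngeg_at1 mulr1 => <-.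
by apply: eq_smean => y _; rewrite hornerM hornerXn.
Qed.

(** Linear extension from powers of x . y. For p = Q_n it says that Q_n is its own reproducing
    kernel up to the factor [kappa n]. *)
Lemma funk_hecke p n x z : S x -> S z ->
  smean (fun y => p.[dot x y] * (Q n).[dot z y]) = zint (p * Q n) * (Q n).[dot x z].
Proof.
move=> Sx Sz.
pose F (a : 'I_(size p)) (y : V) := p`_a * (dot x y ^+ a * (Q n).[dot z y]).
rewrite (@eq_smean _ _ _ (fun y => \sum_a F a y)) => [|y _]; last first.
  by rewrite horner_coef mulr_suml; apply: eq_bigr => a _; rewrite /F -mulrA.
rewrite smean_sum => [|a]; last first.
  by apply: polyfun_sapprox; apply: polyfunZ; exact: polyfun_transfer.
rewrite -[p in zint (p * _)]coefK poly_def mulr_suml zint_sum mulr_suml.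
apply: eq_bigr => a _; rewrite smeanZ; last first.
  by apply: polyfun_sapprox; exact: polyfun_transfer.
by rewrite transferE// transfer_ngeg hornerZ -scalerAl zintZ mulrA.
Qed.

(** Classically the inverse of the dimension of the space of spherical harmonics of degree n. *)
Definition kappa n := zint (Q n * Q n).

Lemma kappa_gt0 n : 0 < kappa n.
Proof.
rewrite lt_neqAle; apply/andP; split.
  apply/eqP => /esym/(@zint_sqr_eq0 R d hd) /eqP.
  by rewrite (negPf (ngeg_neq0 R d n)).
by apply: zint_ge0 => u _; rewrite hornerM -expr2 sqr_ge0.
Qed.

(** By the reproducing property the mean of (c Q_n(pole . y) + Q_n(z . y))^2, with c = 1 or -1,
    equals 2 [kappa n] (1 + c Q_n(u)). *)
Lemma ngeg_le1 n u : -1 <= u <= 1 -> `|(Q n).[u]| <= 1.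
Proof.
move=> u1; pose z : V := meridian u.
have Sz : S z by exact: sphere_meridian.
have Sp := @sphere_pole R d.
have H (c : R) : c ^+ 2 = 1 -> 0 <= 1 + c * (Q n).[u].
  move=> c1.
  have pa y : polyfun (fun x : V => (Q n).[dot y x]) by exact: polyfun_zonal.
  have : 0 <= smean (fun y : V => (Q n * Q n).[dot pole y] +
      (c * 2 * ((Q n).[dot pole y] * (Q n).[dot z y]) + (Q n * Q n).[dot z y])).
    rewrite -[leLHS](@smean_cst R d); apply: smean_ler.
    - exact: polyfun_sapprox (polyfun_cst _).
    - apply: polyfun_sapprox; apply: polyfunD; first exact: polyfun_zonal.
      by apply: polyfunD; [apply: polyfunZ; exact: polyfunM|exact: polyfun_zonal].
    - move=> x _; rewrite !hornerM.
      move: (Q n).[_] (Q n).[_] => s t.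
      rewrite (_ : _ + _ = (s * c + t) ^+ 2) ?sqr_ge0//.
      by rewrite sqrrD exprMn c1; ring.
  rewrite smeanD; last 2 first.
  - by apply: polyfun_sapprox; exact: polyfun_zonal.
  - apply: polyfun_sapprox; apply: polyfunD; last exact: polyfun_zonal.
    by apply: polyfunZ; exact: polyfunM.
  rewrite smeanD; last 2 first.
  - by apply: polyfun_sapprox; apply: polyfunZ; exact: polyfunM.
  - by apply: polyfun_sapprox; exact: polyfun_zonal.
  rewrite smeanZ; last by apply: polyfun_sapprox; exact: polyfunM.
  rewrite funk_hecke// !zintE// dot_meridian// -/(kappa n) => h.
  rewrite -(pmulr_rge0 _ (kappa_gt0 n)).
  by move: h; lra.
have := H 1; have := H (-1); rewrite sqrrN expr1n => /(_ erefl) H1 /(_ erefl) H2.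
by rewrite ler_norml; move: H1 H2; lra.
Qed.

(** Unnormalized: the zonal series of h has coefficients [zcoef h n / kappa n]. *)
Definition zcoef (h : R -> R) n := smean (fun x : V => h (dot pole x) * (Q n).[dot pole x]).

Lemma zcoef_sapprox h n : poly_approx h ->
  sapprox (fun x : V => h (dot pole x) * (Q n).[dot pole x]).
Proof.
move=> ha; apply: sapproxMp; last exact: polyfun_zonal.
by apply: zonal_sapprox => //; exact: sphere_pole.
Qed.

Lemma zcoef_poly p n : zcoef (horner p) n = zint (p * Q n).
Proof. by apply: eq_smean => x _; rewrite hornerM. Qed.

Lemma zcoef_dist h g e n : poly_approx h -> poly_approx g ->
  (forall u, -1 <= u <= 1 -> `|h u - g u| <= e) -> `|zcoef h n - zcoef g n| <= e.
Proof.
move=> ha ga hg; apply: smean_dist; try exact: zcoef_sapprox.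
move=> x Sx; rewrite -mulrBl normrM -[leRHS]mulr1.
have d1 := dot_sphere (@sphere_pole R d) Sx.
by apply: ler_pM => //; [exact: hg|exact: ngeg_le1].
Qed.

Lemma kappa_le1 n : kappa n <= 1.
Proof.
rewrite /kappa -[leRHS](@smean_cst R d); apply: smean_ler.
- exact: zonal_poly_sapprox.
- exact: polyfun_sapprox (polyfun_cst _).
- move=> x Sx; rewrite hornerM -expr2 -real_normK ?num_real// expr_le1//.
  by apply: ngeg_le1; apply: dot_sphere => //; exact: sphere_pole.
Qed.

Lemma bmean_zonal_poly p n k :
  bmean (fun x y : V => p.[dot x y] * ((Q n).[dot pole x] * (Q k).[dot pole y]))
    @ (\oo, \oo) --> (n == k)%:R * (zint (p * Q n) * kappa n).
Proof.
pose F (a : 'I_(size p)) (x y : V) :=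
  dot x y ^+ a * ((Q n).[dot pole x] * (Q k).[dot pole y]).
rewrite (_ : bmean _ = fun NM => \sum_(a < size p) p`_a * bmean (F a) NM); last first.
  apply/funext => NM; under eq_bigr do rewrite /bmean -fintZ.
  rewrite -fint_sum; apply: eq_fint => x.
  under eq_bigr do rewrite -fintZ.
  rewrite -fint_sum; apply: eq_fint => y.
  by rewrite horner_coef mulr_suml; apply: eq_bigr => a _; rewrite /F -mulrA.
rewrite (_ : _ * _ = \sum_(a < size p) p`_a * zint (Q n * transfer a (Q k))).
  by apply: cvg_bigsum => a; apply: cvgMr; exact: bmean_transfer.
rewrite -[p in zint (p * _)]coefK poly_def mulr_suml zint_sum mulr_suml mulr_sumr.
apply: eq_bigr => a _; rewrite transfer_ngeg -[Q n * (_ *: _)]scalerAr -[_ *: _ * Q n]scalerAl !zintZ.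
have [->|nk] := eqVneq n k; first by rewrite mul1r -mulrA.
by rewrite mul0r zint_ngeg_orth// !mulr0.
Qed.

(** Obtained from the polynomial case by uniform approximation. This limit turns positive
    definiteness into information on coefficients and gives the Gram matrix of the harmonic averages
    of the field. *)
Lemma bmean_zonal h n k : poly_approx h ->
  bmean (fun x y : V => h (dot x y) * ((Q n).[dot pole x] * (Q k).[dot pole y]))
    @ (\oo, \oo) --> (n == k)%:R * (zcoef h n * kappa n).
Proof.
move=> ha; apply: cvg_uniform_approx => e e0.
have [p hp] := ha _ e0.
eexists; eexists; split; first exact: (@bmean_zonal_poly p n k).
  apply: nearW => -[N M]; rewrite /bmean/=.
  apply: fprob_dist (unif_prob N) _ => x Sx.
  apply: fprob_dist (unif_prob M) _ => y Sy.
  have Sp := @sphere_pole R d.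
  rewrite -mulrBl normrM -[leRHS]mulr1; apply: ler_pM => //.
    by apply: hp; exact: dot_sphere.
  by rewrite normrM mulr_ile1// ngeg_le1// dot_sphere.
rewrite -mulrBr -mulrBl -zcoef_poly !normrM (gtr0_norm (kappa_gt0 n)).
rewrite -[leRHS]mul1r; apply: ler_pM => //; first by rewrite mulr_ge0// ltW// kappa_gt0.
  by rewrite ger0_norm// lern1; case: eqP.
rewrite -[leRHS]mulr1; apply: ler_pM => //.
- by rewrite ltW// kappa_gt0.
- apply: zcoef_dist => //; exact: poly_approx_poly.
- exact: kappa_le1.
Qed.

(** Subtracting multiples of Q_n to lower degrees shows that h is orthogonal to every polynomial.
    Approximating one factor of h^2 makes its mean 0, and strict positivity concludes. *)
Lemma zcoef_inj h : poly_approx h -> (forall n, zcoef h n = 0) ->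
  forall u, -1 <= u <= 1 -> h u = 0.
Proof.
move=> ha h0.
have hq n q : (size q <= n)%N -> smean (fun x : V => h (dot pole x) * q.[dot pole x]) = 0.
  elim: n q => [|n IH] q qn.
    move: qn; rewrite leqn0 size_poly_eq0 => /eqP ->.
    rewrite -[RHS](@smean_cst R d); apply: eq_smean => x _.
    by rewrite horner0 mulr0.
  have [c hc] := ngeg_cancel qn.
  have -> : (fun x : V => h (dot pole x) * q.[dot pole x]) = (fun x : V =>
      h (dot pole x) * (q - c *: Q n).[dot pole x] +
      c * (h (dot pole x) * (Q n).[dot pole x])).
    by apply/funext => x; rewrite hornerD hornerN hornerZ; ring.
  rewrite smeanD; last 2 first.
  - apply: sapproxMp; last exact: polyfun_zonal.
    by apply: zonal_sapprox => //; exact: sphere_pole.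
  - by apply: sapproxZ; exact: zcoef_sapprox.
  rewrite IH// smeanZ; last exact: zcoef_sapprox.
  by rewrite -/(zcoef h n) h0 mulr0 addr0.
have hh := poly_approxM ha ha.
have Sp := @sphere_pole R d.
have hh0 : smean (fun x : V => h (dot pole x) * h (dot pole x)) <= 0.
  apply/ler_addgt0Pr => e e0; rewrite add0r.
  have [B B0 hB] := poly_approx_bounded ha.
  have [p hp] := ha _ (divr_gt0 e0 B0).
  apply: le_trans (ler_norm _) _.
  rewrite -[X in `|X|]subr0 -(hq _ p (leqnn _)); apply: smean_dist.
  - exact: (zonal_sapprox hh).
  - apply: sapproxMp; last exact: polyfun_zonal.
    exact: zonal_sapprox.
  - move=> x Sx; rewrite -mulrBr normrM.
    have d1 := dot_sphere Sp Sx.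
    rewrite (le_trans (ler_pM _ _ (hB _ d1) (hp _ d1)))//.
    by rewrite mulrC divfK// gt_eqF.
move=> u u1; apply/eqP/negPn/negP => hu.
have : 0 < smean (fun x : V => h (dot pole x) * h (dot pole x)).
  apply: (@smean_zonal_gt0 R d hd (fun v => h v * h v) u hh) => //.
    by move=> v _; rewrite -expr2 sqr_ge0.
  by rewrite lt_neqAle eq_sym mulf_neq0//= -expr2 sqr_ge0.
by rewrite ltNge hh0.
Qed.

End spherical_harmonics.

(** * Positive definite kernels *)

Section positive_definite_kernels.
Context {R : realType} {d : nat}.
Hypothesis hd : (0 < d)%N.
Notation V := 'cV[R]_d.+1.
Notation S := (sphere R d).
Notation Q := (ngeg R d).
Notation zcoef := (@zcoef R d).
Notation kappa := (@kappa R d).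
Notation zint := (@zint R d).

Lemma zcoefD h g n : poly_approx h -> poly_approx g ->
  zcoef (fun u => h u + g u) n = zcoef h n + zcoef g n.
Proof.
move=> ha ga; rewrite /zcoef -smeanD; try exact: zcoef_sapprox.
by apply: eq_smean => x _; rewrite mulrDl.
Qed.

Lemma zcoefN h n : poly_approx h -> zcoef (fun u => - h u) n = - zcoef h n.
Proof.
move=> ha; rewrite /zcoef -mulN1r -smeanZ; last exact: zcoef_sapprox.
by apply: eq_smean => x _; rewrite mulNr mulN1r.
Qed.

Lemma eq_zcoef h g n : (forall u, -1 <= u <= 1 -> h u = g u) -> zcoef h n = zcoef g n.
Proof.
move=> hg; apply: eq_smean => x Sx; rewrite hg//.
by apply: dot_sphere => //; exact: sphere_pole.
Qed.

(** The measure of density phi with respect to nu, placed at the index a. *)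
Definition fweight {T : Type} (phi : V -> R) (a : T) (nu : seq (R * V)) :
  seq (R * (V * T)) := [seq (p.1 * phi p.2, (p.2, a)) | p <- nu].

Lemma fint_weight {T : Type} phi (a : T) nu (F : V * T -> R) :
  fint (fweight phi a nu) F = fint nu (fun x => phi x * F (x, a)).
Proof. by rewrite /fint big_map; apply: eq_bigr => p _; rewrite mulrA. Qed.

Lemma fint_dirac {T : Type} (a : T) (F : T -> R) : fint [:: (1, a)] F = F a.
Proof. by rewrite /fint big_seq1 mul1r. Qed.

Lemma bmean_diag (F : nat * nat -> R) (l : R) : F @ (\oo, \oo) --> l ->
  F (N, N) @[N --> \oo] --> l.
Proof.
move=> /cvgn2_epsP Fl; apply/cvgn_epsP => e e0.
by have [K hK] := Fl _ e0; exists K => N KN; exact: hK.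
Qed.

Context {J : Type} (K : J -> J -> R -> R).

Definition on_sphere (s : seq (R * (V * J))) := List.Forall (fun p => S p.2.1) s.

Definition qform (s t : seq (R * (V * J))) : R :=
  fint s (fun p => fint t (fun q => K p.2 q.2 (dot p.1 q.1))).

Hypothesis Kpsd : forall s, on_sphere s -> 0 <= qform s s.
Hypothesis Ksym : forall a b u, K a b u = K b a u.
Hypothesis Kappr : forall a b, poly_approx (K a b).

Lemma on_sphere_weight phi a N : on_sphere (fweight phi a (unif N)).
Proof.
have [+ _] := @unif_prob R d N; rewrite /on_sphere; elim: (unif N) => [|p nu IH] h.
  by constructor.
inversion h as [|? ? [_ Sp] h']; subst.
by constructor => //; exact: IH.
Qed.

Lemma qformDl s s' t : qform (s ++ s') t = qform s t + qform s' t.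
Proof. by rewrite /qform fint_cat. Qed.

Lemma qformDr s t t' : qform s (t ++ t') = qform s t + qform s t'.
Proof. by rewrite /qform -fintD; apply: eq_fint => p; rewrite fint_cat. Qed.

Lemma qform_sym s t : qform s t = qform t s.
Proof.
rewrite /qform fintC; apply: eq_fint => p; apply: eq_fint => q.
by rewrite Ksym dotC.
Qed.

Let harm n (x : V) : R := (Q n).[dot pole x].

Lemma qform_weight n k (c c' : R) a b N M :
  qform (fweight (fun x => c * harm n x) a (unif N))
        (fweight (fun x => c' * harm k x) b (unif M)) =
  c * c' * bmean (fun x y => K a b (dot x y) * (harm n x * harm k y)) (N, M).
Proof.
rewrite /qform fint_weight /bmean -fintZ; apply: eq_fint => x.
rewrite fint_weight -!fintZ; apply: eq_fint => y /=.
by ring.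
Qed.

Lemma qform_weight_cvg n k (c c' : R) a b :
  qform (fweight (fun x => c * harm n x) a (unif N))
        (fweight (fun x => c' * harm k x) b (unif N)) @[N --> \oo] -->
  c * c' * ((n == k)%:R * (zcoef (K a b) n * kappa n)).
Proof.
under eq_fun do rewrite qform_weight.
apply: cvgMr.
by have /bmean_diag := @bmean_zonal R d hd (K a b) n k (Kappr a b).
Qed.

Lemma zcoef_sym a b n : zcoef (K b a) n = zcoef (K a b) n.
Proof. by apply: eq_zcoef => u _; exact: Ksym. Qed.

(** Positive definiteness is tested on Q_n placed at a plus c times Q_n placed at b, with c = 1 or
    -1. *)
Lemma zcoef_cross a b n :
  2 * `|zcoef (K a b) n| <= zcoef (K a a) n + zcoef (K b b) n.
Proof.
have H (c : R) : c ^+ 2 = 1 ->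
    0 <= zcoef (K a a) n + c * 2 * zcoef (K a b) n + zcoef (K b b) n.
  move=> c1; rewrite -(pmulr_lge0 _ (kappa_gt0 hd n)).
  pose s N := fweight (fun x => 1 * harm n x) a (unif N) ++
              fweight (fun x => c * harm n x) b (unif N).
  have sS N : on_sphere (s N).
    by apply/List.Forall_app; split; exact: on_sphere_weight.
  have := cvgD (cvgD (@qform_weight_cvg n n 1 1 a a) (@qform_weight_cvg n n 1 c a b))
    (cvgD (@qform_weight_cvg n n c 1 b a) (@qform_weight_cvg n n c c b b)).
  rewrite eqxx (_ : true%:R = 1 :> R)// !mul1r (zcoef_sym a b) => h.
  rewrite (_ : _ * kappa n = zcoef (K a a) n * kappa n +
    c * (zcoef (K a b) n * kappa n) +
    (c * 1 * (zcoef (K a b) n * kappa n) +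
     c * c * (zcoef (K b b) n * kappa n))); last first.
    by rewrite -(expr2 c) c1; ring.
  apply: cvgr_to_ge (h _ _ _) _; apply: nearW => N.
  by have := Kpsd (sS N); rewrite /s !(qformDl, qformDr) -!addrA; rewrite !addrA.
have := H 1; have := H (-1); rewrite sqrrN expr1n => /(_ erefl) H1 /(_ erefl) H2.
rewrite mulrC -ler_pdivlMr// ler_norml.
by move: H1 H2; lra.
Qed.

(* Bessel's inequality for the field at the pole minus its projection on the
   harmonics of degree less than N0. *)
Lemma zcoef_bessel a N0 :
  \sum_(n < N0) zcoef (K a a) n / kappa n <= K a a 1.
Proof.
pose s0 : seq (R * (V * J)) := [:: (1, (pole, a))].
pose t N := flatten [seq fweight (fun x => - (kappa n)^-1 * harm n x) a (unif N)
                    | n <- index_iota 0 N0].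
have tS N : on_sphere (t N).
  rewrite /t; elim: (index_iota 0 N0) => [|n r IH]; first by constructor.
  by apply/List.Forall_app; split => //; exact: on_sphere_weight.
have fint_t N (F : V * J -> R) : fint (t N) F = \sum_(0 <= n < N0)
    fint (fweight (fun x => - (kappa n)^-1 * harm n x) a (unif N)) F.
  rewrite /t; elim: (index_iota 0 N0) => [|n r IH].
    by rewrite /fint !big_nil.
  by rewrite /= fint_cat big_cons IH.
have st : qform s0 (t N) @[N --> \oo] -->
    \sum_(0 <= n < N0) - (kappa n)^-1 * zcoef (K a a) n.
  rewrite (_ : (fun N => _) = fun N => \sum_(0 <= n < N0) - (kappa n)^-1 *
      fint (unif N) (fun x => K a a (dot pole x) * harm n x)).
    apply: cvg_bigsum => n; apply: cvgMr; apply: smean_cvg.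
    exact: zcoef_sapprox.
  apply/funext => N; rewrite /qform fint_dirac fint_t.
  apply: eq_bigr => n _; rewrite fint_weight -fintZ; apply: eq_fint => x /=.
  by ring.
have tt : qform (t N) (t N) @[N --> \oo] -->
    \sum_(0 <= n < N0) zcoef (K a a) n / kappa n.
  rewrite (_ : (fun N => _) = fun N => \sum_(0 <= n < N0) \sum_(0 <= k < N0)
      qform (fweight (fun x => - (kappa n)^-1 * harm n x) a (unif N))
            (fweight (fun x => - (kappa k)^-1 * harm k x) a (unif N))).
    rewrite (_ : \sum_(_ <= _ < _) _ = \sum_(0 <= n < N0) \sum_(0 <= k < N0)
        (- (kappa n)^-1) * (- (kappa k)^-1) *
        ((n == k)%:R * (zcoef (K a a) n * kappa n))).
      by apply: cvg_bigsum => n; apply: cvg_bigsum => k; exact: qform_weight_cvg.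
    rewrite !big_mkord; apply: eq_bigr => n _; rewrite big_mkord.
    rewrite (bigD1 n)//= eqxx big1 ?addr0 => [|k kn].
      by rewrite (_ : true%:R = 1 :> R)//; field; rewrite gt_eqF// kappa_gt0.
    have /negPf -> : n != k :> nat by rewrite eq_sym.
    by rewrite mul0r mulr0.
  apply/funext => N; rewrite {1}/qform fint_t; apply: eq_bigr => n _.
  rewrite /qform -fint_sum; apply: eq_fint => p.
  by rewrite fint_t.
have := cvgD (cvgD (cvg_cst (qform s0 s0)) st) (cvgD st tt).
have -> : qform s0 s0 = K a a 1.
  by rewrite /qform !fint_dirac /= dot_pole.
move=> h; rewrite -subr_ge0.
rewrite (_ : _ - _ = K a a 1 + \sum_(0 <= n < N0) - (kappa n)^-1 * zcoef (K a a) n +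
  (\sum_(0 <= n < N0) - (kappa n)^-1 * zcoef (K a a) n +
   \sum_(0 <= n < N0) zcoef (K a a) n / kappa n)); last first.
  have -> : \sum_(0 <= n < N0) - (kappa n)^-1 * zcoef (K a a) n =
      - \sum_(0 <= n < N0) zcoef (K a a) n / kappa n.
    by rewrite -sumrN; apply: eq_bigr => n _; ring.
  by rewrite !big_mkord; ring.
apply: cvgr_to_ge (h _ _ _ _) _; apply: nearW => N.
have s0S : on_sphere (s0 ++ t N).
  by constructor; [exact: sphere_pole|exact: tS].
have := Kpsd s0S; rewrite !(qformDl, qformDr) (qform_sym (t N) s0).
by rewrite {1}/qform !fint_dirac /= dot_pole.
Qed.

Let coef a b n := zcoef (K a b) n / kappa n.

Lemma coef_summable a b : cvgn (series (fun n => `|coef a b n|)).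
Proof.
apply: nondecreasing_is_cvgn.
  by apply: nondecreasing_series => n _ _; exact: normr_ge0.
exists ((K a a 1 + K b b 1) / 2) => _ [N _ <-].
rewrite /series/= big_mkord ler_pdivlMr//.
rewrite (le_trans _ (lerD (zcoef_bessel a N) (zcoef_bessel b N)))//.
rewrite -big_split mulr_suml/=; apply: ler_sum => n _.
rewrite -mulrDl /coef normrM normfV (gtr0_norm (kappa_gt0 hd n)) mulrAC.
rewrite ler_wpM2r ?invr_ge0 ?(ltW (kappa_gt0 hd n))// mulrC.
exact: zcoef_cross.
Qed.

(** Summability and |Q_n| <= 1 make the series converge uniformly to some f, which has the same
    coefficients as K a b; completeness identifies the two. *)
Lemma zonal_series a b (u : R) : -1 <= u <= 1 ->
  series (fun n => coef a b n * (Q n).[u]) @ \oo --> K a b u.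
Proof.
move=> u1.
pose part N v : R := series (fun n => coef a b n * (Q n).[v]) N.
pose T : R := limn (series (fun n => `|coef a b n|)).
have Tcvg : series (fun n => `|coef a b n|) @ \oo --> T by exact: coef_summable.
have scvg (v : R) : -1 <= v <= 1 -> cvgn (series (fun n => coef a b n * (Q n).[v])).
  move=> v1; apply: (@normed_cvg R R^o).
  have := @series_le_cvg R (fun n => `|coef a b n * (Q n).[v]|) (fun n => `|coef a b n|).
  apply => [n|n|n|]; [exact: normr_ge0|exact: normr_ge0| |exact: coef_summable].
  by rewrite normrM ler_piMr// ngeg_le1.
pose f (v : R) : R := limn (series (fun n => coef a b n * (Q n).[v])).
have tail N (v : R) : -1 <= v <= 1 -> `|f v - part N v| <= T - series (fun n => `|coef a b n|) N.
  move=> v1.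
  have H : `|part M v - part N v| @[M --> \oo] --> `|f v - part N v|.
    by apply: cvg_norm; apply: cvgB; [exact: scvg|exact: cvg_cst].
  apply: ler_cvg_to H (cvgB Tcvg (cvg_cst _)) _.
  exists N => // M /= NM; rewrite /part sub_series_geq//.
  rewrite -[leRHS]/(series (fun n => `|coef a b n|) M - series (fun n => `|coef a b n|) N).
  rewrite sub_series_geq//.
  rewrite (le_trans (ler_norm_sum _ _ _))//; apply: ler_sum => n _.
  by rewrite normrM ler_piMr// ngeg_le1.
pose P N : {poly R} := \sum_(0 <= n < N) coef a b n *: Q n.
have PE N v : part N v = (P N).[v].
  rewrite /part /P horner_sum /series/=; apply: eq_bigr => n _.
  by rewrite hornerZ.
have unifP (e : R) : 0 < e -> exists N0, forall N, (N0 <= N)%N ->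
    forall v : R, -1 <= v <= 1 -> `|f v - (P N).[v]| <= e.
  move=> e0; have /cvgn_epsP/(_ _ e0)[N0 hN] := Tcvg.
  exists N0 => N N0N v v1; rewrite -PE (le_trans (tail N v v1))//.
  by have := hN N N0N; rewrite ler_norml => /andP[+ _]; lra.
have fa : poly_approx f.
  by move=> e e0; have [N hN] := unifP e e0; exists (P N); exact: hN.
have fc k : zcoef f k = zcoef (K a b) k.
  apply/eqP; rewrite -subr_eq0 -normr_le0; apply/ler_addgt0Pr => e e0; rewrite add0r.
  (* The partial sum has to contain the term of index k in order to have the right k-th
     coefficient. *)
  have [N0 hN] := unifP e e0; pose N := maxn N0 k.+1.
  have -> : zcoef (K a b) k = zcoef (horner (P N)) k.
    rewrite zcoef_poly /P mulr_suml zint_sum big_mkord.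
    have kN : (k < N)%N by rewrite /N leq_max leqnn orbT.
    rewrite (bigD1 (Ordinal kN))//= -scalerAl zintZ -/(kappa k) /coef.
    rewrite divfK ?gt_eqF ?kappa_gt0// big1 ?addr0// => n nk.
    by rewrite -scalerAl zintZ zint_ngeg_orth ?mulr0.
  apply: zcoef_dist => //; first exact: poly_approx_poly.
  by apply: hN; rewrite leq_maxl.
have diff : f u - K a b u = 0.
  apply: (@zcoef_inj R d hd (fun v => f v - K a b v)) => //.
    by apply: poly_approxD => //; exact: poly_approxN.
  move=> n; rewrite zcoefD ?zcoefN ?fc ?subrr//; exact: poly_approxN.
move/eqP: diff; rewrite subr_eq0 => /eqP <-.
exact: scvg.
Qed.

End positive_definite_kernels.

(** * Generating function *)

Section power_series.
Context {R : realType}.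
Implicit Types (f c : nat -> R) (r x z u : R).

(** Radius of convergence at least 1, in a form stable under termwise differentiation. *)
Definition subgeometric f :=
  forall r, 0 <= r < 1 -> exists M : R, forall n, `|f n| * r ^+ n <= M.

Lemma subgeometric_cvg f z : subgeometric f -> `|z| < 1 -> cvgn (pseries f z).
Proof.
move=> tf z1; pose r : R := (`|z| + 1) / 2.
have r0 : 0 < r by rewrite /r divr_gt0// ltr_wpDl.
have zr : `|z| < r by rewrite /r ltr_pdivlMr//; lra.
have r1 : r < 1 by rewrite /r ltr_pdivrMr//; lra.
have [|M hM] := tf r; first by rewrite ltW.
apply: (@normed_cvg R R^o).
have := @series_le_cvg R (fun n => `|f n * z ^+ n|) (geometric M (`|z| / r)).
apply => [n|n|n|].
- exact: normr_ge0.
- rewrite /= mulr_ge0 ?exprn_ge0 ?divr_ge0 ?(ltW r0)//.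
  by apply: le_trans (hM 0%N); rewrite mulr_ge0// exprn_ge0// ltW.
- rewrite /= normrM normrX expr_div_n [leRHS]mulrCA [leLHS]mulrC.
  by rewrite ler_wpM2l ?exprn_ge0// ler_pdivlMr ?exprn_gt0.
- apply: is_cvg_geometric_series.
  by rewrite ger0_norm ?divr_ge0 ?(ltW r0)// ltr_pdivrMr// mul1r.
Qed.

Lemma cvg_subgeometric f : (forall z, `|z| < 1 -> cvgn (pseries f z)) -> subgeometric f.
Proof.
move=> fc r /andP[r0 r1].
have rn : `|r| < 1 by rewrite ger0_norm.
have /cvg_series_cvg_0/(cvgP (0 : R))/(@cvg_seq_bounded R R^o) := fc r rn.
move=> [M [_ hM]]; exists (M + 1) => n.
have := hM (M + 1); rewrite ltrDl => /(_ ltr01 n I) /=.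
by rewrite normrM (ger0_norm (exprn_ge0 _ r0)).
Qed.

(** Each q^i with i < n is at least q^n, so n q^n is at most a partial geometric sum. *)
Lemma natr_mul_expr_le n (q : R) : 0 <= q < 1 -> n%:R * q ^+ n <= (1 - q)^-1.
Proof.
move=> /andP[q0 q1]; have q1' : 0 < 1 - q by rewrite subr_gt0.
apply: (@le_trans _ _ (\sum_(i < n) q ^+ i)).
  rewrite mulr_natl -[X in _ *+ X]card_ord -sumr_const; apply: ler_sum => i _.
  by rewrite ler_wiXn2l ?(ltW q1)// ltnW.
have := subrX1 q n; rewrite -opprB -[in RHS]opprB mulNr => /oppr_inj h.
rewrite -[leRHS]mul1r ler_pdivlMr// mulrC -h lerBlDr lerDl.
by rewrite exprn_ge0.
Qed.

(** The factor n + 1 is absorbed by passing from r to a radius s strictly between r and 1. *)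
Lemma subgeometric_diffs f : subgeometric f -> subgeometric (pseries_diffs f).
Proof.
move=> tf r /andP[r0 r1]; pose s : R := (r + 1) / 2.
have s0 : 0 < s by rewrite /s divr_gt0// ltr_wpDl.
have rs : r < s by rewrite /s ltr_pdivlMr//; lra.
have s1 : s < 1 by rewrite /s ltr_pdivrMr//; lra.
have [|M hM] := tf s; first by rewrite ltW.
have M0 : 0 <= M.
  by apply: le_trans (hM 0%N); rewrite mulr_ge0// exprn_ge0// ltW.
pose q := r / s.
have q01 : 0 <= q < 1 by rewrite /q divr_ge0 ?(ltW s0)//= ltr_pdivrMr// mul1r.
exists (M / s * ((1 - q)^-1 + 1)) => n.
have rE : r ^+ n = q ^+ n * s ^+ n by rewrite -exprMn /q divfK// gt_eqF.
rewrite /pseries_diffs normrM ger0_norm// rE.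
have -> : n.+1%:R * `|f n.+1| * (q ^+ n * s ^+ n) =
   (`|f n.+1| * s ^+ n) * (n.+1%:R * q ^+ n) by ring.
apply: ler_pM.
- by rewrite mulr_ge0// exprn_ge0// ltW.
- by rewrite mulr_ge0// exprn_ge0//; case/andP: q01.
- by rewrite ler_pdivlMr// -mulrA -exprSr.
- rewrite -natr1 mulrDl mul1r lerD ?natr_mul_expr_le// exprn_ile1//; case/andP: q01 => // _ /ltW//.
Qed.

Lemma pseries_is_derive f u : subgeometric f -> `|u| < 1 ->
  is_derive u (1 : R) (fun v => limn (pseries f v)) (limn (pseries (pseries_diffs f) u)).
Proof.
move=> tf u1; pose K : R := (`|u| + 1) / 2.
have K0 : 0 < K by rewrite /K divr_gt0// ltr_wpDl.
have uK : `|u| < `|K| by rewrite (gtr0_norm K0) /K ltr_pdivlMr//; lra.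
have K1 : `|K| < 1 by rewrite (gtr0_norm K0) /K ltr_pdivrMr//; lra.
by apply: (@pseries_snd_diffs _ _ K) => //; apply: subgeometric_cvg => //;
  do ?apply: subgeometric_diffs.
Qed.

Lemma pseries_at0 f : limn (pseries f 0) = f 0%N.
Proof.
apply/cvg_lim => //; apply/cvgn_epsP => e e0; exists 1%N => -[//|n] _.
rewrite /pseries /series/= big_nat_recl//= expr0 mulr1 big1 ?addr0 ?subrr ?normr0 ?ltW// => i _.
by rewrite expr0n mulr0.
Qed.

(** Evaluation at 0 gives the first coefficient; the differentiated series vanishes as well and
    gives the others. *)
Lemma pseries_eq0 f : (forall u, `|u| < 1 -> pseries f u @ \oo --> (0 : R)) ->
  forall n, f n = 0.
Proof.
move=> f0 n; have tf : subgeometric f.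
  by apply: cvg_subgeometric => z /f0 h; apply/cvg_ex; exists 0.
elim: n f tf f0 => [|n IH] f tf f0.
  by rewrite -pseries_at0; apply/cvg_lim => //; apply: f0; rewrite normr0.
have : pseries_diffs f n = 0.
  apply: (IH _ (subgeometric_diffs tf)) => u u1.
  have := subgeometric_cvg (subgeometric_diffs tf) u1.
  suff <- : limn (pseries (pseries_diffs f) u) = 0 by [].
  have [_ <-] := pseries_is_derive tf u1.
  rewrite (@near_eq_derive _ _ _ _ (cst 0)) ?derive_cst//.
  have : \forall v \near u, `|v| < 1.
    apply/nbhs_ballP; exists (1 - `|u|); first by rewrite /= subr_gt0.
    move=> v; rewrite /ball/= distrC ltrBrDr => /(le_lt_trans (ler_normD _ _)).
    by rewrite subrK.
  by apply: filterS => v v1; apply/cvg_lim => //; exact: f0.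
by move/eqP; rewrite mulf_eq0 pnatr_eq0/= => /eqP.
Qed.

End power_series.

Section generating_function.
Context {R : realType} {d : nat}.
Hypothesis hd : (1 < d)%N.
Notation Q := (ngeg R d).
Implicit Types (x u : R).

(* The value at 1 of the ultraspherical polynomial of index (d - 1) / 2. *)
Definition geg1 n : R := 'C(n + d.-2, n)%:R.

Definition geg n : {poly R} := geg1 n *: Q n.

Lemma geg1_gt0 n : 0 < geg1 n.
Proof. by rewrite ltr0n bin_gt0 leq_addr. Qed.

Lemma geg1S n : n.+1%:R * geg1 n.+1 = (n + d.-1)%:R * geg1 n.
Proof.
rewrite /geg1 -!natrM; congr _%:R.
have -> : d.-1 = d.-2.+1 by case: d hd => [|[]].
by rewrite addnS -mul_bin_diag.
Qed.

Lemma gegSS n x : n.+2%:R * (geg n.+2).[x] =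
  (2 * n.+1 + d.-1)%:R * x * (geg n.+1).[x] - (n + d.-1)%:R * (geg n).[x].
Proof.
have /(congr1 (horner^~ x)) := ngegSS R d n.
rewrite !(hornerD, hornerN, hornerZ, hornerM, hornerX) => h.
rewrite !mulrA geg1S -(geg1S n).
transitivity (geg1 n.+1 * ((n.+1 + d.-1)%:R * (Q n.+2).[x])); first by ring.
by rewrite h; ring.
Qed.

Lemma geg_le1 n x : `|x| <= 1 -> `|(geg n).[x]| <= geg1 n.
Proof.
move=> x1; rewrite hornerZ normrM ger0_norm ?(ltW (geg1_gt0 n))//.
by rewrite ler_piMr ?(ltW (geg1_gt0 n))// (ngeg_le1 (ltnW hd))// -ler_norml.
Qed.

Lemma subgeometric_bin k : subgeometric (fun n => 'C(n + k, n)%:R : R).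
Proof.
elim: k => [|k IH].
  move=> r /andP[r0 r1]; exists 1 => n.
  by rewrite addn0 binn normr1 mul1r exprn_ile1// ltW.
move=> r r01; have [M hM] := subgeometric_diffs IH r01.
exists M => n; apply: le_trans (hM n); case/andP: r01 => r0 _.
rewrite ler_wpM2r ?exprn_ge0// /pseries_diffs -natrM !normr_nat ler_nat.
have -> : (n.+1 * 'C(n.+1 + k, n.+1) = k.+1 * 'C(n + k.+1, n))%N.
  by rewrite addSnnS mul_bin_left addKn.
by rewrite leq_pmull.
Qed.

Lemma subgeometric_geg x : `|x| <= 1 -> subgeometric (fun n => (geg n).[x]).
Proof.
move=> x1 r r01; have [M hM] := @subgeometric_bin d.-2 _ r01; exists M => n.
apply: le_trans (hM n); case/andP: r01 => r0 _.
rewrite ler_wpM2r ?exprn_ge0// normr_nat; exact: geg_le1.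
Qed.

Section fixed_argument.
Variable x : R.
Hypothesis x1 : `|x| <= 1.
Let c n := (geg n).[x].
Let F u : R := limn (pseries c u).
Let w u : R := 1 - 2 * u * x + u ^+ 2.
Let tc : subgeometric c. Proof. exact: subgeometric_geg. Qed.

Let c1 : c 1%N = d.-1%:R * x * c 0%N.
Proof.
rewrite /c /geg ngeg0 ngeg1 !hornerZ hornerX hornerC mulr1.
have := geg1S 0; rewrite mul1r add0n => ->.
by ring.
Qed.

(* The partial sums of (1 - 2 u x + u^2) F'(u) - (d - 1) (x - u) F(u) telescope. *)
Let partial_ode u N :
  w u * series (fun n => pseries_diffs c n * u ^+ n) N
   - d.-1%:R * (x - u) * series (fun n => c n * u ^+ n) N =
  u ^+ N * (d.-1%:R * x * c N - N.+1%:R * c N.+1) + u ^+ N.+1 * (N%:R * c N).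
Proof.
elim: N => [|N IH].
  by rewrite /series/= !big_geq// c1; ring.
rewrite !seriesSr; move: IH; move: (series _ N) (series _ N) => B A IH.
transitivity ((w u * A - d.-1%:R * (x - u) * B) + w u * (pseries_diffs c N * u ^+ N)
  - d.-1%:R * (x - u) * (c N * u ^+ N)); first by ring.
rewrite IH.
have := gegSS N x; rewrite -/(c N) -/(c N.+1) -/(c N.+2) => ->.
by rewrite /pseries_diffs /w !exprS !natrD !natrM; ring.
Qed.

Let ode u : `|u| < 1 -> w u * limn (pseries (pseries_diffs c) u) =
  d.-1%:R * (x - u) * F u.
Proof.
move=> u1; have td := subgeometric_diffs tc.
have C0 : pseries c u @ \oo --> F u by exact: subgeometric_cvg.
have C1 : pseries (pseries_diffs c) u @ \oo --> limn (pseries (pseries_diffs c) u).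
  exact: subgeometric_cvg.
have Z0 : c n * u ^+ n @[n --> \oo] --> (0 : R).
  exact: cvg_series_cvg_0 (cvgP _ C0).
have Z1 : pseries_diffs c n * u ^+ n @[n --> \oo] --> (0 : R).
  exact: cvg_series_cvg_0 (cvgP _ C1).
have H : (fun N => w u * pseries (pseries_diffs c) u N
    - d.-1%:R * (x - u) * pseries c u N) @ \oo -->
    w u * limn (pseries (pseries_diffs c) u) - d.-1%:R * (x - u) * F u.
  by apply: cvgB; apply: cvgMr.
apply/eqP; rewrite -subr_eq0; apply/eqP.
apply: (@cvg_unique _ (@norm_hausdorff _ R^o) _ _ _ _ H).
rewrite (_ : (fun N => _) = fun N => d.-1%:R * x * (c N * u ^+ N) -
  pseries_diffs c N * u ^+ N + u * (N%:R * c N * u ^+ N)); last first.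
  apply/funext => N; rewrite [LHS]partial_ode /pseries_diffs exprS; ring.
have Z2 : N%:R * c N * u ^+ N @[N --> \oo] --> (0 : R).
  rewrite -cvg_shiftS/=.
  have Z3 : u * (pseries_diffs c n * u ^+ n) @[n --> \oo] --> u * 0 by exact: cvgMr.
  rewrite mulr0 in Z3.
  rewrite (_ : (fun n => _) = fun n => u * (pseries_diffs c n * u ^+ n))//.
  by apply/funext => n; rewrite /pseries_diffs exprS; ring.
have : d.-1%:R * x * (c N * u ^+ N) - pseries_diffs c N * u ^+ N +
    u * (N%:R * c N * u ^+ N) @[N --> \oo] --> d.-1%:R * x * 0 - 0 + u * 0.
  by apply: cvgD; [apply: cvgB => //; exact: cvgMr|exact: cvgMr].
by rewrite !mulr0 subrr addr0.
Qed.

Let w_gt0 u : `|u| < 1 -> 0 < w u.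
Proof.
move=> u1; have x2 : x ^+ 2 <= 1.
  by rewrite -real_normK ?num_real// expr_le1.
have ux : `|u * x| < 1 by rewrite normrM (le_lt_trans _ u1)// ler_piMr.
have [->|u0] := eqVneq u 0; first by rewrite /w; lra.
have [xe|xn] := eqVneq (x ^+ 2) 1.
  have -> : w u = (1 - u * x) ^+ 2 by rewrite sqrrB exprMn xe /w; ring.
  by rewrite exprn_gt0// subr_gt0 (le_lt_trans (ler_norm _)).
have -> : w u = (1 - u * x) ^+ 2 + u ^+ 2 * (1 - x ^+ 2) by rewrite /w; ring.
by rewrite ltr_wpDl ?sqr_ge0// mulr_gt0 ?exprn_even_gt0// subr_gt0 lt_neqAle xn.
Qed.

(** The product F w^l has derivative 0 because w F' = 2 l (x - u) F and w' = 2 (u - x), and it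
    equals 1 at u = 0. *)
Lemma geg_generating u : `|u| < 1 ->
  pseries c u @ \oo --> w u `^ (- (d.-1%:R / 2)).
Proof.
set l := d.-1%:R / 2 => u1.
pose wp : {poly R} := 1 - (2 * x) *: 'X + 'X^2.
have wE : w = horner wp.
  by apply/funext => v; rewrite /w /wp !(hornerD, hornerN, hornerZ, hornerX, hornerXn, hornerC); ring.
have dw (v : R) : is_derive v (1 : R) w (2 * v - 2 * x).
  rewrite wE; apply: DeriveDef; first exact: derivable_horner.
  rewrite -derive1E -derivE /wp derivD derivB derivC derivZ derivX derivXn.
  by rewrite /= !(hornerD, hornerN, hornerZ, hornerXn, hornerX, hornerC, hornerMn); ring.
pose H : R -> R := F * ((fun t : R => t `^ l) \o w).
have dH (v : R) : `|v| < 1 -> is_derive v (1 : R) H 0.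
  move=> v1; have w0 := w_gt0 v1.
  have dF := pseries_is_derive tc v1.
  have dP : is_derive v (1 : R) ((fun t : R => t `^ l) \o w) (l * w v `^ (l - 1) * (2 * v - 2 * x)).
    by apply: is_derive1_comp; exact: is_derive1_powR.
  have := is_deriveM dF dP; rewrite -/F => dFP.
  apply: (is_derive_eq dFP).
  rewrite /GRing.scale/= powRB ?(gt_eqF w0) ?implybT// powRr1 ?(ltW w0)//.
  have := ode v1; rewrite -/(F v).
  move: (F v) (w v `^ l) (limn _) => f p f' e.
  apply: (mulfI (lt0r_neq0 w0)); rewrite mulr0.
  transitivity (p * (f * l * (2 * v - 2 * x) * (w v / w v) + w v * f')); first by ring.
  by rewrite e divff ?gt_eqF// /l; field.
have Hcst : H u = H 0.
  have cont a b : -1 < a -> b < 1 -> {within `[a, b], continuous H}.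
    move=> a1 b1; apply: derivable_within_continuous => v; rewrite in_itv/= => /andP[av vb].
    by apply: ex_derive; apply: dH; rewrite ltr_norml; apply/andP; split; lra.
  have [u0|u0|->//] := ltgtP u 0.
  - have [|z|_ _] := @MVT R H (fun=> 0) u 0 u0.
    + by move=> z; rewrite in_itv/= => /andP[uz z0]; apply: dH; move: u1; rewrite !ltr_norml; lra.
    + by apply: cont; move: u1; rewrite ltr_norml; lra.
    + by rewrite mul0r => /eqP; rewrite subr_eq0 => /eqP.
  - have [|z|_ _] := @MVT R H (fun=> 0) 0 u u0.
    + by move=> z; rewrite in_itv/= => /andP[uz z0]; apply: dH; move: u1; rewrite !ltr_norml; lra.
    + by apply: cont; move: u1; rewrite ltr_norml; lra.
    + by rewrite mul0r => /eqP; rewrite subr_eq0 => /eqP.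
have F0 : H 0 = 1.
  rewrite /H /= -[LHS]/(F 0 * w 0 `^ l) /F pseries_at0 /c /geg ngeg0 hornerZ hornerC.
  by rewrite /geg1 bin0 /w mulr0 mul0r subr0 expr0n/= addr0 powR1 !mulr1.
suff <- : F u = w u `^ (- l) by exact: subgeometric_cvg.
have wl : w u `^ l != 0 by rewrite gt_eqF// powR_gt0// w_gt0.
apply: (mulIf wl); rewrite -powRD ?addNr ?powRr0; last by rewrite (gt_eqF (w_gt0 u1)) implybT.
by rewrite -F0 -Hcst.
Qed.

End fixed_argument.

Lemma geg_is_gegenbauer : is_gegenbauer (d.-1%:R / 2) geg.
Proof.
move=> x u x1 u1; have := geg_generating x1 u1.
rewrite /pseries; under eq_fun do rewrite mulrC.
by [].
Qed.

(** The sequence picked by [xget] is known through its generating function alone; comparing power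
    series in u at a fixed x identifies its values on [-1, 1]. *)
Lemma gegenbauerE n x : `|x| <= 1 -> (gegenbauer (d.-1%:R / 2) n).[x] = (geg n).[x].
Proof.
move=> x1; rewrite /gegenbauer; case: xgetP => [p _ pg|/(_ geg)]; last first.
  by move=> /(_ geg_is_gegenbauer).
apply/eqP; rewrite -subr_eq0; apply/eqP.
apply: (@pseries_eq0 R (fun n => (p n).[x] - (geg n).[x])) => u u1.
have := cvgB (pg x u x1 u1) (geg_is_gegenbauer x1 u1).
rewrite subrr => /(_ _ _) h.
rewrite (_ : pseries _ u = series (fun n => u ^+ n * (p n).[x]) -
  series (fun n => u ^+ n * (geg n).[x])) //.
apply/funext => N; rewrite /pseries /series/= -[RHS]sumrB.
by apply: eq_bigr => i _; ring.
Qed.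

End generating_function.

(** * Square-integrable random variables *)

Section square_integrable.
Context {R : realType} {dO : measure_display} {Omega : measurableType dO}.
Context (P : probability Omega R).
Implicit Types f g h : Omega -> R.

Definition L2 f := f \in Lfun P 2%:E.

Definition ip f g : R := fine (\int[P]_w (f w * g w)%:E)%E.

Lemma L2P f : L2 f <->
  measurable_fun setT f /\ (\int[P]_w (f w ^+ 2)%:E < +oo)%E.
Proof.
split=> [f2|[mf fi]].
  have /integrableP[_] := Lfun2_integrable_sqr f2.
  have : f \in mfun by move: f2; rewrite /L2 inE => /andP[].
  rewrite inE/= => mf fi; split => //; apply: le_lt_trans fi.
  rewrite le_eqVlt; apply/orP; left; apply/eqP/eq_integral => w _.
  by rewrite ger0_norm ?sqr_ge0.
rewrite /L2 inE; apply/andP; split; first by rewrite inE.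
rewrite inE/= /finite_norm unlock /Lnorm poweR_lty//.
by under eq_integral => w _ do rewrite abse_EFin poweR_EFin powR_mulrn// real_normK ?num_real//.
Qed.

Lemma L2_measurable f : L2 f -> measurable_fun setT f.
Proof. by case/L2P. Qed.

Lemma L2_cst (c : R) : L2 (fun=> c).
Proof. exact: Lfun_cst. Qed.

Lemma L2D f g : L2 f -> L2 g -> L2 (fun w => f w + g w).
Proof. by move=> f2 g2; rewrite /L2 (_ : (fun w => _) = f + g) ?rpredD ?lee1n. Qed.

Lemma L2Z (c : R) f : L2 f -> L2 (fun w => c * f w).
Proof.
move=> f2; rewrite /L2 (_ : (fun w => _) = c \o* f); last first.
  by apply/funext => w /=; rewrite mulrC.
by apply: Lfun_scale => //; rewrite ler1n.
Qed.

Lemma L2B f g : L2 f -> L2 g -> L2 (fun w => f w - g w).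
Proof.
move=> f2 /(L2Z (-1)) g2; have := L2D f2 g2; congr L2.
by apply/funext => w; rewrite mulN1r.
Qed.

Lemma L2_fint {T : Type} (s : seq (R * T)) (F : T -> Omega -> R) :
  (forall x, L2 (F x)) -> L2 (fun w => fint s (F^~ w)).
Proof.
move=> F2; rewrite /fint; elim: s => [|p s IH].
  by under eq_fun do rewrite big_nil; exact: L2_cst.
by under eq_fun do rewrite big_cons; apply: L2D => //; exact: L2Z.
Qed.

Lemma L2M_integrable f g : L2 f -> L2 g ->
  P.-integrable setT (fun w => (f w * g w)%:E).
Proof. by move=> f2 g2; exact/Lfun1_integrable/Lfun2_mul_Lfun1. Qed.

Lemma L2M_fin_num f g : L2 f -> L2 g ->
  (\int[P]_w (f w * g w)%:E)%E \is a fin_num.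
Proof. by move=> f2 g2; exact/integrable_fin_num/L2M_integrable. Qed.

Lemma ipC f g : ip f g = ip g f.
Proof. by rewrite /ip; under eq_integral do rewrite mulrC. Qed.

Lemma ipDl f g h : L2 f -> L2 g -> L2 h ->
  ip (fun w => f w + g w) h = ip f h + ip g h.
Proof.
move=> f2 g2 h2; rewrite /ip -fineD ?L2M_fin_num//.
rewrite -integralD_EFin//; try exact: L2M_integrable.
by congr fine; apply: eq_integral => w _ /=; rewrite -EFinD mulrDl.
Qed.

Lemma ipZl (c : R) f h : L2 f -> L2 h -> ip (fun w => c * f w) h = c * ip f h.
Proof.
move=> f2 h2; rewrite /ip -[c in RHS]/(fine c%:E) -fineM ?L2M_fin_num//.
rewrite -integralZl//; last exact: L2M_integrable.
by congr fine; apply: eq_integral => w _ /=; rewrite -EFinM mulrA.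
Qed.

Lemma ipBl f g h : L2 f -> L2 g -> L2 h ->
  ip (fun w => f w - g w) h = ip f h - ip g h.
Proof.
move=> f2 g2 h2; have := ipDl f2 (L2Z (-1) g2) h2.
rewrite ipZl// mulN1r => <-; congr ip.
by apply/funext => w; rewrite mulN1r.
Qed.

Lemma ipBr f g h : L2 f -> L2 g -> L2 h ->
  ip h (fun w => f w - g w) = ip h f - ip h g.
Proof. by move=> *; rewrite ipC ipBl// !(ipC h). Qed.

Lemma ip_fintl {T : Type} (s : seq (R * T)) (F : T -> Omega -> R) h :
  (forall x, L2 (F x)) -> L2 h ->
  ip (fun w => fint s (F^~ w)) h = fint s (fun x => ip (F x) h).
Proof.
move=> F2 h2; rewrite /fint; elim: s => [|p s IH].
  rewrite big_nil /ip; under eq_integral do rewrite big_nil mul0r.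
  by rewrite integral0.
rewrite big_cons -IH -ipZl// -ipDl//.
- by congr ip; apply/funext => w; rewrite big_cons.
- exact: L2Z.
- exact: L2_fint.
Qed.

Lemma ip_ge0 f : 0 <= ip f f.
Proof. by apply: fine_ge0; apply: integral_ge0 => w _; rewrite lee_fin -expr2 sqr_ge0. Qed.

Lemma ip_sqrD (s : R) f g : L2 f -> L2 g ->
  ip (fun w => f w + s * g w) (fun w => f w + s * g w) =
  ip f f + 2 * s * ip f g + s ^+ 2 * ip g g.
Proof.
move=> f2 g2; have sg2 := L2Z s g2; have fg2 := L2D f2 sg2.
by rewrite ipDl// ipZl// ![ip _ (fun w => f w + _)]ipC !ipDl// !ipZl// (ipC g f); ring.
Qed.

Lemma ip_cauchy_schwarz f g : L2 f -> L2 g -> ip f g ^+ 2 <= ip f f * ip g g.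
Proof.
move=> f2 g2.
have q (s : R) : 0 <= ip f f + 2 * s * ip f g + s ^+ 2 * ip g g.
  by rewrite -ip_sqrD// ip_ge0.
have [g0|g0] := eqVneq (ip g g) 0.
  have [->|fg0] := eqVneq (ip f g) 0; first by rewrite g0 mulr0 expr0n.
  have := q (- (ip f f + 1) / (2 * ip f g)).
  rewrite g0 mulr0 addr0 (_ : 2 * _ * _ = - (ip f f + 1)); last by field.
  by move=> h; exfalso; lra.
have gp : 0 < ip g g by rewrite lt_neqAle eq_sym g0 ip_ge0.
have := q (- ip f g / ip g g).
rewrite (_ : _ + _ = (ip f f * ip g g - ip f g ^+ 2) / ip g g); last by field.
by rewrite pmulr_lge0 ?invr_gt0// subr_ge0.
Qed.

Lemma ip_sqrB f g : L2 f -> L2 g ->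
  ip (fun w => f w - g w) (fun w => f w - g w) = ip f f - 2 * ip f g + ip g g.
Proof.
move=> f2 g2; have := ip_sqrD (-1) f2 g2.
under [X in ip X]eq_fun do rewrite mulN1r.
under [X in ip _ X]eq_fun do rewrite mulN1r.
by move=> ->; ring.
Qed.

Lemma ip_small (f g : nat -> Omega -> R) (c : R) :
  (forall n, L2 (f n)) -> (forall n, L2 (g n)) ->
  ip (f n) (f n) @[n --> \oo] --> (0 : R) -> ip (g n) (g n) @[n --> \oo] --> c ->
  ip (f n) (g n) @[n --> \oo] --> (0 : R).
Proof.
move=> f2 g2 f0 gc.
have h : ip (f n) (f n) * ip (g n) (g n) @[n --> \oo] --> (0 : R).
  by rewrite -[0](mul0r c); apply: cvgM.
have {}h : ip (f n) (g n) ^+ 2 @[n --> \oo] --> (0 : R).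
  apply: (squeeze_cvgr _ (cvg_cst (0 : R)) h); apply: nearW => n.
  by rewrite sqr_ge0 ip_cauchy_schwarz.
apply/cvgn_epsP => e; move: (e : R) => {}e e0.
have [N hN] := (cvgn_epsP _ _).1 h _ (exprn_gt0 2 e0).
exists N => n /hN; rewrite !subr0 ger0_norm ?sqr_ge0// -[ip _ _ ^+ 2]real_normK ?num_real//.
have e0' : (0 : R) <= e by exact: ltW.
by rewrite ler_sqr ?nnegrE ?normr_ge0.
Qed.

Lemma ip_cvg (f g : nat -> Omega -> R) (f' g' : Omega -> R) :
  (forall n, L2 (f n)) -> (forall n, L2 (g n)) -> L2 f' -> L2 g' ->
  ip (fun w => f n w - f' w) (fun w => f n w - f' w) @[n --> \oo] --> (0 : R) ->
  ip (fun w => g n w - g' w) (fun w => g n w - g' w) @[n --> \oo] --> (0 : R) ->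
  ip (f n) (g n) @[n --> \oo] --> ip f' g'.
Proof.
move=> f2 g2 f'2 g'2 ff gg.
have df n := L2B (f2 n) f'2; have dg n := L2B (g2 n) g'2.
have h1 := ip_small df dg ff gg.
have h2 := ip_small df (fun=> g'2) ff (cvg_cst _).
have h3 := ip_small dg (fun=> f'2) gg (cvg_cst _).
rewrite (_ : (fun n => _) = fun n =>
    ip (fun w => f n w - f' w) (fun w => g n w - g' w) +
    ip (fun w => f n w - f' w) g' + ip (fun w => g n w - g' w) f' + ip f' g').
  rewrite -[ip f' g' in X in _ --> X]add0r -[X in X + ip f' g'](addr0 0) -[X in X + 0 + _](addr0 0).
  apply: cvgD; last exact: cvg_cst.
  by apply: (cvgD (cvgD h1 (h2 _)) (h3 _)).
by apply/funext => n; rewrite !(ipBl, ipBr)// (ipC g' f') (ipC (g n) f'); ring.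
Qed.

End square_integrable.

(** * Completeness of L2 *)

Section L2_complete.
Context {R : realType} {dO : measure_display} {Omega : measurableType dO}.
Context (P : probability Omega R).

Local Notation sqn f := (ip P f f).

Lemma sqn_integral f : L2 P f -> (\int[P]_w (f w ^+ 2)%:E)%E = (sqn f)%:E.
Proof.
by move=> f2; rewrite /ip fineK ?L2M_fin_num//.
Qed.

(** Follows from (1 - c |x|)^2 / c >= 0; with c = 2^k it trades weighted squares for absolute
    summability. *)
Lemma weighted_norm_le (c x : R) : 0 < c -> `|x| <= c^-1 + c * x ^+ 2.
Proof.
move=> c0; rewrite -(real_normK (num_real x)); set y := `|x|.
have y0 : 0 <= y by exact: normr_ge0.
have : 0 <= c^-1 * (1 - c * y) ^+ 2 by rewrite mulr_ge0 ?invr_ge0 ?sqr_ge0// ltW.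
rewrite (_ : c^-1 * _ = c^-1 - 2 * y + c * y ^+ 2); last by field; rewrite gt_eqF.
lra.
Qed.

(* An L2 sequence with geometrically small increments converges almost surely:
   [sum 2^k D_k^2] is integrable, and [|D_k| <= 2^-k + 2^k D_k^2]. *)
Lemma fast_L2_ae_cvg (Y : nat -> Omega -> R) : (forall k, L2 P (Y k)) ->
  (forall k, sqn (fun w => Y k.+1 w - Y k w) <= (2 ^+ k)^-1 / (2 ^ k.+1)%:R) ->
  exists A, [/\ measurable A, P (~` A) = 0 &
    forall w, A w -> cvgn (fun k => Y k w)].
Proof.
move=> Y2 hY; pose D k w := Y k.+1 w - Y k w.
have D2 k : L2 P (D k) by exact: L2B.
pose u k w := (2 ^+ k * D k w ^+ 2)%:E.
have u0 k w : (0 <= u k w)%E by rewrite lee_fin mulr_ge0 ?sqr_ge0 ?exprn_ge0.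
have mu k : measurable_fun setT (u k).
  apply/measurable_EFinP; apply: measurable_funM => //.
  by apply: measurable_funX; exact: L2_measurable.
pose G w := (\sum_(k <oo) u k w)%E.
have mG : measurable_fun setT G by exact: ge0_emeasurable_sum.
have G0 w : (0 <= G w)%E by exact: nneseries_ge0.
have iG : P.-integrable setT G.
  apply/integrableP; split => //.
  under eq_integral do rewrite gee0_abs//.
  rewrite /G integral_nneseries//.
  apply: (@le_lt_trans _ _ 1%:E); last by rewrite ltry.
  (* The weight 2^k cancels the first factor of the bound on increments and leaves 1 / 2^(k + 1),
     with total 1. *)
  apply: le_trans (epsilon_trick0 xpredT ler01).
  apply: lee_nneseries => [k _ _|k _]; first exact: integral_ge0.
  rewrite /u; under eq_integral do rewrite EFinM.
  rewrite ge0_integralZl//; first last.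
  - by move=> w _; rewrite lee_fin sqr_ge0.
  - by apply/measurable_EFinP; apply: measurable_funX; exact: L2_measurable.
  rewrite sqn_integral// -EFinM lee_fin mul1r -ler_pdivlMl ?exprn_gt0//.
  exact: hY.
have mA : measurable [set w | G w \is a fin_num].
  by have := emeasurable_fin_num measurableT mG; rewrite setTI.
exists [set w | G w \is a fin_num]; split => //.
  apply/negligibleP; first exact: measurableC.
  have := integrable_ae measurableT iG; apply: negligibleS.
  by move=> w /= h H; apply: h; exact: H.
move=> w /= Gw.
have bound n : \sum_(0 <= k < n) (2 ^+ k * D k w ^+ 2) <= fine (G w).
  rewrite -lee_fin fineK// -sumEFin; apply: nneseries_lim_ge => k _ _.
  exact: u0.
have s1 : cvgn (series (fun k => 2 ^+ k * D k w ^+ 2)).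
  apply: nondecreasing_is_cvgn.
    by apply: nondecreasing_series => k _ _; rewrite mulr_ge0 ?sqr_ge0 ?exprn_ge0.
  by exists (fine (G w)) => _ [n _ <-]; exact: bound.
have s2 : cvgn (series (fun k => (2 ^+ k)^-1 : R)).
  rewrite (_ : (fun k => _) = geometric 1 2^-1).
    by apply: is_cvg_geometric_series; rewrite ger0_norm ?invr_ge0// invf_lt1 ?ltr1n.
  by apply/funext => k; rewrite /geometric /= mul1r exprVn.
have s3 : cvgn (series (fun k => (2 ^+ k)^-1 + 2 ^+ k * D k w ^+ 2)).
  by have := is_cvgD s2 s1; rewrite seriesD; exact.
have s4 : cvgn (series (fun k => D k w)).
  apply: (@normed_cvg R R^o); move: s3; have := @series_le_cvg R
    (fun k => `|D k w|) (fun k => (2 ^+ k)^-1 + 2 ^+ k * D k w ^+ 2).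
  apply => k; rewrite ?normr_ge0//.
    by rewrite addr_ge0 ?invr_ge0 ?exprn_ge0// mulr_ge0 ?sqr_ge0 ?exprn_ge0.
  by apply: weighted_norm_le; rewrite exprn_gt0.
rewrite (_ : (fun k => Y k w) = fun k => Y 0 w + series (fun k => D k w) k).
  by apply: is_cvgD => //; exact: is_cvg_cst.
by apply/funext => n; rewrite seriesEnat/= telescope_sumr// addrC subrK.
Qed.

(** A rapidly Cauchy subsequence converges almost surely, and Fatou's lemma bounds the distance of
    the whole sequence to its limit. *)
Lemma L2_complete (X : nat -> Omega -> R) : (forall n, L2 P (X n)) ->
  (forall e : R, 0 < e -> exists N, forall n m, (N <= n)%N -> (N <= m)%N ->
    sqn (fun w => X n w - X m w) <= e) ->
  exists2 Y, L2 P Y & sqn (fun w => X n w - Y w) @[n --> \oo] --> (0 : R).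
Proof.
move=> X2 cX.
pose c k : R := (2 ^+ k)^-1 / (2 ^ k.+1)%:R.
have c0 k : 0 < c k by rewrite divr_gt0 ?invr_gt0 ?exprn_gt0 ?ltr0n ?expn_gt0.
pose phi k := sval (cid (cX _ (c0 k))).
have phiP k n m : (phi k <= n)%N -> (phi k <= m)%N ->
    sqn (fun w => X n w - X m w) <= c k.
  by rewrite /phi; case: cid => N /= h; exact: h.
(* A running maximum, so that [psi k] lies beyond every threshold of index at most k. *)
pose psi k := (\max_(i < k.+1) phi i)%N.
have phi_psi i k : (i <= k)%N -> (phi i <= psi k)%N.
  by move=> ik; exact: (leq_bigmax (Ordinal (ik : (i < k.+1)%N))).
pose Y k := X (psi k).
have [A [mA PA YA]] : exists A, [/\ measurable A, P (~` A) = 0 &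
    forall w, A w -> cvgn (fun k => Y k w)].
  apply: (fast_L2_ae_cvg (fun k => X2 (psi k))) => k.
  by apply: phiP; apply: phi_psi.
(* Cut off outside the set of convergence, so that the limit exists everywhere and is measurable. *)
pose T k w := Y k w * \1_A w.
have mT k : measurable_fun setT (T k).
  by apply: measurable_funM; [exact: L2_measurable (X2 _)|exact: measurable_indic].
have cT w : cvgn (fun k => T k w).
  rewrite /T; have [Aw|nAw] := pselect (A w).
    rewrite (_ : (fun k => _) = fun k => Y k w); first exact: YA.
    by apply/funext => k; rewrite indicE mem_set// mulr1.
  rewrite (_ : (fun k => _) = fun=> 0); first exact: is_cvg_cst.
  by apply/funext => k; rewrite indicE memNset// mulr0.
pose Z w : R := limn (fun k => T k w).
have TZ w : T k w @[k --> \oo] --> Z w by exact: cT.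
have mZ : measurable_fun setT Z by apply: (measurable_fun_cvg mT) => w _; exact: TZ.
have key k n : (phi k <= n)%N ->
    (\int[P]_w ((X n w - Z w) ^+ 2)%:E <= (c k)%:E)%E.
  move=> kn.
  pose f j w := ((X n w - T j w) ^+ 2)%:E.
  have mf j : measurable_fun setT (f j).
    apply/measurable_EFinP; apply: measurable_funX; apply: measurable_funB => //.
    exact: L2_measurable (X2 _).
  have f0 j w : (0 <= f j w)%E by rewrite lee_fin sqr_ge0.
  have fZ w : limn_einf (f^~ w) = ((X n w - Z w) ^+ 2)%:E.
    have h : f j w @[j --> \oo] --> ((X n w - Z w) ^+ 2)%:E.
      apply: cvg_EFin; first by exact: nearW.
      have h1 : X n w - T j w @[j --> \oo] --> X n w - Z w.
        by apply: cvgB; [exact: cvg_cst|exact: TZ].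
      rewrite expr2 (_ : fine \o _ = fun j => (X n w - T j w) * (X n w - T j w)).
        by apply: cvgM.
      by apply/funext.
    by have [-> _] := cvg_limn_einf_sup h.
  under eq_integral do rewrite -fZ.
  apply: (le_trans (@fatou _ _ _ P _ measurableT f mf (fun j w _ => f0 j w))).
  have bnd j : (k <= j)%N -> (\int[P]_w f j w <= (c k)%:E)%E.
    move=> kj.
    have -> : (\int[P]_w f j w = \int[P]_w ((X n w - Y j w) ^+ 2)%:E)%E.
      apply: ae_eq_integral => //.
        apply/measurable_EFinP; apply: measurable_funX; apply: measurable_funB => //;
          exact: L2_measurable (X2 _).
      exists (~` A); split => //; first exact: measurableC.
      move=> w /= h Aw; apply: h => _.
      by rewrite /f /T indicE mem_set// mulr1.
    rewrite (sqn_integral (L2B (X2 _) (X2 _))).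
    by rewrite lee_fin; apply: phiP => //; exact: phi_psi.
  rewrite limn_einf_lim; apply: lime_le; first exact: is_cvg_einfs.
  near=> N; apply: le_trans (bnd (maxn k N) (leq_maxl _ _)).
  by apply: ereal_inf_lbound; exists (maxn k N) => //=; exact: leq_maxr.
have Z2 : L2 P Z.
  have XZ2 : L2 P (fun w => X (phi 0%N) w - Z w).
    apply/L2P; split.
      by apply: measurable_funB => //; exact: L2_measurable (X2 _).
    by apply: le_lt_trans (key 0%N _ (leqnn _)) _; rewrite ltry.
  have := L2B (X2 (phi 0%N)) XZ2; congr (L2 P).
  by apply/funext => w; rewrite subKr.
exists Z => //; apply/cvgn_epsP => e; move: (e : R) => {}e e0.
have [k ke] : exists k, c k <= e.
  have : (2^-1 ^+ k : R) @[k --> \oo] --> (0 : R).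
    by apply: cvg_expr; rewrite ger0_norm ?invr_ge0// invf_lt1 ?ltr1n.
  move=> /cvgn_epsP /(_ _ e0) [k hk]; exists k.
  have := hk k (leqnn _); rewrite subr0 ger0_norm ?exprn_ge0 ?invr_ge0// exprVn.
  apply: le_trans; rewrite /c ler_pdivrMr ?ltr0n ?expn_gt0// ler_peMr ?invr_ge0 ?exprn_ge0//.
  by rewrite ler1n expn_gt0.
exists (phi k) => n kn; rewrite subr0 ger0_norm ?ip_ge0//.
rewrite (le_trans _ ke)// -lee_fin -(sqn_integral (L2B (X2 _) Z2)).
exact: key.
Unshelve. all: by end_near. Qed.

End L2_complete.

Section gram_limits.
Context {R : realType} {dO : measure_display} {Omega : measurableType dO}.
Context (P : probability Omega R).

(** The squared norm of V_n - V_m expands into three inner products with limits beta, -2 beta and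
    beta, so the sequence is Cauchy. The clause on h carries centring over to the limit, with h =
    1. *)
Lemma gram_limit {A : Type} (V : nat -> A -> Omega -> R) (beta : A -> A -> R) :
  (forall n a, L2 P (V n a)) ->
  (forall a b, (fun NM => ip P (V NM.1 a) (V NM.2 b)) @ (\oo, \oo) --> beta a b) ->
  exists W : A -> Omega -> R, [/\ forall a, L2 P (W a),
    forall a b, ip P (W a) (W b) = beta a b &
    forall h, L2 P h -> (forall n a, ip P (V n a) h = 0) ->
      forall a, ip P (W a) h = 0].
Proof.
move=> V2 Vb.
have cauchy a (e : R) : 0 < e -> exists N, forall n m, (N <= n)%N -> (N <= m)%N ->
    ip P (fun w => V n a w - V m a w) (fun w => V n a w - V m a w) <= e.
  move=> e0; have e4 : 0 < e / 4 by rewrite divr_gt0.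
  have [K hK] := (cvgn2_epsP _ _).1 (Vb a a) _ e4.
  exists K => n m Kn Km; rewrite ip_sqrB//.
  have := hK _ _ Kn Kn; have := hK _ _ Kn Km; have := hK _ _ Km Km => /=.
  by rewrite !ler_norml => /andP[? ?] /andP[? ?] /andP[? ?]; lra.
have lim a : exists Y, L2 P Y /\
    ip P (fun w => V n a w - Y w) (fun w => V n a w - Y w) @[n --> \oo] --> (0 : R).
  by have [Y Y2 VY] := L2_complete (V2^~ a) (cauchy a); exists Y.
pose W a := sval (cid (lim a)).
have W2 a : L2 P (W a) by rewrite /W; case: cid => Y [].
have VW a : ip P (fun w => V n a w - W a w) (fun w => V n a w - W a w)
    @[n --> \oo] --> (0 : R) by rewrite /W; case: cid => Y [].
exists W; split => // [a b|h h2 Vh a].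
  have := ip_cvg (V2^~ a) (V2^~ b) (W2 a) (W2 b) (VW a) (VW b) => H.
  have := bmean_diag (Vb a b) => /= H'.
  exact: (@cvg_unique _ (@norm_hausdorff _ R^o) _ _ _ _ H H').
have h0 : ip P (fun w => h w - h w) (fun w => h w - h w) @[n --> \oo] --> (0 : R).
  rewrite ip_sqrB// (_ : _ + _ = 0); first exact: cvg_cst.
  by ring.
have H := ip_cvg (V2^~ a) (fun=> h2) (W2 a) h2 (VW a) h0.
apply: (@cvg_unique _ (@norm_hausdorff _ R^o) _ _ _ _ H) => /=.
rewrite (_ : (fun n => _) = fun=> 0); last by apply/funext => n; exact: Vh.
exact: cvg_cst.
Qed.

Lemma mean_ip (f : Omega -> R) : fine 'E_P[f] = ip P f (fun=> 1).
Proof. by rewrite unlock /ip; under [in RHS]eq_integral do rewrite mulr1. Qed.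

Lemma covariance_ip (f g : Omega -> R) : fine (covariance P f g) =
  ip P (fun w => f w - fine 'E_P[f]) (fun w => g w - fine 'E_P[g]).
Proof. by rewrite covariance.unlock {1}expectation.unlock. Qed.

End gram_limits.

(** * Randomized direction of time *)

Section mixture.
Context {R : realType} {dO : measure_display} {Omega : measurableType dO}.
Context (P : probability Omega R).

Definition coin : probability bool R := bernoulli_prob (2^-1 : R).

Definition with_coin := (P \x coin)%E.

Definition mix (F : bool -> Omega -> R) (z : Omega * bool) : R := F z.2 z.1.

Lemma mix_measurable F : (forall b, measurable_fun setT (F b)) ->
  measurable_fun setT (mix F).
Proof.
move=> mF.
rewrite (_ : mix F = fun z => if z.2 then F true z.1 else F false z.1).
  apply: measurable_fun_ifT.
  - exact: measurable_snd.
  - exact: measurableT_comp (mF true) measurable_fst.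
  - exact: measurableT_comp (mF false) measurable_fst.
by apply/funext => -[w []].
Qed.

Lemma integral_mix F : (forall b, L2 P (F b)) ->
  (\int[with_coin]_z (mix F z ^+ 2)%:E)%E =
  (2^-1 * (ip P (F true) (F true) + ip P (F false) (F false)))%:E.
Proof.
move=> F2; rewrite /with_coin fubini_tonelli1; last 2 first.
- apply/measurable_EFinP; apply: measurable_funX; apply: mix_measurable => b.
  exact: L2_measurable (F2 b).
- by move=> z; rewrite lee_fin sqr_ge0.
have h01 : 0 <= (2^-1 : R) <= 1 by rewrite invr_ge0 ler0n invf_le1// ler1n.
rewrite /fubini_F; under eq_integral => w _.
  rewrite integral_bernoulli_prob//; last by move=> b; rewrite lee_fin sqr_ge0.
  over.
have sqr2 b : P.-integrable setT (fun w => (F b w ^+ 2)%:E).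
  exact: Lfun2_integrable_sqr (F2 b).
rewrite integralD//=; last 2 first.
- by apply: integrableZl => //; exact: sqr2.
- by apply: integrableZl => //; exact: sqr2.
rewrite integralZl//; last exact: sqr2.
rewrite integralZl//; last exact: sqr2.
rewrite /mix/= !sqn_integral// -!EFinM -EFinD; congr EFin.
by rewrite /unstable.onem; field.
Qed.

Lemma mix_L2 F : (forall b, L2 P (F b)) -> L2 with_coin (mix F).
Proof.
move=> F2; apply/L2P; split.
  by apply: mix_measurable => b; exact: L2_measurable (F2 b).
by rewrite integral_mix// ltry.
Qed.

Lemma ip_polar {d1 : measure_display} {O1 : measurableType d1}
    (P1 : probability O1 R) (f g : O1 -> R) : L2 P1 f -> L2 P1 g ->
  ip P1 f g = 4^-1 * (ip P1 (fun w => f w + g w) (fun w => f w + g w) -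
                      ip P1 (fun w => f w - g w) (fun w => f w - g w)).
Proof.
move=> f2 g2; have := ip_sqrD 1 f2 g2.
under [X in ip _ X]eq_fun do rewrite mul1r.
under [X in ip _ _ X]eq_fun do rewrite mul1r.
by move=> ->; rewrite ip_sqrB//; field.
Qed.

(** Polarization reduces to squares, whose integrand is nonnegative, so that Tonelli's theorem
    applies. *)
Lemma ip_mix F G : (forall b, L2 P (F b)) -> (forall b, L2 P (G b)) ->
  ip with_coin (mix F) (mix G) =
  2^-1 * (ip P (F true) (G true) + ip P (F false) (G false)).
Proof.
move=> F2 G2.
have sq H : (forall b, L2 P (H b)) -> ip with_coin (mix H) (mix H) =
    2^-1 * (ip P (H true) (H true) + ip P (H false) (H false)).
  by move=> H2; have := integral_mix H2; rewrite sqn_integral ?mix_L2// => -[].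
rewrite ip_polar ?mix_L2//.
rewrite (sq (fun b w => F b w + G b w)); last by move=> b; exact: L2D.
rewrite (sq (fun b w => F b w - G b w)); last by move=> b; exact: L2B.
by rewrite (ip_polar (F2 true) (G2 true)) (ip_polar (F2 false) (G2 false)); ring.
Qed.

End mixture.

Definition random_variable_of {R : realType} {dO : measure_display}
    {Omega : measurableType dO} (P : probability Omega R) (f : Omega -> R)
    (mf : measurable_fun setT f) : {RV P >-> R} :=
  HB.pack f (isMeasurableFun.Build _ _ _ _ _ mf).

(** Both branches of the coin being centred, the covariance is r^2 times the average of B(t - s) and
    B(s - t); the choice r^2 = 2 c compensates the factor 1/2. *)
Lemma stationary_cov_symmetrization {R : realType} {dO : measure_display}
    {Omega : measurableType dO} (P : probability Omega R) (m : nat) (T : zmodType)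
    (W : T -> 'I_m -> Omega -> R) (B : T -> 'M[R]_m) (c : R) :
  0 <= c -> (forall t i, L2 P (W t i)) -> (forall t i, ip P (W t i) (fun=> 1) = 0) ->
  (forall t s i j, ip P (W t i) (W s j) = B (t - s) i j) ->
  stationary_cov (fun t => c *: (B t + B (- t))).
Proof.
move=> c0 W2 W0 WB; pose r := Num.sqrt (2 * c).
pose F t i b w := r * W (if b then t else - t) i w.
have F2 t i b : L2 P (F t i b) by exact: L2Z.
have F0 t i : ip (with_coin P) (mix (F t i)) (fun=> 1) = 0.
  have := ip_mix (F2 t i) (fun=> L2_cst P 1); rewrite (_ : mix (fun=> fun=> 1) = fun=> 1)// => ->.
  by rewrite !ipZl ?W0//; [ring|exact: L2_cst|exact: L2_cst].
have mF t i : measurable_fun setT (mix (F t i)).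
  by apply: mix_measurable => b; exact: L2_measurable (F2 t i b).
exists _, _, (with_coin P), (fun t i => random_variable_of (with_coin P) (mF t i)).
split=> [t i|t s]; first exact: mix_L2.
apply/matrixP => i j; rewrite !mxE covariance_ip !mean_ip /= !F0.
under [X in ip _ X]eq_fun do rewrite subr0.
under [X in ip _ _ X]eq_fun do rewrite subr0.
rewrite -[LHS]/(ip (with_coin P) (mix (F t i)) (mix (F s j))) ip_mix//.
have FW b : ip P (F t i b) (F s j b) =
    r * (r * ip P (W (if b then t else - t) i) (W (if b then s else - s) j)).
  by rewrite /F ipZl ?L2Z// ipC ipZl// ipC.
rewrite !FW !WB.
rewrite (_ : - t - - s = - (t - s)); last by rewrite opprB opprK addrC.
rewrite (_ : 2^-1 * _ = 2^-1 * r ^+ 2 * (B (t - s) i j + B (- (t - s)) i j)); last by ring.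
rewrite sqr_sqrtr ?mulr_ge0//; congr (_ * _).
by field.
Qed.

(** * Isotropic fields *)

Section zonal_functions.
Context {R : realType} {d : nat}.
Hypothesis hd : (0 < d)%N.

(** The ratio of the zonal functions of the statement to the polynomials normalized at 1. *)
Definition zscale n : R := if d == 1%N then 1 else @geg1 R d n.

Lemma zscale_gt0 n : 0 < zscale n.
Proof. by rewrite /zscale; case: ifP => // _; exact: geg1_gt0. Qed.

Lemma cos_multiple n (t : R) : cos (n%:R * t) = (ngeg R 1 n).[cos t].
Proof.
suff : cos (n%:R * t) = (ngeg R 1 n).[cos t] /\
       cos (n.+1%:R * t) = (ngeg R 1 n.+1).[cos t] by case.
elim: n => [|n [IH0 IH1]]; first by rewrite mul0r cos0 mul1r ngeg0 ngeg1 hornerC hornerX.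
split => //.
have /(congr1 (horner^~ (cos t))) := ngegSS R 1 n.
rewrite !(hornerD, hornerN, hornerZ, hornerM, hornerX) -IH0 -IH1 /= addn0 => h.
have h0 : n.+1%:R != 0 :> R by rewrite pnatr_eq0.
apply: (mulfI h0); rewrite addn0 in h; rewrite h natrM.
have -> : n.+2%:R * t = n.+1%:R * t + t by rewrite -natr1 mulrDl mul1r.
have -> : n%:R * t = n.+1%:R * t - t by rewrite -natr1 mulrDl mul1r addrK.
by rewrite cosD cosB; ring.
Qed.

Lemma zonalE n (t : R) : zonal d n t = zscale n * (ngeg R d n).[cos t].
Proof.
rewrite /zonal /zscale; case: eqVneq => [->|d1]; first by rewrite mul1r cos_multiple.
have hd1 : (1 < d)%N by rewrite ltn_neqAle eq_sym d1.
by rewrite gegenbauerE// ?ler_norml ?cos_geN1 ?cos_le1// /geg hornerZ.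
Qed.

Lemma zonal_at_oneE n : zonal_at_one R d n = zonal d n (0 : R).
Proof. by rewrite /zonal_at_one /zonal mulr0 cos0. Qed.

End zonal_functions.

(** * Expansion of the covariance of an isotropic field *)

Section random_field_expansion.
Context {R : realType} {m d : nat} {T : zmodType}.
Hypothesis hd : (0 < d)%N.
Context {dO : measure_display} {Omega : measurableType dO}.
Context {P : probability Omega R}.
Context (Z : 'cV[R]_d.+1 -> T -> random_vector P m) (C : R -> T -> 'M[R]_m).
Hypothesis hZ2 : second_order_field Z.
Hypothesis hZiso : isotropic_stationary Z C.
Hypothesis hZcont : mean_square_continuous Z.
Notation V := 'cV[R]_d.+1.
Notation S := (sphere R d).
Notation J := (T * 'I_m)%type.

(** The centred field, set to 0 off the sphere, where Z is unconstrained, so that every value is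
    square integrable and centred. *)
Let X (x : V) (a : J) (w : Omega) : R :=
  if `[< S x >] then Z x a.1 a.2 w - fine 'E_P[Z x a.1 a.2] else 0.

Let X_sphere x a : S x -> X x a = fun w => Z x a.1 a.2 w - fine 'E_P[Z x a.1 a.2].
Proof. by move=> Sx; apply/funext => w; rewrite /X asboolT. Qed.

Let X_L2 x a : L2 P (X x a).
Proof.
have [Sx|nSx] := pselect (S x).
  by rewrite X_sphere//; apply: L2B; [exact: hZ2|exact: L2_cst].
by rewrite (_ : X x a = fun=> 0); [exact: L2_cst|apply/funext => w; rewrite /X asboolF].
Qed.

Let X_mean x a : ip P (X x a) (fun=> 1) = 0.
Proof.
have [Sx|nSx] := pselect (S x).
  rewrite X_sphere// ipBl; [|exact: hZ2|exact: L2_cst|exact: L2_cst].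
  by rewrite -!mean_ip expectation_cst subrr.
rewrite (_ : X x a = fun=> 0); last by apply/funext => w; rewrite /X asboolF.
by rewrite -mean_ip expectation_cst.
Qed.

Let X_cov x y a b : S x -> S y ->
  ip P (X x a) (X y b) = C (acos (dot x y)) (a.1 - b.1) a.2 b.2.
Proof.
move=> Sx Sy; rewrite !X_sphere// -covariance_ip.
by rewrite -(hZiso.2 x y a.1 b.1 Sx Sy) mxE.
Qed.

(* The kernel is extended outside [-1, 1] by its boundary values. *)
Let clamp (u : R) : R := Num.max (-1) (Num.min 1 u).

Let clamp_itv u : -1 <= clamp u <= 1.
Proof. by rewrite /clamp le_max lexx/= ge_max ge_min lexx /= andbT; lra. Qed.

Let clamp_id u : -1 <= u <= 1 -> clamp u = u.
Proof. by move=> /andP[h1 h2]; rewrite /clamp min_r// max_r. Qed.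

Let K (a b : J) (u : R) : R := ip P (X (meridian (clamp u)) a) (X pole b).

Let K_C a b u : K a b u = C (acos (clamp u)) (a.1 - b.1) a.2 b.2.
Proof.
have Sm := sphere_meridian hd (clamp_itv u).
by rewrite /K (X_cov _ _ Sm sphere_pole) dotC dot_meridian.
Qed.

Let K_dot a b x y : S x -> S y -> K a b (dot x y) = ip P (X x a) (X y b).
Proof. by move=> Sx Sy; rewrite K_C X_cov// clamp_id// dot_sphere. Qed.

(** Exchanging the indices amounts to exchanging the two points, and the covariance depends on these
    through their angle. *)
Let K_sym a b u : K a b u = K b a u.
Proof.
have Sm := sphere_meridian hd (clamp_itv u).
by rewrite [RHS]/K ipC (X_cov _ _ sphere_pole Sm) dot_meridian// K_C.
Qed.

Let eq_fint_Forall {A : Type} (s : seq (R * A)) f g :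
  List.Forall (fun p => f p.2 = g p.2) s -> fint s f = fint s g.
Proof. by rewrite /fint; elim => [|p l h _ IH]; rewrite ?big_nil// !big_cons h IH. Qed.

(** The form is the squared norm of the corresponding combination of values of the field. *)
Let K_psd (s : seq (R * (V * J))) : on_sphere s -> 0 <= qform K s s.
Proof.
move=> sS; rewrite (_ : qform K s s =
    ip P (fun w => fint s (fun p => X p.1 p.2 w)) (fun w => fint s (fun p => X p.1 p.2 w))).
  exact: ip_ge0.
have X2 (p : V * J) : L2 P (X p.1 p.2) by exact: X_L2.
rewrite ip_fintl//; last exact: L2_fint.
rewrite /qform; apply: eq_fint_Forall; apply: List.Forall_impl (sS) => p Sp.
rewrite ipC ip_fintl//.
apply: eq_fint_Forall; apply: List.Forall_impl sS => q Sq.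
by rewrite (K_dot _ _ Sp Sq) ipC.
Qed.

Let clamp_continuous : continuous clamp.
Proof.
move=> u; apply: (@continuous_max R R (fun=> -1) (fun v => Num.min 1 v)); first exact: cvg_cst.
by apply: (@continuous_min R R (fun=> 1) id); [exact: cvg_cst|exact: cvg_id].
Qed.

Let meridian_continuous : continuous (fun u : R => meridian u : V).
Proof.
move=> u; rewrite /meridian; apply: cvgD; apply: cvgZr_tmp; first exact: cvg_id.
have h : 1 - v ^+ 2 @[v --> u] --> 1 - u ^+ 2.
  by apply: cvgB; [exact: cvg_cst|exact: exprn_continuous].
exact: (cvg_comp _ _ h (@sqrt_continuous R (1 - u ^+ 2))).
Qed.

(** One component is dominated by the whole mean square distance; centring drops out as the mean is
    constant over the sphere. *)
Let X_continuous x0 a (e : R) : S x0 -> 0 < e ->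
  \forall x \near within S (nbhs x0),
    ip P (fun w => X x a w - X x0 a w) (fun w => X x a w - X x0 a w) < e.
Proof.
move=> Sx0 e0; have := hZcont a.1 Sx0.
have e0' : (0%E < e%:E)%E by rewrite lte_fin.
move=> /(_ _ (open_ereal_lt' e0')); rewrite !nbhs_simpl /=.
move=> near0; apply: (@filterS _ (nbhs x0) _ _ _ _ near0) => x /= h Sx.
rewrite -lte_fin; apply: le_lt_trans (h Sx).
rewrite -sqn_integral; last exact: L2B.
rewrite /msq_dist unlock.
have mZ y i : S y -> measurable_fun setT (Z y a.1 i : Omega -> R) by [].
apply: ge0_le_integral => //.
- by move=> w _; rewrite lee_fin sqr_ge0.
- apply/measurable_EFinP; apply: measurable_funX; apply: measurable_funB;
    exact: L2_measurable (X_L2 _ _).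
- apply/measurable_EFinP; apply: measurable_sum => i.
  by apply: measurable_funX; apply: measurable_funB.
move=> w _; rewrite lee_fin !X_sphere//.
have -> : fine 'E_P[Z x a.1 a.2] = fine 'E_P[Z x0 a.1 a.2].
  have [[mu hmu] _] := hZiso.
  have := hmu x a.1 Sx; rewrite -(hmu x0 a.1 Sx0) => /matrixP /(_ a.2 ord0).
  by rewrite !mxE.
rewrite (bigD1 a.2)//= (_ : _ - _ - _ = Z x a.1 a.2 w - Z x0 a.1 a.2 w); last by ring.
by rewrite lerDl sumr_ge0// => i _; exact: sqr_ge0.
Qed.

(** One point stays at the pole while the other moves along the meridian; Cauchy-Schwarz reduces the
    claim to mean square continuity. *)
Let K_continuous a b : continuous (K a b).
Proof.
move=> u0; apply/cvgrPdist_le => /= e e0.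
have Sm u : S (meridian (clamp u)) by exact: sphere_meridian (clamp_itv u).
(* The added 1 keeps the divisor positive when the variance is 0. *)
pose c := ip P (X pole b) (X pole b) + 1.
have c0 : 0 < c by rewrite ltr_wpDl ?ip_ge0.
have ec : 0 < e ^+ 2 / c by rewrite divr_gt0// exprn_gt0.
have near0 := X_continuous a (Sm u0) ec.
have mc : meridian (clamp u) @[u --> u0] --> (meridian (clamp u0) : V).
  exact: (cvg_comp _ _ (@clamp_continuous u0) (@meridian_continuous (clamp u0))).
have := mc _ near0; rewrite nbhs_simpl /=; apply: filterS => u /= /(_ (Sm u)) h.
rewrite distrC.
rewrite /K -ipBl//.
rewrite -ler_sqr ?nnegrE ?normr_ge0 ?(ltW e0)// real_normK ?num_real//.
apply: (le_trans (ip_cauchy_schwarz (L2B (X_L2 _ _) (X_L2 _ _)) (X_L2 _ _))).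
apply: (@le_trans _ _ (e ^+ 2 / c * c)); last by rewrite divfK// gt_eqF.
by apply: ler_pM; rewrite ?ip_ge0// ?(ltW h)// lerDl.
Qed.

Let K_appr a b : poly_approx (K a b).
Proof. exact/weierstrass/K_continuous. Qed.

Let zcoefK n (t : T) : 'M[R]_m := \matrix_(i, j) @zcoef R d (K (t, i) (0, j)) n.

Let zcoefKE n t s i j : @zcoef R d (K (t, i) (s, j)) n = zcoefK n (t - s) i j.
Proof. by rewrite mxE; apply: eq_zcoef => u _; rewrite !K_C /= subr0. Qed.

(** Symmetry of K exchanges the components together with the times. This is what makes the sum over
    t and -t in [B] a symmetric matrix. *)
Let zcoefK_tr n t : (zcoefK n t)^T = zcoefK n (- t).
Proof.
apply/matrixP => i j; rewrite !mxE (zcoef_sym K_sym).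
by rewrite zcoefKE mxE sub0r.
Qed.

Let harm n (x : V) : R := (ngeg R d n).[dot pole x].

(** Inner products of the finite means are double means of K against Q_n in both variables, so
    [bmean_zonal] supplies the limits that [gram_limit] requires. *)
Let harm_gram n : exists W : J -> Omega -> R, [/\ forall a, L2 P (W a),
  forall a, ip P (W a) (fun=> 1) = 0 &
  forall a b, ip P (W a) (W b) = @zcoef R d (K a b) n * @kappa R d n].
Proof.
pose V0 N (a : J) w := fint (unif N) (fun x => harm n x * X x a w).
have hX2 a x : L2 P (fun w => harm n x * X x a w) by exact: L2Z.
have V2 N a : L2 P (V0 N a) by exact: L2_fint.
have V0ip N a h : L2 P h ->
    ip P (V0 N a) h = fint (unif N) (fun x => harm n x * ip P (X x a) h).
  by move=> h2; rewrite ip_fintl//; apply: eq_fint => x; rewrite ipZl.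
have Vb a b : (fun NM => ip P (V0 NM.1 a) (V0 NM.2 b)) @ (\oo, \oo) -->
    @zcoef R d (K a b) n * @kappa R d n.
  rewrite (_ : (fun NM => _) =
      bmean (fun x y => K a b (dot x y) * (harm n x * harm n y))).
    have := @bmean_zonal R d hd _ n n (K_appr a b).
    by rewrite eqxx (_ : true%:R = 1 :> R)// mul1r.
  apply/funext => -[N M].
  rewrite /bmean /= V0ip//; apply: fprob_eq (unif_prob N) _ => x Sx.
  rewrite ipC V0ip// -fintZ; apply: fprob_eq (unif_prob M) _ => y Sy.
  by rewrite K_dot// ipC /harm; ring.
have [W [W2 Wb W1]] := gram_limit V2 Vb.
exists W; split => // a; apply: W1; first exact: L2_cst.
by move=> N b; rewrite V0ip ?L2_cst// /fint big1// => x _; rewrite X_mean !mulr0.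
Qed.

(** Dividing by [kappa n] turns [zcoef] into a series coefficient, dividing by [zscale n] passes
    from Q_n to the zonal function of the statement, and dividing by 2 averages over t and -t. *)
Let scale n : R := (2 * @kappa R d n * @zscale R d n)^-1.

Let B n (t : T) : 'M[R]_m := scale n *: (zcoefK n t + zcoefK n (- t)).

Let B_stationary n : stationary_cov (B n).
Proof.
have [W [W2 W1 Wb]] := harm_gram n.
have kp := @kappa_gt0 R d hd n; have zp := @zscale_gt0 R d n.
rewrite (_ : B n = fun t => (scale n / @kappa R d n) *:
  ((@kappa R d n *: zcoefK n t) + (@kappa R d n *: zcoefK n (- t)))).
  apply: (@stationary_cov_symmetrization _ _ _ P _ _ (fun t i => W (t, i))
            (fun t => @kappa R d n *: zcoefK n t)) => //.
    by rewrite divr_ge0 ?invr_ge0 ?mulr_ge0 ?ltW.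
  by move=> t s i j; rewrite Wb zcoefKE [RHS]mxE mulrC.
by apply/funext => t; rewrite -scalerDr scalerA divfK// gt_eqF.
Qed.

Let B_series (theta : R) (t : T) : 0 <= theta <= pi ->
  mxseries_to (fun n => zonal d n theta *: B n t) (2^-1 *: (C theta t + C theta (- t))).
Proof.
move=> th i j.
have cos1 : -1 <= cos theta <= 1 by rewrite cos_geN1 cos_le1.
have H s := @zonal_series R d hd J K K_psd K_sym K_appr (s, i) (0, j) (cos theta) cos1.
have KC s : K (s, i) (0, j) (cos theta) = C theta s i j.
  by rewrite K_C /= subr0 clamp_id// cosK// in_itv.
have H1 : 2^-1 * (series (fun n => @zcoef R d (K (t, i) (0, j)) n / @kappa R d n *
        (ngeg R d n).[cos theta]) N +
      series (fun n => @zcoef R d (K (- t, i) (0, j)) n / @kappa R d n *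
        (ngeg R d n).[cos theta]) N) @[N --> \oo] -->
    2^-1 * (K (t, i) (0, j) (cos theta) + K (- t, i) (0, j) (cos theta)).
  by apply: cvgMr; apply: cvgD; [exact: (H t)|exact: (H (- t))].
rewrite !KC in H1; rewrite !mxE.
rewrite (_ : series _ = fun N => 2^-1 *
    (series (fun n => @zcoef R d (K (t, i) (0, j)) n / @kappa R d n *
        (ngeg R d n).[cos theta]) N +
      series (fun n => @zcoef R d (K (- t, i) (0, j)) n / @kappa R d n *
        (ngeg R d n).[cos theta]) N)) //.
apply/funext => N; rewrite /series/= -big_split/= mulr_sumr; apply: eq_bigr => n _.
have kp := @kappa_gt0 R d hd n; have zp := @zscale_gt0 R d n.
rewrite /B !mxE (zonalE hd) /scale; move: kp zp.
set k := kappa n; set z := zscale n; move: k z => k z k0 z0.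
field.
by rewrite !gt_eqF.
Qed.

Lemma symmetrized_expansion : exists B0 : nat -> T -> 'M[R]_m,
  zonal_expansion d (fun theta t => 2^-1 *: (C theta t + C theta (- t))) B0.
Proof.
exists B; split => [theta t|t n|t|n].
- exact: B_series.
- by rewrite /B linearZ/= linearD/= !zcoefK_tr opprK addrC.
(* Convergence at 1 is the expansion at theta = 0. *)
- exists (2^-1 *: (C 0 t + C 0 (- t))).
  have -> : (fun n => zonal_at_one R d n *: B n t) = fun n => zonal d n 0 *: B n t.
    by apply/funext => n; rewrite zonal_at_oneE.
  by apply: B_series; rewrite lexx pi_ge0.
- exact: B_stationary.
Qed.

End random_field_expansion.

Theorem theorem1 (R : realType) (m d : nat) (hm : (0 < m)%N) (hd : (0 < d)%N)
    (k : time_domain)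
    (dO : measure_display) (Omega : measurableType dO)
    (P : probability Omega R)
    (Z : 'cV[R]_d.+1 -> time R k -> random_vector P m)
    (C : R -> time R k -> 'M[R]_m)
    (hZ2 : second_order_field Z)
    (hZiso : isotropic_stationary Z C)
    (hZcont : mean_square_continuous Z) :
  (exists B : nat -> time R k -> 'M[R]_m,
     zonal_expansion d (fun theta t => 2^-1 *: (C theta t + C theta (- t))) B) /\
  ((forall theta t, 0 <= theta <= pi -> C theta (- t) = C theta t) ->
   exists B : nat -> time R k -> 'M[R]_m, zonal_expansion d C B).
Proof.
have [B hB] := symmetrized_expansion hd hZ2 hZiso hZcont.
split=> [|Csym]; first by exists B.
have [h1 h2 h3 h4] := hB.
exists B; split => // theta t th.
have := h1 theta t th.
rewrite (Csym _ _ th) scalerDr -scalerDl (_ : 2^-1 + 2^-1 = 1 :> R) ?scale1r//.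
by field.
Qed.
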